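(* For every bounded continuous function $f\colon\mathrm{SL}_d(\mathbb{Q})\backslash\mathrm{SL}_d(\mathbb{A})\to\mathbb{R}$, every $M\in\mathrm{SL}_d(\mathbb{A})$ and every Borel probability measure $\lambda$ on $S^{d-1}$ absolutely continuous with respect to Lebesgue measure, $$\lim_{t\to\infty}\int_{S^{d-1}}f\big(M\,\iota(K(\bm v)\Phi^t)\big)\,d\lambda(\bm v)=\int_{\mathrm{SL}_d(\mathbb{Q})\backslash\mathrm{SL}_d(\mathbb{A})}f\,d\mu,$$ where $f(g)$ for $g\in\mathrm{SL}_d(\mathbb{A})$ means $f$ evaluated at the coset $\mathrm{SL}_d(\mathbb{Q})g$.
   Context: $d\ge2$; $\mathbb{A}$ denotes the adeles of $\mathbb{Q}$, $\iota\colon\mathrm{SL}_d(\mathbb{R})\to\mathrm{SL}_d(\mathbb{A})$, $M\mapsto(M,I_d,I_d,\ldots)$ is the embedding at the real place, and $\mathrm{SL}_d(\mathbb{Q})$ is embedded diagonally. $\Phi^t=\mathrm{diag}(e^{-(d-1)t},e^t,\ldots,e^t)$. $K\colon S^{d-1}\to\mathrm{SO}(d)$ is a fixed map with $\bm vK(\bm v)=(1,0,\ldots,0)$ (row vectors) for all $\bm v$, smooth on the sphere minus one point. $\mu$ is the invariant probability measure on $\mathrm{SL}_d(\mathbb{Q})\backslash\mathrm{SL}_d(\mathbb{A})$. *)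

(* Defs.v *)
From HB Require Import structures.
From mathcomp Require Import all_boot all_order all_algebra.
From mathcomp Require Import generic_quotient ring_quotient.
From mathcomp Require Import all_classical all_reals all_analysis.

Set Implicit Arguments.
Unset Strict Implicit.
Unset Printing Implicit Defensive.

Import Order.TTheory GRing.Theory Num.Theory.
Import numFieldNormedType.Exports.

Local Open Scope classical_set_scope.
Local Open Scope ring_scope.

Record prime_number := PrimeNumber {
  prime_val :> nat ;
  prime_valP : prime prime_val }.

Section padic_abs.
Variable p : prime_number.
Implicit Types x y : rat.

Definition padic_abs x : rat :=
  if x == 0 then 0
  else p%:R ^ ((logn p `|denq x|)%:Z - (logn p `|numq x|)%:Z).

Lemma prime_gt0r : (0 : rat) < p%:R.
Proof. by rewrite ltr0n prime_gt0// prime_valP. Qed.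

Lemma padic_abs0 : padic_abs 0 = 0.
Proof. by rewrite /padic_abs eqxx. Qed.

Lemma padic_absE (a b : int) : a != 0 -> b != 0 ->
  padic_abs (a%:~R / b%:~R) = p%:R ^ ((logn p `|b|)%:Z - (logn p `|a|)%:Z).
Proof.
move=> a0 b0; rewrite /padic_abs.
have aQ : (a%:~R : rat) != 0 by rewrite intr_eq0.
have bQ : (b%:~R : rat) != 0 by rewrite intr_eq0.
have x0 : a%:~R / b%:~R != 0 :> rat by rewrite mulf_neq0// invr_eq0.
rewrite (negbTE x0); congr (_ ^ _).
set x := a%:~R / b%:~R in x0 *.
have : (numq x * b)%:~R = (a * denq x)%:~R :> rat.
  by rewrite !intrM numqE mulrAC divfK.
move/eqP; rewrite eqr_int => /eqP /(congr1 absz); rewrite !abszM => /(congr1 (logn p)).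
rewrite !lognM ?absz_gt0 ?numq_eq0 ?denq_neq0// => /(congr1 Posz).
rewrite !PoszD => h; apply/eqP.
by rewrite subr_eq addrAC eq_sym subr_eq addrC h addrC.
Qed.

Lemma padic_absM x y : padic_abs (x * y) = padic_abs x * padic_abs y.
Proof.
have [->|x0] := eqVneq x 0; first by rewrite mul0r padic_abs0 mul0r.
have [->|y0] := eqVneq y 0; first by rewrite mulr0 padic_abs0 mulr0.
rewrite -{1}(divq_num_den x) -{1}(divq_num_den y) mulf_div -!intrM.
rewrite padic_absE ?mulf_neq0 ?numq_eq0 ?denq_neq0//.
rewrite /padic_abs (negbTE x0) (negbTE y0) !abszM !lognM ?absz_gt0 ?numq_eq0 ?denq_neq0//.
rewrite -expfzDr ?(gt_eqF prime_gt0r)//; congr (_ ^ _).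
by rewrite !PoszD opprD addrACA.
Qed.

Lemma padic_abs_ge0 x : 0 <= padic_abs x.
Proof. by rewrite /padic_abs; case: ifP => // _; rewrite exprz_ge0// ltW// prime_gt0r. Qed.

Lemma padic_abs_eq0 x : (padic_abs x == 0) = (x == 0).
Proof.
rewrite /padic_abs; case: ifP => [_|_]; first by rewrite eqxx.
by rewrite expfz_eq0 (gt_eqF prime_gt0r) andbF.
Qed.

Lemma padic_abs1 : padic_abs 1 = 1.
Proof.
have := padic_absM 1 1; rewrite mulr1 => /eqP.
by rewrite -subr_eq0 -{1}[padic_abs 1]mulr1 -mulrBr mulf_eq0 padic_abs_eq0 oner_eq0 /= subr_eq0 eq_sym => /eqP.
Qed.

Lemma padic_absN x : padic_abs (- x) = padic_abs x.
Proof. by rewrite /padic_abs oppr_eq0 numqN denqN abszN. Qed.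

Lemma padic_absD x y : padic_abs (x + y) <= Num.max (padic_abs x) (padic_abs y).
Proof.
have [->|x0] := eqVneq x 0; first by rewrite add0r le_max lexx orbT.
have [->|y0] := eqVneq y 0; first by rewrite addr0 le_max lexx.
have [->|xy0] := eqVneq (x + y) 0; first by rewrite padic_abs0 le_max padic_abs_ge0.
have px : x = (numq x * denq y)%:~R / (denq x * denq y)%:~R.
  by rewrite !intrM -mulf_div divff ?intr_eq0 ?denq_neq0// mulr1 divq_num_den.
have py : y = (numq y * denq x)%:~R / (denq x * denq y)%:~R.
  by rewrite !intrM [(denq x)%:~R * _]mulrC -mulf_div divff ?intr_eq0 ?denq_neq0// mulr1 divq_num_den.
set d := denq x * denq y in px py.
set a := numq x * _ in px; set b := numq y * _ in py.
have d0 : d != 0 by rewrite mulf_neq0// denq_neq0.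
have a0 : a != 0 by rewrite mulf_neq0// ?denq_neq0// numq_eq0.
have b0 : b != 0 by rewrite mulf_neq0// ?denq_neq0// numq_eq0.
have pxy : x + y = (a + b)%:~R / d%:~R by rewrite {1}px {1}py -mulrDl -intrD.
have ab0 : a + b != 0.
  by apply: contraNneq xy0 => ab0; rewrite pxy ab0 mul0r.
rewrite pxy {1}px {1}py !padic_absE//.
have p1 : 1 <= p%:R :> rat by rewrite ler1n prime_gt0// prime_valP.
have key : (minn (logn p (absz (a : int))) (logn p (absz (b : int))) <= logn p (absz (a + b : int)))%N.
  rewrite -pfactor_dvdn ?prime_valP ?absz_gt0//.
  set k := minn _ _.
  have ka : (p ^ k %| (absz (a : int)))%N by rewrite pfactor_dvdn ?prime_valP ?absz_gt0// geq_minl.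
  have kb : (p ^ k %| (absz (b : int)))%N by rewrite pfactor_dvdn ?prime_valP ?absz_gt0// geq_minr.
  have : ((p ^ k)%N%:Z %| a + b)%Z by rewrite rpredD// dvdzE.
  by rewrite dvdzE.
rewrite le_max; case: (leqP (logn p (absz (a : int))) (logn p (absz (b : int)))) => ab.
  rewrite (minn_idPl ab) in key; apply/orP; left.
  by rewrite ler_weXz2l// lerD2l lerN2 lez_nat.
rewrite (minn_idPr (ltnW ab)) in key; apply/orP; right.
by rewrite ler_weXz2l// lerD2l lerN2 lez_nat.
Qed.

Lemma padic_absB x y : padic_abs (x - y) <= Num.max (padic_abs x) (padic_abs y).
Proof. by rewrite -(padic_absN y) padic_absD. Qed.

Lemma padic_abs_dist x y : padic_abs (x - y) < padic_abs x ->
  padic_abs y = padic_abs x.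
Proof.
move=> h; apply/eqP; rewrite eq_le; apply/andP; split.
  have -> : y = x - (x - y) by rewrite opprB addrC subrK.
  by apply: le_trans (padic_absB _ _) _; rewrite ge_max lexx ltW.
have := padic_absD (x - y) y; rewrite subrK le_max => /orP[|//].
by rewrite leNgt h.
Qed.

Lemma padic_abs_cofinite x : (`|denq x| < p)%N -> padic_abs x <= 1.
Proof.
move=> xp; rewrite /padic_abs; case: ifP => [//|_].
rewrite (_ : logn p `|denq x| = 0%N); last first.
  rewrite lognE prime_valP; case: ifP => // /and3P[_ d0 /(dvdn_leq d0)].
  by rewrite leqNgt xp.
rewrite sub0r -exprnN -exprVn exprn_ile1 ?invr_ge0 ?ler0n//.
by rewrite invf_le1 ?prime_gt0r// ler1n prime_gt0// prime_valP.
Qed.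

End padic_abs.

Section cauchy_sequences.
Variable p : prime_number.
Local Notation vp := (padic_abs p).

Definition padic_cauchy : {pred nat -> rat} := fun u =>
  `[< forall e, 0 < e -> exists N, forall m n, (N <= m)%N -> (N <= n)%N ->
        vp (u m - u n) < e >].

Lemma padic_cauchy_bounded u : u \in padic_cauchy ->
  exists2 B, 0 < B & forall n, vp (u n) <= B.
Proof.
move=> /asboolP/(_ 1 ltr01)[N HN].
exists (Num.max 1 (\big[Num.max/1]_(i < N.+1) vp (u i))).
  by rewrite lt_max ltr01.
move=> n; rewrite le_max; have [nN|Nn] := ltnP n N.+1.
  apply/orP; right; have -> : n = Ordinal nN by [].
  by apply: (le_bigmax _ (fun i : 'I_N.+1 => vp (u i))).
have := padic_absD p (u n - u N) (u N); rewrite subrK le_max => /orP[h|h].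
  by rewrite (le_trans h)// ltW// HN// ltnW.
apply/orP; right; apply: le_trans h _.
by apply: (le_bigmax _ (fun i : 'I_N.+1 => vp (u i)) ord_max).
Qed.

Lemma padic_cauchy_subring : subring_closed padic_cauchy.
Proof.
split.
- apply/asboolP => e e0; exists 0%N => m n _ _.
  by rewrite subrr padic_abs0.
- move=> u v /asboolP cu /asboolP cv; apply/asboolP => e e0.
  have [N HN] := cu _ e0; have [M HM] := cv _ e0.
  exists (maxn N M) => m n; rewrite !geq_max => /andP[Nm Mm] /andP[Nn Mn].
  have -> : (u - v) m - (u - v) n = (u m - u n) - (v m - v n).
    by rewrite /= opprD opprK opprB addrACA [v n - _]addrC.
  by apply: le_lt_trans (padic_absB _ _ _) _; rewrite gt_max HN// HM.
- move=> u v cu cv; apply/asboolP => e e0.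
  have [A A0 uA] := padic_cauchy_bounded cu.
  have [B B0 vB] := padic_cauchy_bounded cv.
  move/asboolP : cu => /(_ (e / B) (divr_gt0 e0 B0))[N HN].
  move/asboolP : cv => /(_ (e / A) (divr_gt0 e0 A0))[M HM].
  exists (maxn N M) => m n; rewrite !geq_max => /andP[Nm Mm] /andP[Nn Mn].
  have -> : (u * v) m - (u * v) n = (u m - u n) * v m + u n * (v m - v n).
    by rewrite mulrBl mulrBr addrA subrK.
  apply: le_lt_trans (padic_absD _ _ _) _; rewrite !padic_absM gt_max.
  apply/andP; split.
    apply: le_lt_trans (_ : _ <= vp (u m - u n) * B) _.
      by rewrite ler_wpM2l// padic_abs_ge0.
    by rewrite -ltr_pdivlMr// HN.
  apply: le_lt_trans (_ : _ <= A * vp (v m - v n)) _.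
    by rewrite ler_wpM2r// padic_abs_ge0.
  by rewrite mulrC -ltr_pdivlMr// HM.
Qed.

HB.instance Definition _ :=
  GRing.isSubringClosed.Build (nat -> rat) padic_cauchy padic_cauchy_subring.

Record cauchy_seq := CauchySeq {
  cauchy_val :> nat -> rat ;
  cauchy_valP : cauchy_val \in padic_cauchy }.

HB.instance Definition _ := [isSub for cauchy_val].
HB.instance Definition _ := [Choice of cauchy_seq by <:].
HB.instance Definition _ := [SubChoice_isSubComNzRing of cauchy_seq by <:].

Definition padic_null : {pred cauchy_seq} := fun u =>
  `[< forall e, 0 < e -> exists N, forall n, (N <= n)%N -> vp (u n) < e >].

Lemma padic_null_ideal : idealr_closed padic_null.
Proof.
split.
- by apply/asboolP => e e0; exists 0%N => n _; rewrite padic_abs0.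
- apply/negP => /asboolP/(_ 1 ltr01)[N /(_ N (leqnn _))].
  by rewrite padic_abs1 ltxx.
- move=> a u v /asboolP nu /asboolP nv; apply/asboolP => e e0.
  have [A A0 aA] := padic_cauchy_bounded (cauchy_valP a).
  have [N HN] := nu _ (divr_gt0 e0 A0); have [M HM] := nv _ e0.
  exists (maxn N M) => n; rewrite !geq_max => /andP[Nn Mn].
  apply: le_lt_trans (padic_absD _ _ _) _; rewrite gt_max HM// andbT padic_absM.
  apply: le_lt_trans (_ : _ <= A * vp (u n)) _.
    by rewrite ler_wpM2r// padic_abs_ge0.
  by rewrite mulrC -ltr_pdivlMr// HN.
Qed.

HB.instance Definition _ :=
  isIdealr.Build cauchy_seq padic_null padic_null_ideal.

(* Q_p as the completion of Q: Cauchy sequences modulo null sequences. *)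
Definition padic := {ideal_quot padic_null}.

HB.instance Definition _ := GRing.ComNzRing.on padic.
HB.instance Definition _ := Quotient.on padic.

Lemma padic_null_dist (u v : cauchy_seq) :
  (u = v %[mod padic])%qT -> u - v \in padic_null.
Proof. by move=> /eqP; rewrite -Quotient.idealrBE. Qed.

(* |x|_p = lim |u_n|_p for any representative u. The sequence |u_n|_p is
   eventually constant unless u is a null sequence, in which case xget can only
   return 0; see padic_normE and padic_norm0 below. *)
Definition padic_norm (x : padic) : rat :=
  xget 0 [set c | \forall n \near \oo, vp ((repr x : cauchy_seq) n) = c].

End cauchy_sequences.

Section padic_norm_theory.
Variable p : prime_number.
Local Notation vp := (padic_abs p).
Local Notation "\pip u" := (\pi_(padic p)%qT u : padic p) (at level 10).
Implicit Types (u v : cauchy_seq p) (x y : padic p).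

Lemma padic_pi_eq0 u : (\pip u == 0) = (u \in padic_null (p := p)).
Proof. by rewrite -[0](raddf0 \pi_(padic p)%qT) -Quotient.idealrBE subr0. Qed.

Lemma padic_normE u : \pip u != 0 ->
  0 < padic_norm (\pip u) /\
  exists N, forall n, (N <= n)%N -> vp (u n) = padic_norm (\pip u).
Proof.
rewrite padic_pi_eq0 => /asboolPn/existsNP[e /not_implyP[e0 /forallNP unz]].
have /asboolP/(_ e e0)[N HN] := cauchy_valP u.
have /existsNP[n0 /not_implyP[Nn0 /negP]] := unz N; rewrite -leNgt => en0.
have uE n : (N <= n)%N -> vp (u n) = vp (u n0).
  by move=> Nn; apply: padic_abs_dist; rewrite (lt_le_trans (HN _ _ Nn0 Nn)).
have c0 : 0 < vp (u n0) by exact: lt_le_trans en0.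
suff -> : padic_norm (\pip u) = vp (u n0) by split => //; exists N.
have /asboolP/(_ _ c0)[M HM] : u - repr (\pip u) \in padic_null (p := p).
  by apply: padic_null_dist; rewrite reprK.
have vE n : (maxn M N <= n)%N -> vp ((repr (\pip u) : cauchy_seq p) n) = vp (u n0).
  rewrite geq_max => /andP[Mn Nn]; rewrite -(uE n Nn).
  by apply: padic_abs_dist; rewrite (uE n Nn) HM.
apply: xget_subset1.
  by exists (maxn M N).
move=> c d [K _ HK] [L _ HL].
by rewrite -(HK (maxn K L)) ?HL//= ?leq_maxl ?leq_maxr.
Qed.

Lemma padic_norm0 : padic_norm (0 : padic p) = 0.
Proof.
rewrite /padic_norm; case: xgetP => [c _ [N _ HN]|//].
apply/eqP/negPn/negP => c0.
have : repr (0 : padic p) \in padic_null (p := p).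
  by rewrite -padic_pi_eq0 reprK.
have cp : 0 < c by rewrite lt_neqAle eq_sym c0 -(HN N)//= padic_abs_ge0.
move=> /asboolP/(_ c cp)[M HM].
by have := HM (maxn N M) (leq_maxr _ _); rewrite HN ?ltxx//= leq_maxl.
Qed.

Lemma padic_norm_ge0 x : 0 <= padic_norm x.
Proof.
have [->|] := eqVneq x 0; first by rewrite padic_norm0.
by rewrite -[x]reprK => /padic_normE[/ltW].
Qed.

Lemma padic_norm_eq0 x : (padic_norm x == 0) = (x == 0).
Proof.
have [->|] := eqVneq x 0; first by rewrite padic_norm0 eqxx.
by rewrite -[x]reprK => /padic_normE[/gt_eqF].
Qed.

Lemma padic_normM x y : padic_norm (x * y) = padic_norm x * padic_norm y.
Proof.
have [->|] := eqVneq x 0; first by rewrite !(mul0r, padic_norm0).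
have [->|] := eqVneq y 0; first by rewrite !(mulr0, padic_norm0).
rewrite -[x]reprK -[y]reprK -rmorphM.
set u := repr x; set v := repr y => v0 u0.
have [cv [M HM]] := padic_normE v0; have [cu [N HN]] := padic_normE u0.
have uv n : (maxn M N <= n)%N ->
    vp ((u * v) n) = padic_norm (\pip u) * padic_norm (\pip v).
  by rewrite geq_max => /andP[Mn Nn]; rewrite -(HM n)// -(HN n)// -padic_absM.
have uv0 : \pip (u * v) != 0.
  rewrite padic_pi_eq0; apply/negP => /asboolP/(_ _ (mulr_gt0 cu cv))[K HK].
  have := HK (maxn K (maxn M N)) (leq_maxl _ _).
  by rewrite uv ?ltxx// leq_maxr.
have [_ [K HK]] := padic_normE uv0.
by rewrite -(HK (maxn K (maxn M N))) ?leq_maxl// uv// leq_maxr.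
Qed.

Lemma padic_norm1 : padic_norm (1 : padic p) = 1.
Proof.
have h : \pip 1 != 0 by rewrite rmorph1 oner_eq0.
have [_ [N /(_ N (leqnn N))]] := padic_normE h.
by rewrite rmorph1 padic_abs1 => <-.
Qed.

Lemma padic_normN x : padic_norm (- x) = padic_norm x.
Proof.
apply/eqP; rewrite -mulN1r padic_normM.
suff -> : padic_norm (-1 : padic p) = 1 by rewrite mul1r.
have : padic_norm (-1 : padic p) ^+ 2 == 1 ^+ 2.
  by rewrite expr2 -padic_normM mulrNN mulr1 padic_norm1 expr1n.
by rewrite eqrXn2// ?padic_norm_ge0// => /eqP.
Qed.

Lemma padic_normD x y :
  padic_norm (x + y) <= Num.max (padic_norm x) (padic_norm y).
Proof.
have [->|] := eqVneq x 0; first by rewrite add0r le_max lexx orbT.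
have [->|] := eqVneq y 0; first by rewrite addr0 le_max lexx.
have [->|] := eqVneq (x + y) 0.
  by rewrite padic_norm0 le_max padic_norm_ge0.
rewrite -[x]reprK -[y]reprK -rmorphD.
set u := repr x; set v := repr y => uv0 v0 u0.
have [_ [M HM]] := padic_normE v0; have [_ [N HN]] := padic_normE u0.
have [_ [K HK]] := padic_normE uv0.
pose n := maxn K (maxn M N).
rewrite -(HK n) ?leq_maxl// -(HM n) ?(leq_trans (leq_maxl M N)) ?leq_maxr//.
rewrite -(HN n) ?(leq_trans (leq_maxr M N)) ?leq_maxr//.
exact: padic_absD.
Qed.

Lemma const_cauchy (q : rat) : (fun=> q) \in padic_cauchy p.
Proof. by apply/asboolP => e e0; exists 0%N => *; rewrite subrr padic_abs0. Qed.

Definition padic_of_rat (q : rat) : padic p := \pip (CauchySeq (const_cauchy q)).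

Lemma padic_of_rat_zmod_morphism : zmod_morphism padic_of_rat.
Proof. by move=> a b; rewrite -rmorphB; congr (\pip _); exact: val_inj. Qed.

Lemma padic_of_rat_monoid_morphism : monoid_morphism padic_of_rat.
Proof.
split; first by rewrite -(rmorph1 \pi_(padic p)%qT); congr (\pip _); exact: val_inj.
by move=> a b; rewrite -rmorphM; congr (\pip _); exact: val_inj.
Qed.

HB.instance Definition _ :=
  GRing.isZmodMorphism.Build rat (padic p) padic_of_rat
    padic_of_rat_zmod_morphism.
HB.instance Definition _ :=
  GRing.isMonoidMorphism.Build rat (padic p) padic_of_rat
    padic_of_rat_monoid_morphism.

Lemma padic_norm_rat q : padic_norm (padic_of_rat q) = vp q.
Proof.
have [->|q0] := eqVneq q 0; first by rewrite rmorph0 padic_norm0 padic_abs0.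
have h : padic_of_rat q != 0 by rewrite fmorph_eq0.
by have [_ [N HN]] := padic_normE h; rewrite /padic_of_rat -(HN N).
Qed.

Definition padic_ball x (r : rat) : set (padic p) :=
  [set y | padic_norm (y - x) < r].

Definition padic_open (U : set (padic p)) : Prop :=
  forall x, U x -> exists2 r, 0 < r & padic_ball x r `<=` U.

Lemma padic_openT : padic_open setT.
Proof. by move=> x _; exists 1. Qed.

Lemma padic_openI : setI_closed padic_open.
Proof.
move=> U V oU oV x [/oU[r r0 rU] /oV[s s0 sV]].
exists (Num.min r s); first by rewrite lt_min r0 s0.
by move=> y; rewrite /padic_ball/= lt_min => /andP[/rU ? /sV].
Qed.

Lemma padic_open_bigcup (I : Type) (U : I -> set (padic p)) :
  (forall i, padic_open (U i)) -> padic_open (\bigcup_i U i).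
Proof.
move=> oU x [i _ /oU[r r0 rU]]; exists r => //.
by apply: subset_trans rU _; exact: bigcup_sup.
Qed.

HB.instance Definition _ := isOpenTopological.Build (padic p)
  padic_openT padic_openI padic_open_bigcup.

Definition padic_int : set (padic p) := [set x | padic_norm x <= 1].

Lemma padic_int1 : padic_int 1.
Proof. by rewrite /padic_int/= padic_norm1. Qed.

Lemma padic_intB x y : padic_int x -> padic_int y -> padic_int (x - y).
Proof.
move=> x1 y1; apply: le_trans (padic_normD _ _) _.
by rewrite ge_max padic_normN x1.
Qed.

Lemma padic_intM x y : padic_int x -> padic_int y -> padic_int (x * y).
Proof. by move=> x1 y1; rewrite /padic_int/= padic_normM mulr_ile1 ?padic_norm_ge0. Qed.

Lemma padic_int_open : open padic_int.
Proof.
move=> x x1; exists 1 => // y /ltW yx.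
have -> : y = (y - x) - (- x) by rewrite opprK subrK.
by apply: padic_intB => //; rewrite /padic_int/= padic_normN.
Qed.

End padic_norm_theory.

Definition padic_prod := forall p : prime_number, padic p.

HB.instance Definition _ := Choice.on padic_prod.

Section padic_prod_ring.
Implicit Types x y z : padic_prod.

Definition padic_prod_zero : padic_prod := fun=> 0.
Definition padic_prod_opp x : padic_prod := fun p => - x p.
Definition padic_prod_add x y : padic_prod := fun p => x p + y p.
Definition padic_prod_one : padic_prod := fun=> 1.
Definition padic_prod_mul x y : padic_prod := fun p => x p * y p.

Lemma padic_prod_addA : associative padic_prod_add.
Proof. by move=> x y z; apply: functional_extensionality_dep => p; exact: addrA. Qed.
Lemma padic_prod_addC : commutative padic_prod_add.
Proof. by move=> x y; apply: functional_extensionality_dep => p; exact: addrC. Qed.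
Lemma padic_prod_add0 : left_id padic_prod_zero padic_prod_add.
Proof. by move=> x; apply: functional_extensionality_dep => p; exact: add0r. Qed.
Lemma padic_prod_addN : left_inverse padic_prod_zero padic_prod_opp padic_prod_add.
Proof. by move=> x; apply: functional_extensionality_dep => p; exact: addNr. Qed.
HB.instance Definition _ := GRing.isZmodule.Build padic_prod
  padic_prod_addA padic_prod_addC padic_prod_add0 padic_prod_addN.

Lemma padic_prod_mulA : associative padic_prod_mul.
Proof. by move=> x y z; apply: functional_extensionality_dep => p; exact: mulrA. Qed.
Lemma padic_prod_mulC : commutative padic_prod_mul.
Proof. by move=> x y; apply: functional_extensionality_dep => p; exact: mulrC. Qed.
Lemma padic_prod_mul1 : left_id padic_prod_one padic_prod_mul.
Proof. by move=> x; apply: functional_extensionality_dep => p; exact: mul1r. Qed.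
Lemma padic_prod_mulD : left_distributive padic_prod_mul padic_prod_add.
Proof. by move=> x y z; apply: functional_extensionality_dep => p; exact: mulrDl. Qed.

Definition prime_number2 := @PrimeNumber 2 isT.

Lemma padic_prod_one_neq0 : padic_prod_one != 0.
Proof.
by apply/eqP => /(congr1 (fun x => x prime_number2))/eqP; rewrite oner_eq0.
Qed.
HB.instance Definition _ := GRing.Zmodule_isComNzRing.Build padic_prod
  padic_prod_mulA padic_prod_mulC padic_prod_mul1 padic_prod_mulD
  padic_prod_one_neq0.

End padic_prod_ring.

Definition almost_integral : {pred padic_prod} := fun x =>
  `[< finite_set [set p | ~ padic_int (x p)] >].

Lemma almost_integral_subring : subring_closed almost_integral.
Proof.
split.
- apply/asboolP; rewrite (_ : mkset _ = set0)//.
  by apply/seteqP; split => // p /= []; exact: padic_int1.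
- move=> x y /asboolP fx /asboolP fy; apply/asboolP.
  apply: sub_finite_set (_ : _ `<=` [set p | ~ padic_int (x p)] `|` [set p | ~ padic_int (y p)]) _.
    move=> p /= /contra_notP; apply; rewrite not_orE !notK => -[].
    exact: padic_intB.
  by rewrite finite_setU.
- move=> x y /asboolP fx /asboolP fy; apply/asboolP.
  apply: sub_finite_set (_ : _ `<=` [set p | ~ padic_int (x p)] `|` [set p | ~ padic_int (y p)]) _.
    move=> p /= /contra_notP; apply; rewrite not_orE !notK => -[].
    exact: padic_intM.
  by rewrite finite_setU.
Qed.

HB.instance Definition _ :=
  GRing.isSubringClosed.Build padic_prod almost_integral
    almost_integral_subring.

Record fin_adele := FinAdele {
  fin_adele_val :> padic_prod ;
  fin_adele_valP : fin_adele_val \in almost_integral }.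

HB.instance Definition _ := [isSub for fin_adele_val].
HB.instance Definition _ := [Choice of fin_adele by <:].
HB.instance Definition _ := [SubChoice_isSubComNzRing of fin_adele by <:].

Section fin_adele_topology.

Definition restricted_box (B : forall p, set (padic p)) : set fin_adele :=
  [set x : fin_adele | forall p, B p (fin_adele_val x p)].

Definition restricted_basis (B : forall p, set (padic p)) : Prop :=
  (forall p, open (B p)) /\ finite_set [set p | B p <> @padic_int p].

(* Restricted product topology: the boxes with open sides, almost all of them
   equal to Z_p, form a basis. *)
Definition fin_adele_open (U : set fin_adele) : Prop :=
  forall x, U x -> exists B,
    [/\ restricted_basis B, restricted_box B x & restricted_box B `<=` U].

Lemma fin_adele_openT : fin_adele_open setT.
Proof.
move=> x _.
exists (fun p => if `[< padic_int (fin_adele_val x p) >] then @padic_int p else setT).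
split => //; last by move=> p; case: asboolP.
split; first by move=> p; case: ifP => _; [exact: padic_int_open|exact: openT].
by have /asboolP := fin_adele_valP x; apply: sub_finite_set => p /=; case: asboolP.
Qed.

Lemma fin_adele_openI : setI_closed fin_adele_open.
Proof.
move=> U V oU oV x [/oU[B [[oB fB] Bx BU]] /oV[C [[oC fC] Cx CV]]].
exists (fun p => B p `&` C p); split.
- split=> [p|]; first exact: openI.
  apply: sub_finite_set (_ : _ `<=` [set p | B p <> @padic_int p] `|` [set p | C p <> @padic_int p]) _.
    move=> p /= /contra_notP; apply; rewrite not_orE !notK => -[-> ->].
    by rewrite setIid.
  by rewrite finite_setU.
- by move=> p; split.
- by move=> y By; split; [apply: BU|apply: CV] => p; case: (By p).
Qed.

Lemma fin_adele_open_bigcup (I : Type) (U : I -> set fin_adele) :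
  (forall i, fin_adele_open (U i)) -> fin_adele_open (\bigcup_i U i).
Proof.
move=> oU x [i _ /oU[B [bB Bx BU]]]; exists B; split => //.
by apply: subset_trans BU _; exact: bigcup_sup.
Qed.

HB.instance Definition _ := isOpenTopological.Build fin_adele
  fin_adele_openT fin_adele_openI fin_adele_open_bigcup.

End fin_adele_topology.

Lemma rat_almost_integral (q : rat) :
  (fun p => padic_of_rat p q) \in almost_integral.
Proof.
apply/asboolP.
have : finite_set (prime_val @^-1` `I_(`|denq q|.+1)).
  apply: finite_preimage; last exact: finite_II.
  by move=> [p pp] [r pr] _ _ /= pr'; subst r; congr PrimeNumber; exact: bool_irrelevance.
apply: sub_finite_set => p /=; apply: contra_notP => /negP.
by rewrite -leqNgt /padic_int/= padic_norm_rat; exact: padic_abs_cofinite.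
Qed.

Definition fin_adele_of_rat (q : rat) : fin_adele :=
  FinAdele (rat_almost_integral q).

Lemma fin_adele_of_rat_zmod_morphism : zmod_morphism fin_adele_of_rat.
Proof.
move=> a b; apply: val_inj; apply: functional_extensionality_dep => p.
exact: rmorphB.
Qed.
Lemma fin_adele_of_rat_monoid_morphism : monoid_morphism fin_adele_of_rat.
Proof.
split=> [|a b]; apply: val_inj; apply: functional_extensionality_dep => p.
  exact: rmorph1.
exact: rmorphM.
Qed.
HB.instance Definition _ :=
  GRing.isZmodMorphism.Build rat fin_adele fin_adele_of_rat
    fin_adele_of_rat_zmod_morphism.
HB.instance Definition _ :=
  GRing.isMonoidMorphism.Build rat fin_adele fin_adele_of_rat
    fin_adele_of_rat_monoid_morphism.

Section adele.
Variable R : realType.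

Definition adele := (R * fin_adele)%type.

HB.instance Definition _ := GRing.ComNzRing.on adele.
HB.instance Definition _ := Topological.on adele.

Definition adele_of_rat (q : rat) : adele := (ratr q, fin_adele_of_rat q).

Lemma adele_of_rat_zmod_morphism : zmod_morphism adele_of_rat.
Proof. by move=> a b; rewrite /adele_of_rat !rmorphB. Qed.
Lemma adele_of_rat_monoid_morphism : monoid_morphism adele_of_rat.
Proof.
by split=> [|a b]; rewrite /adele_of_rat ?rmorph1// !rmorphM.
Qed.
HB.instance Definition _ :=
  GRing.isZmodMorphism.Build rat adele adele_of_rat adele_of_rat_zmod_morphism.
HB.instance Definition _ :=
  GRing.isMonoidMorphism.Build rat adele adele_of_rat
    adele_of_rat_monoid_morphism.

End adele.

Section special_linear.
Variable n : nat.

Record SL (S : comNzRingType) := MkSL {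
  SL_mx :> 'M[S]_n ;
  SL_mxP : \det SL_mx == 1 }.

HB.instance Definition _ S := [isSub for @SL_mx S].
HB.instance Definition _ S := [Choice of SL S by <:].

Section group.
Variable S : comNzRingType.
Implicit Types A B C : SL S.

Lemma SL_det A : \det A = 1.
Proof. exact/eqP/SL_mxP. Qed.

Lemma SL_one_proof : \det (1%:M : 'M[S]_n) == 1.
Proof. by rewrite det1. Qed.
Definition SL_one := MkSL SL_one_proof.

Lemma SL_mul_proof A B : \det (A *m B) == 1.
Proof. by rewrite det_mulmx !SL_det mulr1. Qed.
Definition SL_mul A B := MkSL (SL_mul_proof A B).

Lemma SL_inv_proof A : \det (\adj A) == 1.
Proof.
have /(congr1 determinant) := mul_mx_adj A.
by rewrite det_mulmx SL_det mul1r det1 => ->.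
Qed.
Definition SL_inv A := MkSL (SL_inv_proof A).

Lemma SL_mulA : associative SL_mul.
Proof. by move=> A B C; apply: val_inj; exact: mulmxA. Qed.
Lemma SL_mul1 : left_id SL_one SL_mul.
Proof. by move=> A; apply: val_inj; exact: mul1mx. Qed.
Lemma SL_mulr1 : right_id SL_one SL_mul.
Proof. by move=> A; apply: val_inj; exact: mulmx1. Qed.
Lemma SL_mulV : left_inverse SL_one SL_inv SL_mul.
Proof. by move=> A; apply: val_inj; rewrite /= mul_adj_mx SL_det. Qed.
Lemma SL_mulrV : right_inverse SL_one SL_inv SL_mul.
Proof. by move=> A; apply: val_inj; rewrite /= mul_mx_adj SL_det. Qed.

HB.instance Definition _ := isGroup.Build (SL S)
  SL_mulA SL_mul1 SL_mulr1 SL_mulV SL_mulrV.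
HB.instance Definition _ := isPointed.Build (SL S) SL_one.

End group.

Section map.
Variables (S T : comNzRingType) (f : {rmorphism S -> T}).

Lemma SL_map_proof (A : SL S) : \det (map_mx f A) == 1.
Proof. by rewrite det_map_mx SL_det rmorph1. Qed.
Definition SL_map (A : SL S) : SL T := MkSL (SL_map_proof A).

Lemma SL_mapM : {morph SL_map : A B / (A * B)%g}.
Proof. by move=> A B; apply: val_inj; exact: map_mxM. Qed.
Lemma SL_map1 : SL_map 1%g = 1%g.
Proof. by apply: val_inj; exact: map_mx1. Qed.
Lemma SL_mapV (A : SL S) : SL_map A^-1%g = (SL_map A)^-1%g.
Proof. by apply: val_inj; rewrite /= map_mx_adj. Qed.
End map.

Section adelic.
Variable R : realType.

(* The topology induced by the inclusion of SL_n in the n x n matrices. *)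
HB.instance Definition _ := Topological.copy (SL (adele R))
  (initial_topology (@SL_mx (adele R) : SL (adele R) -> 'M[adele R]_n)).
HB.instance Definition _ := Pointed.on (SL (adele R)).

(* M |-> (M, I, I, ...), the real place being the first component. *)
Lemma SL_iota_proof (M : SL R) :
  \det (\matrix_(i, j) ((M i j, (i == j)%:R) : adele R)) == 1.
Proof.
set A := \matrix_(i, j) _.
have /(congr1 determinant) : map_mx fst A = M.
  by apply/matrixP => i j; rewrite !mxE.
have /(congr1 determinant) : map_mx snd A = 1%:M.
  by apply/matrixP => i j; rewrite !mxE.
rewrite !det_map_mx det1 SL_det => h2 h1.
by apply/eqP; rewrite [LHS]surjective_pairing h1 h2.
Qed.

Definition SL_iota (M : SL R) : SL (adele R) := MkSL (SL_iota_proof M).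

Definition SL_diag : SL rat -> SL (adele R) := SL_map (@adele_of_rat R).

Definition SLQ_equiv (g h : SL (adele R)) : bool :=
  `[< exists gamma : SL rat, h = (SL_diag gamma * g)%g >].

Lemma SLQ_equiv_class : equiv_class_of SLQ_equiv.
Proof.
split=> [g|g h|h g k].
- by apply/asboolP; exists 1%g; rewrite /SL_diag SL_map1 mul1g.
- by apply/asboolP/asboolP => -[c ->]; exists c^-1%g;
    rewrite /SL_diag SL_mapV mulKg.
- move=> /asboolP[c ->] /asboolP[e ->]; apply/asboolP.
  by exists (e * c)%g; rewrite /SL_diag SL_mapM mulgA.
Qed.

Canonical SLQ_equiv_rel := EquivRelPack SLQ_equiv_class.
Canonical SLQ_enc := defaultEncModRel SLQ_equiv.

(* The space of cosets SL_n(Q) g, with the quotient topology. *)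
Definition SLQ_quot := quotient_topology {eq_quot SLQ_equiv}%qT.

HB.instance Definition _ := PointedTopological.on SLQ_quot.

Definition SLQ_coset (g : SL (adele R)) : SLQ_quot := \pi_SLQ_quot%qT g.

(* SL_n(Q) h |-> SL_n(Q) h g, see SLQ_rtransE. *)
Definition SLQ_rtrans (g : SL (adele R)) (x : SLQ_quot) : SLQ_quot :=
  SLQ_coset (repr x * g)%g.

Lemma SLQ_cosetP g h : SLQ_coset g = SLQ_coset h <->
  exists gamma : SL rat, h = (SL_diag gamma * g)%g.
Proof.
have e := @eqmodP _ SLQ_equiv_rel g h.
by split=> [/e/asboolP//|gh]; apply/e/asboolP.
Qed.

Lemma SLQ_rtransE g h : SLQ_rtrans g (SLQ_coset h) = SLQ_coset (h * g)%g.
Proof.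
have /SLQ_cosetP[c hc] : SLQ_coset (repr (SLQ_coset h)) = SLQ_coset h.
  exact: reprK.
by apply/SLQ_cosetP; exists c; rewrite mulgA -hc.
Qed.

End adelic.
End special_linear.

Definition borel (T : ptopologicalType) := g_sigma_algebraType (@open T).

HB.instance Definition _ (T : ptopologicalType) :=
  Measurable.on (borel T).

Section real_groups.
Variables (R : realType) (n : nat).

Definition SO : set (SL n R) := [set M | SL_mx M *m (SL_mx M)^T = 1%:M].

(* diag(e^(-(n-1)t), e^t, ..., e^t) *)
Definition Phi_row (t : R) : 'rV[R]_n :=
  \row_i expR (if (i : nat) == 0%N then - (n.-1%:R * t) else t).

Lemma Phi_proof t : \det (diag_mx (Phi_row t)) == 1.
Proof.
rewrite det_diag; apply/eqP; rewrite /Phi_row.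
under eq_bigr do rewrite mxE.
case: n => [|m]; first by rewrite big_ord0.
rewrite big_ord_recl/= (eq_bigr (fun=> expR t))//.
by rewrite prodr_const card_ord -expRM_natl -expRD mulrC addNr expR0.
Qed.

Definition Phi (t : R) : SL n R := MkSL (Phi_proof t).

End real_groups.

Section sphere.
Variables (R : realType) (n : nat).

(* S^n as the Euclidean unit sphere of R^(n+1); the norm that the library puts
   on matrices is the sup norm. *)
Record sphere := Sphere {
  sphere_val :> 'rV[R]_n.+1 ;
  sphere_valP : \sum_i sphere_val 0 i ^+ 2 == 1 }.

HB.instance Definition _ := [isSub for sphere_val].
HB.instance Definition _ := [Choice of sphere by <:].

Lemma sphere_e1_proof : \sum_i (delta_mx 0 0 : 'rV[R]_n.+1) 0 i ^+ 2 == 1.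
Proof.
rewrite (bigD1 ord0)//= big1 => [|i i0]; first by rewrite mxE expr1n addr0.
by rewrite mxE (negbTE i0) andbF expr0n.
Qed.

HB.instance Definition _ := isPointed.Build sphere (Sphere sphere_e1_proof).
HB.instance Definition _ :=
  Topological.copy sphere (initial_topology sphere_val).

Fixpoint Ck (k : nat) (U : set 'rV[R]_n.+1) (f : 'rV[R]_n.+1 -> R) : Prop :=
  if k is k'.+1 then
    forall i, (forall x, U x -> derivable f x (delta_mx 0 i)) /\
              Ck k' U ('D_(delta_mx 0 i) f)
  else forall x, U x -> {for x, continuous f}.

Definition smooth_on U f := forall k, Ck k U f.

(* Smoothness of a map defined on a subset of R^(n+1): it is locally the
   restriction of a smooth map defined on an open set. *)
Definition smooth_at (m : nat) (K : sphere -> 'M[R]_m) (v : sphere) : Prop :=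
  exists (U : set 'rV[R]_n.+1) (F : 'rV[R]_n.+1 -> 'M[R]_m),
    [/\ open U, U v, forall i j, smooth_on U (fun x => F x i j) &
        forall w : sphere, U w -> K w = F w].

Definition box (a b : 'rV[R]_n.+1) : set 'rV[R]_n.+1 :=
  [set x : 'rV[R]_n.+1 | forall i, a 0 i <= x 0 i <= b 0 i].

(* (n+1)-dimensional Lebesgue outer measure, from countable covers by boxes. *)
Definition lebesgue_outer (A : set 'rV[R]_n.+1) : \bar R :=
  ereal_inf
    [set (\sum_(k <oo) (\prod_i ((F k).2 0 i - (F k).1 0 i))%:E)%E |
      F in [set F : nat -> 'rV[R]_n.+1 * 'rV[R]_n.+1 |
        (forall k i, (F k).1 0 i <= (F k).2 0 i) /\
        A `<=` \bigcup_k box (F k).1 (F k).2]].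

Definition cone (B : set sphere) : set 'rV[R]_n.+1 :=
  [set x | exists r v, [/\ 0 < r <= 1, B v & x = r *: sphere_val v]].

(* Surface measure on the unit sphere, in terms of the volume of the cone
   {r v | 0 < r <= 1, v \in B}. *)
Definition sphere_lebesgue (B : set (borel sphere)) : \bar R :=
  (n.+1%:R%:E * lebesgue_outer (cone B))%E.

End sphere.

(* Main.v *)
(** The integrand is averaged over the direction v of z in an open set A of R^d
  instead of over the sphere: F_t(x) = \int_A f(x K(z/|z|) Phi^t) dz.

  For f Lipschitz along SL_d(R)-orbits and invariant under a congruence subgroup
  of SL_d(Zhat), the functions F_t are equicontinuous uniformly in t >= 0. Indeed
  g K(z/|z|) = K(w/|w|) p with w = z g^-1 and p in the stabilizer of the line of
  e_1, which Phi^t contracts, and Lebesgue measure is SL_d(R)-invariant.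
  Hence F_t is close to its average over a long piece of unipotent orbit
  u_tau, u_2tau, ... with tau = e^(-dt); moving u past K(z/|z|) Phi^t turns it into
  an average of f along the unit-step orbit of u. By the mean ergodic theorem such
  averages are almost invariant under u uniformly in the power, so by Mautner's
  phenomenon they are almost invariant in L^2 under all elementary matrices,
  whatever their size. Therefore F_t(x g) - F_t(x) tends to 0 in L^1(mu), and
  pointwise by equicontinuity, for every g in SL_d(R). By strong approximation
  (elementary generation of SL_d over the finite adeles and density of Q) every two
  points of the space differ by an element of SL_d(R) times one of the congruence
  subgroup, so F_t(x) converges to |A| times the mean of f.

  A pi-lambda argument and Radon-Nikodym pass from open sets of directions to
  absolutely continuous measures, and monotone approximation by inf-convolutions
  passes from such f to bounded continuous functions. *)

Require Import Defs.
From HB Require Import structures.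
From mathcomp Require Import all_boot all_order all_algebra.
From mathcomp Require Import generic_quotient ring_quotient.
From mathcomp Require Import all_classical all_reals all_analysis.
From mathcomp Require Import measurable_realfun.
From mathcomp Require Import ring lra.

Set Implicit Arguments.
Unset Strict Implicit.
Unset Printing Implicit Defensive.

Import Order.TTheory GRing.Theory Num.Theory.
Import numFieldNormedType.Exports.

Local Open Scope classical_set_scope.
Local Open Scope ring_scope.

(** * Generation of SL_n by elementary matrices *)

(** The obstacle is that the translating element h = [horo c * Phi t] runs off to infinity with t:
    conjugating a fixed elementary matrix by h gives entries that grow exponentially. Almost
    invariance is therefore propagated through the number of elementary factors ([elen]), which
    conjugation by [Phi t] preserves, and the estimate for a single elementary matrix has to be
    uniform in its entry. The orbit average has about e^t terms: their number tends to infinity, as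
    the ergodic theorem requires, while the piece of orbit has length about e^((1-d)t), negligible
    for an equicontinuous function since d >= 2. The ergodic theorem takes the form of an inequality
    with an explicit threshold, valid for bounded functions, so that it can be applied while t and
    the number of terms grow together. Passing from L^1(mu) to single points rests on the fact that
    small orbit neighbourhoods have positive measure, which follows from transitivity and the
    invariance of mu. *)

Section elementary.
Variable S : comNzRingType.

(** The factor [s *+ (i != j)] turns the case i = j into the identity matrix. Hence the determinant
    is 1 for all i and j, and inductions over elementary products carry no side condition. *)
Definition elem_mx n (i j : 'I_n) (s : S) : 'M[S]_n :=
  1%:M + (s *+ (i != j)) *: delta_mx i j.

Lemma elem_mxE n (i j : 'I_n) s k l :
  elem_mx i j s k l = (k == l)%:R + (s *+ (i != j)) * ((k == i) && (l == j))%:R.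
Proof. by rewrite !mxE. Qed.

Lemma tr_elem_mx n (i j : 'I_n) s : (elem_mx i j s)^T = elem_mx j i s.
Proof. by rewrite /elem_mx raddfD/= trmx1 linearZ/= trmx_delta eq_sym. Qed.

Lemma det_elem_mx n (i j : 'I_n) s : \det (elem_mx i j s) = 1.
Proof.
wlog ij : i j / (j <= i)%N.
  move=> H; case: (leqP j i) => [/H//|/ltnW/H].
  by rewrite -tr_elem_mx det_tr.
rewrite det_trig; last first.
  apply/is_trig_mxP => k l kl; rewrite elem_mxE -val_eqE (ltn_eqF kl) add0r.
  case: (eqVneq k i) => [ki|_]; last by rewrite mulr0.
  case: (eqVneq l j) => [lj|_]; last by rewrite mulr0.
  by move: kl; rewrite ki lj ltnNge ij.
apply: big1 => k _; rewrite elem_mxE eqxx.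
have [ki|_] := eqVneq k i; last by rewrite mulr0 addr0.
have [kj|_] := eqVneq k j; last by rewrite mulr0 addr0.
by rewrite -ki -kj eqxx mul0r addr0.
Qed.

Definition elem n (i j : 'I_n) s : SL n S := MkSL (introT eqP (det_elem_mx i j s)).

Lemma elemD n (i j : 'I_n) s t : elem i j (s + t) = (elem i j s * elem i j t)%g.
Proof.
apply: val_inj; rewrite /= /elem_mx mulmxDl mul1mx mulmxDr mulmx1.
rewrite -scalemxAr -scalemxAl mul_delta_mx_cond.
case: eqVneq => [->|ij]; first by rewrite !mulr0n !scale0r !addr0.
by rewrite !mulr1n mulr0n !scaler0 addr0 -addrA -scalerDl [t + s]addrC.
Qed.

Lemma elem0 n (i j : 'I_n) : elem i j 0 = 1%g.
Proof. by apply: val_inj; rewrite /= /elem_mx mul0rn scale0r addr0. Qed.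

Lemma elemV n (i j : 'I_n) s : (elem i j s)^-1%g = elem i j (- s).
Proof.
by apply: (mulgI (elem i j s)); rewrite mulgV -elemD subrr elem0.
Qed.

Lemma elem_id n (i : 'I_n) s : elem i i s = 1%g.
Proof. by apply: val_inj; rewrite /= /elem_mx eqxx scale0r addr0. Qed.

(** Steinberg's commutator relation. [dq_elem] uses it with k = a to reach the positions (i, j) that
    avoid both a and b. *)
Lemma elem_comm n (i k j : 'I_n) s t : i != j -> i != k -> k != j ->
  elem i j (s * t) = (elem i k s * elem k j t * elem i k (- s) * elem k j (- t))%g.
Proof.
move=> ij ik kj; have h : (elem i j (s * t) * elem k j t * elem i k s = elem i k s * elem k j t)%g.
  apply: val_inj; rewrite /= /elem_mx ij ik kj !mulr1n.
  rewrite !(mulmxDl, mulmxDr, mul1mx, mulmx1) -!(scalemxAr, scalemxAl).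
  rewrite !mul_delta_mx_cond eqxx [j == k]eq_sym (negbTE kj) [j == i]eq_sym (negbTE ij).
  rewrite !mulr0n !mulr1n mul0mx !scaler0 !addr0 scalerA.
  by apply/matrixP => a b; rewrite !mxE; ring.
by rewrite -h -!elemV !mulgK.
Qed.

Inductive elem_product n : 'M[S]_n -> Prop :=
| EP1 : elem_product 1%:M
| EPM i j s A of elem_product A : elem_product (elem_mx i j s *m A).

Lemma elem_productM n (A B : 'M[S]_n) :
  elem_product A -> elem_product B -> elem_product (A *m B).
Proof.
elim=> [|i j s {}A _ IH] pB; first by rewrite mul1mx.
by rewrite -mulmxA; exact/EPM/IH.
Qed.

Lemma elem_product_elem n i j s : elem_product (@elem_mx n i j s).
Proof. by rewrite -[elem_mx i j s]mulmx1; apply: EPM; exact: EP1. Qed.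

Local Notation eqsh := (eq_lshift, eq_rshift, eq_lrshift, eq_rlshift, andbF).

Lemma elem_product_lift n (A : 'M[S]_n) :
  elem_product A -> elem_product (block_mx (1%:M : 'M[S]_1) 0 0 A).
Proof.
elim=> [|i j s {}A _ IH]; first by rewrite -scalar_mx_block; exact: EP1.
have -> : block_mx (1%:M : 'M[S]_1) 0 0 (elem_mx i j s *m A) =
    elem_mx (rshift 1 i) (rshift 1 j) s *m block_mx (1%:M : 'M[S]_1) 0 0 A.
  have -> : elem_mx (rshift 1 i) (rshift 1 j) s = block_mx (1%:M : 'M[S]_1) 0 0 (elem_mx i j s).
    rewrite /elem_mx (inj_eq (@rshift_inj _ _)).
    rewrite [in LHS]scalar_mx_block -{1}[delta_mx (rshift 1 i) _]submxK.
    rewrite scale_block_mx add_block_mx; congr block_mx; apply/matrixP => a b;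
    rewrite !mxE ?eqsh ?mulr0 ?addr0 ?add0r//.
  by rewrite mulmx_block !mul1mx !mul0mx !mulmx0 !addr0 !add0r.
exact: EPM.
Qed.

Lemma elem_product_ur n (r : 'rV[S]_n) : elem_product (block_mx (1%:M : 'M[S]_1) r 0 1%:M).
Proof.
rewrite [r]row_sum_delta; elim/big_ind: _ => [|x y px py|j _].
- by rewrite -scalar_mx_block; exact: EP1.
- have -> : block_mx (1%:M : 'M[S]_1) (x + y) 0 1%:M =
    block_mx (1%:M : 'M[S]_1) x 0 1%:M *m block_mx (1%:M : 'M[S]_1) y 0 1%:M.
    by rewrite mulmx_block !mul1mx !mul0mx !mulmx1 !addr0 !add0r mulmx0 addr0 addrC.
  exact: elem_productM.
suff -> : block_mx (1%:M : 'M[S]_1) (r 0 j *: delta_mx 0 j) 0 1%:M =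
    elem_mx (lshift n 0) (rshift 1 j) (r 0 j) by exact: elem_product_elem.
rewrite /elem_mx eq_lrshift mulr1n [in RHS]scalar_mx_block -[delta_mx (lshift n _) _]submxK.
rewrite scale_block_mx add_block_mx; congr block_mx; apply/matrixP => a b;
  rewrite !mxE ?eqsh ?mulr0 ?addr0 ?add0r//.
Qed.

Lemma elem_product_tr n (A : 'M[S]_n) : elem_product A -> elem_product A^T.
Proof.
elim=> [|i j s {}A _ IH]; first by rewrite trmx1; exact: EP1.
by rewrite trmx_mul tr_elem_mx; apply: elem_productM => //; exact: elem_product_elem.
Qed.

Lemma elem_product_dl n (c : 'cV[S]_n) : elem_product (block_mx (1%:M : 'M[S]_1) 0 c 1%:M).
Proof.
have /elem_product_tr := elem_product_ur c^T.
by rewrite tr_block_mx !trmx1 trmx0 trmxK.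
Qed.

(** Bass's stable range condition. The finite adeles are far from being a field, but they share this
    property with R, so one elimination serves both rings. *)
Definition stable_range1 :=
  forall a b x y : S, x * a + y * b = 1 -> exists t w, (a + t * b) * w = 1.

(** Gaussian elimination on the first column. A row of the adjugate witnesses that the column is
    unimodular, and the stable range condition then provides a unit in the corner. *)
Lemma det1_elem_product n (A : 'M[S]_n) :
  stable_range1 -> \det A = 1 -> elem_product A.
Proof.
move=> sr; elim: n A => [|[|n] IH] A dA.
- by rewrite (_ : A = 1%:M); [exact: EP1|apply/matrixP => -[]].
- rewrite (_ : A = 1%:M); first exact: EP1.
  by rewrite [A]mx11_scalar -[A 0 0]det_mx11 dA.
pose B : 'M[S]_(1 + n.+1) := A; rewrite (_ : A = B)//.
have [C CB] : exists C : 'M[S]_(1 + n.+1), (C *m B) 0 0 = 1.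
  by exists (\adj B); rewrite mul_adj_mx dA mxE eqxx.
have {dA} dB : \det B = 1 by [].
move: CB dB; rewrite -[B]submxK -[C]submxK.
move: (ulsubmx B) (ursubmx B) (dlsubmx B) (drsubmx B) => a r c D.
move: (ulsubmx C) (ursubmx C) (dlsubmx C) (drsubmx C) => x y x1 y1 /[swap] dB.
rewrite mulmx_block (_ : (0 : 'I_(1 + n.+1)) = lshift n.+1 0); last exact: val_inj.
rewrite block_mxEul mxE [x]mx11_scalar {1}[a]mx11_scalar -scalar_mxM mxE/= mulr1n.
set yc := (y *m c) 0 0; rewrite -[yc]mul1r => /sr[t [w tw]].
set a0 := a 0 0 in tw.
pose e : 'cV[S]_n.+1 := delta_mx 0 0.
pose W := a0 + t * yc.
set M := block_mx _ _ _ _ in dB *.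
(* [E1] makes the corner the unit W, [E2] replaces the column below it by e, [E3] uses the entry 1
   of e to change W into 1, and [E4] clears e. The matrices [F1] to [F4] are their inverses. *)
pose E1 := block_mx (1%:M : 'M[S]_1) (t *: y) 0 (1%:M : 'M[S]_n.+1).
pose E2 := block_mx (1%:M : 'M[S]_1) 0 (w *: (e - c)) (1%:M : 'M[S]_n.+1).
pose E3 := block_mx (1%:M : 'M[S]_1) ((1 - W) *: e^T) 0 (1%:M : 'M[S]_n.+1).
pose E4 := block_mx (1%:M : 'M[S]_1) 0 (- e) (1%:M : 'M[S]_n.+1).
pose F1 := block_mx (1%:M : 'M[S]_1) (- (t *: y)) 0 (1%:M : 'M[S]_n.+1).
pose F2 := block_mx (1%:M : 'M[S]_1) 0 (- (w *: (e - c))) (1%:M : 'M[S]_n.+1).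
pose F3 := block_mx (1%:M : 'M[S]_1) (- ((1 - W) *: e^T)) 0 (1%:M : 'M[S]_n.+1).
pose F4 := block_mx (1%:M : 'M[S]_1) 0 e (1%:M : 'M[S]_n.+1).
have FE1 : F1 *m E1 = 1%:M.
  by rewrite mulmx_block !(mul1mx, mul0mx, mulmx0, mulmx1, addr0, add0r) subrr -scalar_mx_block.
have FE2 : F2 *m E2 = 1%:M.
  by rewrite mulmx_block !(mul1mx, mul0mx, mulmx0, mulmx1, addr0, add0r) addrC subrr -scalar_mx_block.
have FE3 : F3 *m E3 = 1%:M.
  by rewrite mulmx_block !(mul1mx, mul0mx, mulmx0, mulmx1, addr0, add0r) subrr -scalar_mx_block.
have FE4 : F4 *m E4 = 1%:M.
  by rewrite mulmx_block !(mul1mx, mul0mx, mulmx0, mulmx1, addr0, add0r) subrr -scalar_mx_block.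
have e1 : e^T *m e = 1%:M.
  rewrite /e trmx_delta mul_delta_mx; apply/matrixP => i j.
  by rewrite !ord1 !mxE.
have [r' [D' EM]] : exists r' D', E4 *m (E3 *m (E2 *m (E1 *m M))) = block_mx (1%:M : 'M[S]_1) r' 0 D'.
  rewrite /M /E1 mulmx_block !(mul1mx, mul0mx, mulmx0, mulmx1, addr0, add0r).
  rewrite -scalemxAl [y *m c]mx11_scalar -/yc {1}[a]mx11_scalar -/a0 scale_scalar_mx -(raddfD (@scalar_mx S 1)) -/W.
  rewrite /E2 mulmx_block !(mul1mx, mul0mx, mulmx0, mulmx1, addr0, add0r).
  rewrite mul_mx_scalar scalerA tw scale1r subrK.
  rewrite /E3 mulmx_block !(mul1mx, mul0mx, mulmx0, mulmx1, addr0, add0r).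
  rewrite -!scalemxAl e1 scale_scalar_mx mulr1 -(raddfD (@scalar_mx S 1)) subrKC.
  rewrite /E4 mulmx_block !(mul1mx, mul0mx, mulmx0, mulmx1, addr0, add0r).
  by rewrite addNr; eexists; eexists.
have -> : M = F1 *m (F2 *m (F3 *m (F4 *m block_mx (1%:M : 'M[S]_1) r' 0 D'))).
  by rewrite -EM (mulmxA F4) FE4 mul1mx (mulmxA F3) FE3 mul1mx (mulmxA F2) FE2
    mul1mx (mulmxA F1) FE1 mul1mx.
have dD : \det D' = 1.
  have := congr1 determinant EM.
  rewrite !det_mulmx /E1 /E2 /E3 /E4 !(det_ublock, det_lblock) !det1 !mul1r => <-.
  by rewrite /M dB.
do 4!(apply: elem_productM; first by [exact: elem_product_ur|exact: elem_product_dl]).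
have -> : block_mx (1%:M : 'M[S]_1) r' 0 D' = block_mx 1%:M 0 0 D' *m block_mx (1%:M : 'M[S]_1) r' 0 1%:M.
  by rewrite mulmx_block !(mul1mx, mul0mx, mulmx0, mulmx1, addr0, add0r).
apply: elem_productM; last exact: elem_product_ur.
exact/elem_product_lift/IH.
Qed.

Lemma SL_elem_ind n (P : SL n S -> Prop) : stable_range1 ->
  P 1%g -> (forall i j s g, P g -> P (elem i j s * g)%g) -> forall g, P g.
Proof.
move=> sr P1 PM g; have := det1_elem_product sr (SL_det g).
move gA : (SL_mx g) => A pA; elim: pA g gA => {A} [|i j s A pA IH] g gA.
  by rewrite (_ : g = 1%g)//; exact: val_inj.
have dA : \det A == 1.
  by have := SL_det g; rewrite gA det_mulmx det_elem_mx mul1r => ->.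
have -> : g = (elem i j s * MkSL dA)%g by apply: val_inj; rewrite /= gA.
by apply: PM; exact: IH.
Qed.

End elementary.

Lemma field_stable_range1 (F : fieldType) : stable_range1 F.
Proof.
move=> a b x y h; have [a0|a0] := eqVneq a 0.
  exists 1, b^-1; rewrite a0 add0r mul1r mulfV//.
  by apply: contra_eq_neq h => ->; rewrite a0 !mulr0 addr0 eq_sym oner_eq0.
by exists 0, a^-1; rewrite mul0r addr0 mulfV.
Qed.

(** * Entrywise norms on SL_n(R) *)

Section l1norm.
Variable R : realType.

Definition l1 m n (A : 'M[R]_(m, n)) : R := \sum_i \sum_j `|A i j|.

Lemma l1_ge0 m n (A : 'M[R]_(m, n)) : 0 <= l1 A.
Proof. by apply: sumr_ge0 => i _; exact: sumr_ge0. Qed.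

Lemma l10 m n : l1 (0 : 'M[R]_(m, n)) = 0.
Proof. by rewrite /l1 big1// => i _; rewrite big1// => j _; rewrite mxE normr0. Qed.

Lemma l1D m n (A B : 'M[R]_(m, n)) : l1 (A + B) <= l1 A + l1 B.
Proof.
rewrite /l1 -big_split/=; apply: ler_sum => i _; rewrite -big_split/=.
by apply: ler_sum => j _; rewrite mxE ler_normD.
Qed.

Lemma l1N m n (A : 'M[R]_(m, n)) : l1 (- A) = l1 A.
Proof. by apply: eq_bigr => i _; apply: eq_bigr => j _; rewrite mxE normrN. Qed.

Lemma l1M m n p (A : 'M[R]_(m, n)) (B : 'M[R]_(n, p)) :
  l1 (A *m B) <= l1 A * l1 B.
Proof.
rewrite /l1 mulr_suml; apply: ler_sum => i _.
apply: (@le_trans _ _ (\sum_j \sum_k `|A i k| * `|B k j|)).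
  apply: ler_sum => j _; rewrite mxE (le_trans (ler_norm_sum _ _ _))//.
  by apply: ler_sum => k _; rewrite normrM.
rewrite exchange_big/= mulr_suml; apply: ler_sum => k _.
rewrite -mulr_sumr ler_wpM2l// (bigD1 k)//= lerDl.
by apply: sumr_ge0 => i' _; exact: sumr_ge0.
Qed.

Lemma ler_l1 m n (A : 'M[R]_(m, n)) i j : `|A i j| <= l1 A.
Proof.
rewrite /l1 (bigD1 i)//= (bigD1 j)//= -addrA lerDl addr_ge0//.
  exact: sumr_ge0.
by apply: sumr_ge0 => i' _; exact: sumr_ge0.
Qed.

Lemma l1_le m n (A : 'M[R]_(m, n)) e :
  (forall i j, `|A i j| <= e) -> l1 A <= (m * n)%:R * e.
Proof.
move=> Ae; apply: (@le_trans _ _ (\sum_(i < m) \sum_(j < n) e)).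
  by apply: ler_sum => i _; exact: ler_sum.
by rewrite !sumr_const !card_ord -mulrnA mulr_natl mulnC.
Qed.

Lemma l1_lt m n (e : R) : 0 < e -> exists2 d, 0 < d &
  forall A : 'M[R]_(m, n), (forall i j, `|A i j| < d) -> l1 A < e.
Proof.
move=> e0; exists (e / (m * n).+1%:R); first by rewrite divr_gt0.
move=> A Ad; apply: (@le_lt_trans _ _ ((m * n)%:R * (e / (m * n).+1%:R))).
  by apply: l1_le => i j; exact/ltW.
by rewrite mulrA ltr_pdivrMr// mulrC ltr_pM2l// ltr_nat.
Qed.

Variable n : nat.
Implicit Types g h : SL n R.

(** Counting g^-1 as well gives [dist1V], and lets one bound control both g and the substitution z *
    g^-1. *)
Definition dist1 g : R := l1 (SL_mx g - 1%:M) + l1 (SL_mx g^-1%g - 1%:M).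

Lemma dist1_ge0 g : 0 <= dist1 g.
Proof. by rewrite addr_ge0// l1_ge0. Qed.

Lemma dist1V g : dist1 g^-1%g = dist1 g.
Proof. by rewrite /dist1 invgK addrC. Qed.

Lemma SL_mulV_mx g : SL_mx g^-1%g *m g = 1%:M.
Proof. by have /(congr1 (@SL_mx n R)) := mulVg g. Qed.
Lemma SL_mxM g h : SL_mx (g * h)%g = g *m h. Proof. by []. Qed.

(** Since g^-1 - 1 = g^-1 (1 - g), its norm z satisfies z <= (c + z) y, with y the norm of g - 1 and
    c that of the identity. For y <= 1/2 the term z y is absorbed and z <= 2 c y. *)
Lemma dist1_small (e : R) : 0 < e -> exists2 d, 0 < d &
  forall g, l1 (SL_mx g - 1%:M) < d -> dist1 g < e.
Proof.
move=> e0; pose c := l1 (1%:M : 'M[R]_n).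
have c0 : 0 <= c := l1_ge0 _.
pose d := Num.min (2^-1) (e / (2 * (2 * c + 1))).
have d0 : 0 < d by rewrite lt_min invr_gt0 ltr0n divr_gt0//; lra.
exists d => // g; rewrite lt_min => /andP[gh ge].
rewrite /dist1; set y := l1 (SL_mx g - 1%:M) in gh ge *; set z := l1 (_ - _).
have y0 : 0 <= y := l1_ge0 _.
have z0 : 0 <= z := l1_ge0 _.
have zy : z <= (c + z) * y.
  have zE : z = l1 (SL_mx g^-1%g *m (1%:M - SL_mx g)).
    by rewrite mulmxBr mulmx1 SL_mulV_mx.
  rewrite {1}zE (le_trans (l1M _ _))// -[l1 (1%:M - _)]l1N opprB -/y ler_wpM2r//.
  by have := l1D 1%:M (SL_mx g^-1%g - 1%:M); rewrite subrKC.
have zc : z <= 2 * (c * y).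
  have : z * y <= z * 2^-1 by rewrite ler_wpM2l// ltW.
  move: zy; rewrite mulrDl; lra.
have : y * (2 * (2 * c + 1)) < e by rewrite -ltr_pdivlMr//; lra.
have := mulr_ge0 c0 y0.
rewrite (_ : y * (2 * (2 * c + 1)) = 4 * (c * y) + 2 * y); last by ring.
lra.
Qed.

Lemma dist1_conj g h : dist1 (h^-1 * g * h)%g <= l1 (SL_mx h^-1%g) * l1 h * dist1 g.
Proof.
have key g' : l1 (SL_mx (h^-1 * g' * h)%g - 1%:M) <=
    l1 (SL_mx h^-1%g) * l1 h * l1 (SL_mx g' - 1%:M).
  have -> : SL_mx (h^-1 * g' * h)%g - 1%:M = SL_mx h^-1%g *m (SL_mx g' - 1%:M) *m h.
    by rewrite mulmxBr mulmxBl mulmx1 SL_mulV_mx.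
  rewrite (le_trans (l1M _ _))// mulrAC ler_wpM2r ?l1_ge0//.
  by rewrite (le_trans (l1M _ _)).
rewrite /dist1 mulrDr lerD//.
by rewrite !invgM invgK mulgA.
Qed.
Lemma dist1_near g (e : R) : 0 < e -> exists2 d, 0 < d &
  forall h, l1 (SL_mx h - SL_mx g) < d -> dist1 (g^-1 * h)%g < e.
Proof.
move=> e0; have [d d0 dP] := dist1_small e0.
exists (d / (l1 (SL_mx g^-1%g) + 1)); first by rewrite divr_gt0// ltr_pwDr// l1_ge0.
move=> h hg; apply: dP.
have -> : SL_mx (g^-1 * h)%g - 1%:M = SL_mx g^-1%g *m (SL_mx h - SL_mx g).
  by rewrite mulmxBr SL_mulV_mx.
rewrite (le_lt_trans (l1M _ _))//.
move: hg; rewrite ltr_pdivlMr; last by rewrite ltr_pwDr// l1_ge0.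
have := l1_ge0 (SL_mx g^-1%g); have := l1_ge0 (SL_mx h - SL_mx g); nra.
Qed.

(** For each rational matrix and each m one picks an element of SL_n(R) within 1/(m+1) of it, if
    there is one; the rational matrix itself may have another determinant. The pairs (matrix, m) are
    countable. *)
Lemma dense_SL_seq : exists q : nat -> SL n R,
  forall g e, 0 < e -> exists j, dist1 (g^-1 * q j)%g < e.
Proof.
pose P (M : 'M[rat]_n) (m : nat) h :=
  `[< l1 (SL_mx h - map_mx ratr M) < m.+1%:R^-1 >].
pose pick Mm := xget 1%g [set h | P Mm.1 Mm.2 h].
exists (fun k => if unpickle k is Some Mm then pick Mm else 1%g) => g e e0.
have [d d0 dP] := dist1_near g e0.
have [m] : exists m : nat, m.+1%:R^-1 < d / 2.
  have /ltr_add_invr[m] : 0 < d / 2 by rewrite divr_gt0.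
  by rewrite add0r => ?; exists m.
move=> mP.
have m0 : 0 < m.+1%:R^-1 :> R by [].
have [r r0 rP] := l1_lt n n m0.
have /choice[M MP] : forall ij : 'I_n * 'I_n, exists q : rat,
    `|SL_mx g ij.1 ij.2 - ratr q| < r.
  move=> ij; have /rat_in_itvoo[q qP] : SL_mx g ij.1 ij.2 - r < SL_mx g ij.1 ij.2 + r.
    by rewrite ltrD2l (lt_trans _ r0)// oppr_lt0.
  by exists q; move: qP; rewrite in_itv/= ltr_distlC.
pose M' : 'M[rat]_n := \matrix_(i, j) M (i, j).
have PM : P M' m g.
  by apply/asboolP; apply: rP => i j; rewrite !mxE; exact: (MP (i, j)).
exists (pickle (M', m)); rewrite pickleK.
have : P M' m (pick (M', m)) by rewrite /pick; case: xgetP => [h -> //|/(_ g)].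
move/asboolP: PM => PM /asboolP Ppick; apply: dP.
rewrite (_ : _ - _ = (SL_mx (pick (M', m)) - map_mx ratr M') - (SL_mx g - map_mx ratr M')); last first.
  by rewrite opprB addrA subrK.
rewrite (le_lt_trans (l1D _ _))// l1N (lt_trans (ltrD Ppick PM))//.
by rewrite [ltRHS]splitr ltrD.
Qed.

End l1norm.

(** * Finite adeles: congruences, density of Q, strong approximation *)

Section padic_field.
Variable p : prime_number.
Local Notation "\pip u" := (\pi_(padic p)%qT u : padic p) (at level 10).
Implicit Types (x y : padic p) (u : cauchy_seq p).

Lemma padic_abs_int (z : int) : padic_abs p z%:~R <= 1.
Proof.
apply: padic_abs_cofinite; rewrite denq_int.
exact: (prime_gt1 (prime_valP p)).
Qed.

(** The norms of a representative of x are eventually constant, equal to some c > 0, and then |1/a -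
    1/b| = |a - b| / c^2, so the termwise inverses form a Cauchy sequence. *)
Lemma padic_inv_ex x : x != 0 -> exists y, x * y = 1.
Proof.
move=> x0; have := x0; rewrite -[x]reprK; set u := repr x => u0.
have [c0 [N HN]] := padic_normE u0; set c := padic_norm _ in c0 HN.
have vP : (fun n => (u n)^-1) \in padic_cauchy p.
  apply/asboolP => e e0.
  have /asboolP/(_ (e * (c * c)))[|M HM] := cauchy_valP u.
    by rewrite !mulr_gt0.
  exists (maxn M N) => m n; rewrite !geq_max => /andP[Mm Nm] /andP[Mn Nn].
  have um : u m != 0 by rewrite -(padic_abs_eq0 p) HN// gt_eqF.
  have un : u n != 0 by rewrite -(padic_abs_eq0 p) HN// gt_eqF.
  have : padic_abs p ((u n - u m)) < e * (c * c) by exact: HM.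
  have -> : u n - u m = ((u m)^-1 - (u n)^-1) * (u m * u n).
    by rewrite mulrBl mulrA mulVf// mul1r [u m * u n]mulrC mulrA mulVf// mul1r.
  by rewrite !padic_absM !HN// ltr_pM2r// mulr_gt0.
exists (\pip (CauchySeq vP)); rewrite -rmorphM -(rmorph1 \pi_(padic p)%qT).
apply/eqP; rewrite -subr_eq0 -rmorphB padic_pi_eq0; apply/asboolP => e e0.
exists N => n Nn; rewrite (_ : cauchy_val _ n = u n * (u n)^-1 - 1)//.
rewrite mulfV ?subrr ?padic_abs0//.
by rewrite -(padic_abs_eq0 p) HN// gt_eqF.
Qed.

Lemma padic_rat_dense x (e : rat) : 0 < e -> exists q : rat,
  padic_norm (x - padic_of_rat p q) < e.
Proof.
move=> e0; rewrite -[x]reprK; set u := repr x.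
have /asboolP/(_ e e0)[N HN] := cauchy_valP u.
exists (u N).
have -> : \pip u - padic_of_rat p (u N) = \pip (u - CauchySeq (const_cauchy p (u N))).
  by rewrite rmorphB.
have [->|/padic_normE[_ [M HM]]] := eqVneq (\pip (u - CauchySeq (const_cauchy p (u N)))) 0.
  by rewrite padic_norm0.
by rewrite -(HM (maxn M N)) ?leq_maxl//= HN// leq_maxr.
Qed.

Lemma padic_abs_nat (N : nat) : (0 < N)%N -> padic_abs p N%:R = (p%:R ^+ logn p N)^-1.
Proof.
move=> N0; have := @padic_absE p N%:Z 1; rewrite /= invr1 mulr1 => ->//.
  by rewrite logn1 sub0r exprnN.
by rewrite -lt0n in N0 *; case: N N0.
Qed.

Lemma padic_abs_nat_gt0 (N : nat) : (0 < N)%N -> 0 < padic_abs p N%:R.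
Proof. by move=> N0; rewrite padic_abs_nat// invr_gt0 exprn_gt0// prime_gt0r. Qed.

Lemma padic_abs_nat_le1 (N : nat) : padic_abs p N%:R <= 1.
Proof. by have := padic_abs_int N%:Z; rewrite pmulrn. Qed.

Lemma padic_abs_nat_eq1 (N : nat) : (0 < N < p)%N -> padic_abs p N%:R = 1.
Proof.
move=> /andP[N0 Np]; rewrite padic_abs_nat// lognE prime_valP N0/=.
by rewrite gtnNdvd// expr0 invr1.
Qed.

(** A denominator prime to p has an inverse u modulo p^k by Bezout, and t is the numerator times
    u. *)
Lemma rat_int_approx (r : rat) k : padic_abs p r <= 1 ->
  exists t : int, padic_abs p (r - t%:~R) <= (p%:R ^+ k)^-1.
Proof.
have [->|r0] := eqVneq r 0.
  by exists 0; rewrite subr0 padic_abs0 invr_ge0 exprn_ge0// ler0n.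
move=> r1; have p1 : (1 : rat) < p%:R by rewrite ltr1n prime_gt1// prime_valP.
have cop : coprime `|denq r| (p ^ k).
  rewrite coprimeXr// coprime_sym prime_coprime ?prime_valP//.
  apply/negP => pd; move: r1; rewrite /padic_abs (negbTE r0) leNgt => /negP; apply.
  have -> : logn p `|numq r| = 0%N.
    rewrite logn_coprime// prime_coprime ?prime_valP//; apply/negP => pn.
    have : (p %| gcdn `|numq r| `|denq r|)%N by rewrite dvdn_gcd pn.
    rewrite (eqP (coprime_num_den r)) dvdn1 => /eqP p1'.
    by have := prime_valP p; rewrite p1'.
  rewrite subr0 -(expr0z (p%:R : rat)) ltr_eXz2l// ltz_nat logn_gt0.
  by rewrite mem_primes prime_valP pd absz_gt0 denq_neq0.
have /coprimezP[[u v] /= uv] : coprimez (denq r) (p ^ k)%N%:Z.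
  by rewrite coprimezE.
exists (numq r * u).
have -> : r - (numq r * u)%:~R = r * (v%:~R * p%:R ^+ k).
  have -> : v%:~R * p%:R ^+ k = (1 - u * denq r)%:~R :> rat.
    by rewrite -uv addrC addKr intrM -natrX pmulrn.
  rewrite intrB mulrBr mulr1 !intrM numqE.
  by rewrite [u%:~R * _]mulrC mulrA.
rewrite !padic_absM -natrX padic_abs_nat ?expn_gt0 ?prime_gt0 ?prime_valP//.
rewrite pfactorK ?prime_valP// natrX mulrA ler_piMl ?invr_ge0 ?exprn_ge0 ?ler0n//.
by rewrite mulr_ile1 ?padic_abs_ge0// padic_abs_int.
Qed.

Lemma padic_int_approx x k : padic_norm x <= 1 ->
  exists t : int, padic_norm (x - padic_of_rat p t%:~R) <= (p%:R ^+ k)^-1.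
Proof.
move=> x1; have pk0 : 0 < (p%:R ^+ k)^-1 :> rat.
  by rewrite invr_gt0 exprn_gt0// prime_gt0r.
have [r xr] := padic_rat_dense x pk0.
have r1 : padic_abs p r <= 1.
  rewrite -padic_norm_rat -[padic_of_rat p r](subKr x).
  rewrite (le_trans (padic_normD _ _))// ge_max x1 padic_normN (le_trans (ltW xr))//.
  by rewrite invf_le1 ?exprn_gt0 ?prime_gt0r// exprn_ege1// ler1n prime_gt0// prime_valP.
have [t rt] := rat_int_approx k r1; exists t.
rewrite -[x](subrK (padic_of_rat p r)) -addrA -rmorphB.
rewrite (le_trans (padic_normD _ _))// ge_max (ltW xr)//=.
by rewrite padic_norm_rat.
Qed.

End padic_field.

Section fin_adele.
Implicit Types (x y : fin_adele) (N M D : nat) (p : prime_number).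
Local Notation fval := fin_adele_val.

Lemma fin_adeleD x y p : fval (x + y) p = fval x p + fval y p. Proof. by []. Qed.
Lemma fin_adeleN x p : fval (- x) p = - fval x p. Proof. by []. Qed.
Lemma fin_adeleM x y p : fval (x * y) p = fval x p * fval y p. Proof. by []. Qed.
Lemma fin_adele_ratE q p : fval (fin_adele_of_rat q) p = padic_of_rat p q. Proof. by []. Qed.

Lemma fin_adele_natE N p : fval (N%:R) p = padic_of_rat p N%:R.
Proof. by rewrite -fin_adele_ratE rmorph_nat. Qed.

Lemma padic_norm_nat N p : padic_norm (fval N%:R p) = padic_abs p N%:R.
Proof. by rewrite fin_adele_natE padic_norm_rat. Qed.

(* x belongs to N Zhat *)
Definition fcong N x := forall p, padic_norm (fval x p) <= padic_abs p N%:R.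

Lemma fcong0 N : fcong N 0.
Proof. by move=> p; rewrite padic_norm0 padic_abs_ge0. Qed.

Lemma fcongD N x y : fcong N x -> fcong N y -> fcong N (x + y).
Proof. by move=> xN yN p; rewrite (le_trans (padic_normD _ _))// ge_max xN yN. Qed.

Lemma fcongN N x : fcong N x -> fcong N (- x).
Proof. by move=> xN p; rewrite fin_adeleN padic_normN. Qed.
Lemma fcongM M N x y : fcong M x -> fcong N y -> fcong (M * N) (x * y).
Proof.
move=> xM yN p; rewrite fin_adeleM padic_normM natrM padic_absM.
by rewrite ler_pM// padic_norm_ge0.
Qed.

Lemma fcong_sum N (I : Type) (r : seq I) (P : pred I) (F : I -> fin_adele) :
  (forall i, P i -> fcong N (F i)) -> fcong N (\sum_(i <- r | P i) F i).
Proof. by move=> H; elim/big_ind: _ => //; [exact: fcong0|exact: fcongD]. Qed.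

Lemma fcong_mull N M x : fcong (M * N) x -> fcong N x.
Proof.
move=> H p; rewrite (le_trans (H p))// natrM padic_absM ler_piMl ?padic_abs_ge0//.
exact: padic_abs_nat_le1.
Qed.

Lemma fcong_mulr N M x : fcong (N * M) x -> fcong N x.
Proof. by rewrite mulnC; exact: fcong_mull. Qed.

Lemma fcong1P x : fcong 1 x <-> forall p, padic_int (fval x p).
Proof. by split => + p => /(_ p); rewrite padic_abs1. Qed.

(* a has denominator D *)
Lemma fcong_den D N a x : (0 < D)%N -> fcong 1 (D%:R * a) -> fcong (D * N) x ->
  fcong N (a * x).
Proof.
move=> D0 Da xDN p; have := Da p; have := xDN p.
rewrite padic_abs1 !fin_adeleM !padic_normM padic_norm_nat natrM padic_absM => h1 h2.
have d0 := padic_abs_nat_gt0 p D0.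
rewrite -(ler_pM2l d0); apply: le_trans h1.
by rewrite mulrA ler_piMl// padic_norm_ge0.
Qed.

Lemma finite_primes_bounded (A : set prime_number) : finite_set A ->
  exists B : nat, forall p, A p -> (p < B)%N.
Proof.
move=> /(finite_image prime_val)/finite_seqP[F AF].
exists (\max_(i <- F) i).+1 => p Ap; rewrite ltnS.
apply: (@leq_bigmax_seq _ F xpredT id p) => //.
have : (prime_val @` A) p by exists p.
by rewrite AF.
Qed.

(** Glues local choices at finitely many primes into one integer, by multiplying them; the second
    premise says that a choice survives multiplication. *)
Lemma bounded_prime_choice (P : prime_number -> nat -> Prop) :
  (forall p, exists2 N, (0 < N)%N & P p N) ->
  (forall p N M, (0 < N)%N -> (0 < M)%N -> P p N -> P p (N * M)%N) ->
  forall B, exists2 N, (0 < N)%N & forall p, (p < B)%N -> P p N.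
Proof.
move=> Pex PM; elim=> [|B [N N0 NP]]; first by exists 1%N.
have [pB|npB] := boolP (prime B); last first.
  exists N => // p; rewrite ltnS leq_eqVlt => /orP[/eqP pB|]; last exact: NP.
  by move: npB; rewrite -pB prime_valP.
have [M M0 MP] := Pex (PrimeNumber pB).
exists (N * M)%N => [|p]; first by rewrite muln_gt0 N0.
rewrite ltnS leq_eqVlt => /orP[/eqP pE|/NP]; last exact: PM.
rewrite mulnC; apply: PM => //.
rewrite (_ : p = PrimeNumber pB)//; case: p pE => p pp /= pE; subst p.
by congr PrimeNumber; exact: bool_irrelevance.
Qed.

Lemma padic_abs_pow_lt p (e : rat) : 0 < e ->
  exists2 N, (0 < N)%N & padic_abs p N%:R < e.
Proof.
move=> e0; have [k ke] : exists k : nat, e^-1 < k%:R.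
  by exists (Num.bound e^-1); rewrite archi_boundP// invr_ge0 ltW.
exists (p ^ k)%N; first by rewrite expn_gt0 prime_gt0// prime_valP.
rewrite padic_abs_nat ?expn_gt0 ?prime_gt0 ?prime_valP// pfactorK ?prime_valP//.
rewrite invf_plt ?posrE ?exprn_gt0 ?prime_gt0r// (lt_le_trans ke)//.
by rewrite -natrX ler_nat ltnW// ltn_expl// prime_gt1// prime_valP.
Qed.

Lemma fin_adele_den x : exists2 D, (0 < D)%N & fcong 1 (D%:R * x).
Proof.
have /asboolP/finite_primes_bounded[B HB] := fin_adele_valP x.
have [p|p N M N0 M0|D D0 DP] :=
    @bounded_prime_choice (fun p N => padic_norm (fval (N%:R * x) p) <= 1) _ _ B.
- have x0 : 0 < (padic_norm (fval x p) + 1)^-1 by rewrite invr_gt0 ltr_wpDl// padic_norm_ge0.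
  have [N N0 NP] := padic_abs_pow_lt p x0.
  exists N => //; rewrite fin_adeleM padic_normM padic_norm_nat.
  move: NP; rewrite -div1r ltr_pdivlMr ?ltr_wpDl ?padic_norm_ge0// => /ltW; apply: le_trans.
  by rewrite ler_wpM2l ?padic_abs_ge0// lerDl.
- rewrite !fin_adeleM !padic_normM !padic_norm_nat natrM padic_absM => h.
  by rewrite mulrAC mulr_ile1// ?mulr_ge0 ?padic_abs_ge0 ?padic_norm_ge0// padic_abs_nat_le1.
exists D => // p; rewrite padic_abs1; have [pB|Bp] := ltnP p B; first exact: DP.
rewrite fin_adeleM padic_normM padic_norm_nat mulr_ile1 ?padic_abs_ge0 ?padic_norm_ge0//.
  exact: padic_abs_nat_le1.
by apply: contrapT => /(HB p); rewrite ltnNge Bp.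
Qed.

Lemma finite_primes_lt N : finite_set [set p : prime_number | (p < N)%N].
Proof.
have : finite_set (prime_val @^-1` `I_N).
  apply: finite_preimage; last exact: finite_II.
  by move=> [p pp] [r pr] _ _ /= pr'; subst r; congr PrimeNumber; exact: bool_irrelevance.
by [].
Qed.

(** The cosets of N Zhat form a neighbourhood basis. A basic box differs from Z_p at finitely many
    primes, and one N serves them all; elsewhere the side Z_p absorbs integral perturbations.
    Conversely x + N Zhat is a box with side Z_p at each p > N where x is integral. *)
Lemma fin_adele_nbhsP x (U : set fin_adele) : nbhs x U <->
  exists2 N, (0 < N)%N & forall y, fcong N (y - x) -> U y.
Proof.
rewrite nbhsE; split => [[V [oV Vx] VU]|[N N0 NU]].
  have [B [[oB fB] Bx BV]] := (oV : fin_adele_open V) _ Vx.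
  have [b0 Hb] := finite_primes_bounded fB.
  pose good p N := forall z : padic p, padic_norm (z - fval x p) <= padic_abs p N%:R -> B p z.
  have [p|p N M N0 M0 NP z zM|N N0 NP] := @bounded_prime_choice good _ _ b0.
  - have [r r0 rB] := (oB p : padic_open (B p)) _ (Bx p).
    have [N N0 NP] := padic_abs_pow_lt p r0; exists N => // z zN.
    by apply: rB; rewrite /padic_ball/= (le_lt_trans zN).
  - apply: NP; rewrite (le_trans zM)// natrM padic_absM ler_piMr ?padic_abs_ge0//.
    exact: padic_abs_nat_le1.
  exists N => // y yN; apply: VU; apply: BV => p.
  have [pb|bp] := ltnP p b0; first exact/(NP p pb)/yN.
  have BpE : B p = @padic_int p.
    by apply: contrapT => /(Hb p); rewrite ltnNge bp.
  have := Bx p; rewrite BpE => xp; rewrite -(subrK (fval x p) (fval y p)).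
  rewrite -[X in padic_int (_ + X)]opprK; apply: padic_intB.
    by rewrite /padic_int/= (le_trans (yN p))// padic_abs_nat_le1.
  by rewrite /padic_int/= padic_normN.
exists [set y | fcong N (y - x)]; last by move=> y /NU.
split; last by rewrite /= subrr; exact: fcong0.
suff : fin_adele_open [set y | fcong N (y - x)] by [].
move=> y Ny; exists (fun p => [set z | padic_norm (z - fval x p) <= padic_abs p N%:R]).
split => //; split=> [p|].
  suff : padic_open [set z : padic p | padic_norm (z - fval x p) <= padic_abs p N%:R] by [].
  move=> z /= zN; exists (padic_abs p N%:R); first exact: padic_abs_nat_gt0.
  move=> z' /= /ltW zz'; rewrite -(subrK z z') -addrA.
  by rewrite (le_trans (padic_normD _ _))// ge_max zz'.
have /asboolP fx := fin_adele_valP x.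
have := finite_primes_lt N.+1 => fN.
apply: sub_finite_set (_ : finite_set ([set p | ~ padic_int (fval x p)] `|` [set p : prime_number | (p < N.+1)%N])); last by rewrite finite_setU.
move=> p /= /contra_notP; apply; rewrite not_orE !notK => -[xp /negP].
rewrite -leqNgt => Np; apply/seteqP; rewrite padic_abs_nat_eq1 ?N0//; split => z /= zx.
  rewrite -(subrK (fval x p) z) -[X in padic_int (_ + X)]opprK; apply: padic_intB => //.
  by rewrite /padic_int/= padic_normN.
exact: padic_intB.
Qed.

End fin_adele.

Section fin_adele_approximation.
Implicit Types (x y : fin_adele) (N M D : nat) (p : prime_number).
Local Notation fval := fin_adele_val.

Lemma fin_adele_rat_dense x N : (0 < N)%N ->
  exists q : rat, fcong N (x - fin_adele_of_rat q).
Proof.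
move=> N0.
suff H y M : (0 < M)%N -> fcong 1 y -> exists z : int, fcong M (y - fin_adele_of_rat z%:~R).
  have [D D0 xD] := fin_adele_den x.
  have [//|z zP] := H _ (D * N)%N _ xD; first by rewrite muln_gt0 D0.
  exists (z%:~R / D%:R).
  have -> : x - fin_adele_of_rat (z%:~R / D%:R) =
      fin_adele_of_rat (D%:R^-1) * (D%:R * x - fin_adele_of_rat z%:~R).
    rewrite mulrBr -rmorphM mulrA -(rmorph_nat fin_adele_of_rat) -rmorphM.
    by rewrite mulVf ?pnatr_eq0 -?lt0n// rmorph1 mul1r [_ / _]mulrC.
  apply: fcong_den zP => //.
  rewrite -(rmorph_nat fin_adele_of_rat) -rmorphM mulfV ?pnatr_eq0 -?lt0n//.
  by apply/fcong1P => p; rewrite rmorph1; exact: padic_int1.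
move=> M0 y1.
suff {}H : forall B, exists z : int, forall p, (p < B)%N ->
    padic_norm (fval y p - padic_of_rat p z%:~R) <= padic_abs p M%:R.
  (* For p > M the norm of M is 1, so every integer z is close enough there and only the primes up
     to M matter. *)
  have [z Hz] := H M.+1; exists z => p; have [pM|Mp] := ltnP p M.+1.
    exact: Hz.
  rewrite padic_abs_nat_eq1 ?M0//; apply: padic_intB; first exact: (fcong1P _).1.
  by rewrite /padic_int/= padic_norm_rat padic_abs_int.
elim=> [|B [z zB]]; first by exists 0.
have [pB|npB] := boolP (prime B); last first.
  exists z => // p; rewrite ltnS leq_eqVlt => /orP[/eqP pB|]; last exact: zB.
  by move: npB; rewrite -pB prime_valP.
pose q := PrimeNumber pB.
have [N' [N'0 N'q N'M]] : exists N', [/\ (0 < N')%N, padic_abs q N'%:R = 1 &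
    forall p, (p < B)%N -> padic_abs p N'%:R <= padic_abs p M%:R].
  (* The part of M prime to B is a unit at B and has the same norm as M at every smaller prime:
     adding a multiple of it corrects z at B and keeps the earlier congruences. *)
  exists (M`_B^')%N; split; first exact: part_gt0.
    rewrite padic_abs_nat ?part_gt0// logn_coprime ?expr0 ?invr1//.
    rewrite prime_coprime//; apply/negP => qM.
    have /pnatP := part_pnat (negn (nat_pred_of_nat B)) M; rewrite part_gt0 => /(_ isT B pB qM).
    by rewrite inE/= inE eqxx.
  move=> p pB'; rewrite !padic_abs_nat ?part_gt0//.
  rewrite -[in leRHS](partnC (nat_pred_of_nat B) M0) lognM ?part_gt0// p_part lognX.
  by rewrite (logn_prime _ pB) ltn_eqF// muln0.
have N'inv : padic_norm (padic_of_rat q (N'%:R^-1)) = 1.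
  rewrite padic_norm_rat; have := padic_absM q N'%:R N'%:R^-1.
  by rewrite mulfV ?pnatr_eq0 -?lt0n// padic_abs1 N'q mul1r.
have [t tP] : exists t : int, padic_norm ((fval y q - padic_of_rat q z%:~R) * padic_of_rat q N'%:R^-1
     - padic_of_rat q t%:~R) <= (q%:R ^+ logn q M)^-1.
  apply: padic_int_approx; rewrite padic_normM N'inv mulr1.
  apply: padic_intB; first exact: (fcong1P _).1.
  by rewrite /padic_int/= padic_norm_rat padic_abs_int.
exists (z + N'%:Z * t) => p; rewrite ltnS leq_eqVlt => /orP[/eqP pE|pB'].
  rewrite (_ : p = q); last first.
    by case: p pE => p pp /= pE; rewrite /q; subst p; congr PrimeNumber; exact: bool_irrelevance.
  rewrite padic_abs_nat//; apply: le_trans tP.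
  set u := _ - padic_of_rat q t%:~R.
  have -> : padic_norm u = padic_norm (padic_of_rat q N'%:R * u).
    by rewrite padic_normM padic_norm_rat N'q mul1r.
  rewrite /u mulrBr mulrCA -!rmorphM mulfV ?pnatr_eq0 -?lt0n// rmorph1 mulr1.
  by rewrite intrD intrM rmorphD opprD addrA -pmulrn.
rewrite intrD rmorphD opprD addrA.
rewrite (le_trans (padic_normD _ _))// ge_max zB//= padic_normN.
rewrite padic_norm_rat intrM padic_absM -pmulrn.
by rewrite (le_trans _ (N'M p pB'))// ler_piMr ?padic_abs_ge0// padic_abs_int.
Qed.

(** At each place t is 0 or 1, chosen such that |a + t b| = max(|a|, |b|): when |a| < |b| the
    ultrametric inequality makes |a + b| = |b|. Because x a + y b = 1, this maximum is nonzero, and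
    it is at least 1 wherever x and y are integral, so the placewise inverse w is again a finite
    adele. *)
Lemma fin_adele_stable_range1 : stable_range1 fin_adele.
Proof.
move=> a b x y xy.
pose t : padic_prod := fun p =>
  if padic_norm (fval b p) <= padic_norm (fval a p) then 0 else 1.
have tP : t \in almost_integral.
  apply/asboolP; rewrite (_ : mkset _ = set0)//.
  apply/seteqP; split => // p /= []; rewrite /t; case: ifP => _; last exact: padic_int1.
  by rewrite /padic_int/= padic_norm0.
pose c := a + FinAdele tP * b.
have cE p : padic_norm (fval c p) = Num.max (padic_norm (fval a p)) (padic_norm (fval b p)).
  rewrite fin_adeleD fin_adeleM /= /t; case: leP => ba.
    by rewrite mul0r addr0.
  rewrite mul1r; apply/eqP; rewrite eq_le; apply/andP; split.
    by rewrite (le_trans (padic_normD _ _))// ge_max lexx ltW.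
  have := padic_normD (fval a p + fval b p) (- fval a p).
  by rewrite addrAC subrr add0r padic_normN le_max orbC leNgt ba.
have ab p : 1 <= Num.max (padic_norm (fval x p) * padic_norm (fval a p))
    (padic_norm (fval y p) * padic_norm (fval b p)).
  have := padic_normD (fval x p * fval a p) (fval y p * fval b p).
  rewrite -!padic_normM -!fin_adeleM -fin_adeleD xy; apply: le_trans.
  by rewrite padic_norm1.
have c0 p : fval c p != 0.
  rewrite -padic_norm_eq0 cE; apply/eqP => ab0.
  have a0 : padic_norm (fval a p) = 0.
    by apply/eqP; rewrite eq_le padic_norm_ge0 andbT -ab0 le_max lexx.
  have b0 : padic_norm (fval b p) = 0.
    by apply/eqP; rewrite eq_le padic_norm_ge0 andbT -ab0 le_max lexx orbT.
  by have := ab p; rewrite a0 b0 !mulr0 maxxx ler10.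
have /= winv p := padic_inv_ex (c0 p).
pose w : padic_prod := fun p => sval (cid (winv p)).
have cw p : fval c p * w p = 1 by rewrite /w; case: cid.
have wP : w \in almost_integral.
  apply/asboolP.
  have /asboolP fa := fin_adele_valP a; have /asboolP fb := fin_adele_valP b.
  have /asboolP fx := fin_adele_valP x; have /asboolP fy := fin_adele_valP y.
  have : finite_set ([set p | ~ padic_int (fval a p)] `|` [set p | ~ padic_int (fval b p)]
     `|` ([set p | ~ padic_int (fval x p)] `|` [set p | ~ padic_int (fval y p)])).
    by rewrite !finite_setU.
  apply: sub_finite_set => p /= /contra_notP; apply.
  rewrite !not_orE !notK => -[[ap bp] [xp yp]].
  have c1 : 1 <= padic_norm (fval c p).
    rewrite cE (le_trans (ab p))// ge_max !le_max; apply/andP; split; apply/orP.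
      by left; rewrite ler_piMl// padic_norm_ge0.
    by right; rewrite ler_piMl// padic_norm_ge0.
  have := padic_normM (fval c p) (w p); rewrite cw padic_norm1 /padic_int/= => ->.
  by rewrite ler_peMl// padic_norm_ge0.
exists (FinAdele tP), (FinAdele wP); apply: val_inj.
by apply: functional_extensionality_dep => p; exact: cw.
Qed.

End fin_adele_approximation.

Section congruence_subgroups.
Variable n : nat.
Implicit Types (N M D : nat) (g h k : SL n fin_adele).

Definition mcong m l N (A : 'M[fin_adele]_(m, l)) := forall i j, fcong N (A i j).

Lemma mcongD m l N (A B : 'M[fin_adele]_(m, l)) : mcong N A -> mcong N B -> mcong N (A + B).
Proof. by move=> NA NB i j; rewrite mxE; exact: fcongD. Qed.

Lemma mcongN m l N (A : 'M[fin_adele]_(m, l)) : mcong N A -> mcong N (- A).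
Proof. by move=> NA i j; rewrite mxE; exact: fcongN. Qed.

Lemma mcongM m l o M N (A : 'M[fin_adele]_(m, l)) (B : 'M[fin_adele]_(l, o)) :
  mcong M A -> mcong N B -> mcong (M * N) (A *m B).
Proof. by move=> MA NB i j; rewrite mxE; apply: fcong_sum => a _; exact: fcongM. Qed.

Lemma mcong_mulr m l N M (A : 'M[fin_adele]_(m, l)) : mcong (N * M) A -> mcong N A.
Proof. by move=> H i j; exact: fcong_mulr (H i j). Qed.

Lemma mcong_mull m l N M (A : 'M[fin_adele]_(m, l)) : mcong (M * N) A -> mcong N A.
Proof. by move=> H i j; exact: fcong_mull (H i j). Qed.

Lemma fcong_1 : fcong 1 1.
Proof. by move=> p; rewrite padic_norm1 padic_abs1. Qed.

Lemma fcong1M x y : fcong 1 x -> fcong 1 y -> fcong 1 (x * y).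
Proof. exact: fcongM. Qed.

Lemma fcong_sign e : fcong 1 ((-1) ^+ e).
Proof.
elim: e => [|e IH]; first exact: fcong_1.
by rewrite exprS; apply: fcong1M => //; apply/fcongN/fcong_1.
Qed.

Lemma fcong_det m (A : 'M[fin_adele]_m) : mcong 1 A -> fcong 1 (\det A).
Proof.
move=> A1; apply: fcong_sum => s _; apply: fcong1M; first exact: fcong_sign.
by elim/big_ind: _ => [||i _]; [exact: fcong_1|exact: fcong1M|exact: A1].
Qed.

Lemma mcong_adj m (A : 'M[fin_adele]_m) : mcong 1 A -> mcong 1 (\adj A).
Proof.
move=> A1 i j; rewrite mxE; apply: fcong1M; first exact: fcong_sign.
by apply: fcong_det => a b; rewrite !mxE.
Qed.

Lemma mcong_den m l (A : 'M[fin_adele]_(m, l)) : exists2 D, (0 < D)%N & mcong 1 (D%:R *: A).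
Proof.
have /choice[D HD] : forall ij : 'I_m * 'I_l, exists D, (0 < D)%N /\ fcong 1 (D%:R * A ij.1 ij.2).
  by move=> ij; have [D] := fin_adele_den (A ij.1 ij.2); exists D.
exists (\prod_ij D ij)%N.
  by rewrite prodn_gt0// => ij; have [] := HD ij.
move=> i j; rewrite mxE (bigD1 (i, j))//= natrM mulrAC.
rewrite -[1%N]muln1; apply: fcongM; first by have [] := HD (i, j).
by move=> p; rewrite padic_norm_nat padic_abs1 padic_abs_nat_le1.
Qed.

Lemma mcong_denM m l o D N (A : 'M[fin_adele]_(m, l)) (B : 'M[fin_adele]_(l, o)) : (0 < D)%N ->
  mcong 1 (D%:R *: A) -> mcong (D * N) B -> mcong N (A *m B).
Proof.
move=> D0 DA DNB i j; rewrite mxE; apply: fcong_sum => a _.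
by apply: fcong_den D0 _ (DNB _ _); have := DA i a; rewrite mxE.
Qed.

Lemma mcong_Mden m l o D N (A : 'M[fin_adele]_(m, l)) (B : 'M[fin_adele]_(l, o)) : (0 < D)%N ->
  mcong 1 (D%:R *: B) -> mcong (D * N) A -> mcong N (A *m B).
Proof.
move=> D0 DB DNA i j; rewrite mxE; apply: fcong_sum => a _.
by rewrite mulrC; apply: fcong_den D0 _ (DNA _ _); have := DB a j; rewrite mxE.
Qed.

(* the principal congruence subgroup of level N of SL_n(Zhat) *)
Definition Kcong N k := mcong N (SL_mx k - 1%:M).

Lemma Kcong1 N : Kcong N 1%g.
Proof. by move=> i j; rewrite subrr mxE; exact: fcong0. Qed.

Lemma Kcong_mull N M k : Kcong (M * N) k -> Kcong N k.
Proof. exact: mcong_mull. Qed.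

Lemma Kcong_int N k : Kcong N k -> mcong 1 (SL_mx k).
Proof.
move=> Nk; rewrite -(subrK 1%:M (SL_mx k)); apply: mcongD.
  by apply: (@mcong_mulr _ _ 1 N); rewrite mul1n.
by move=> i j; rewrite mxE; case: eqP => _; [exact: fcong_1|exact: fcong0].
Qed.

Lemma KcongM N h k : Kcong N h -> Kcong N k -> Kcong N (h * k)%g.
Proof.
move=> Nh Nk; rewrite /Kcong.
have -> : SL_mx (h * k)%g - 1%:M = (SL_mx h - 1%:M) *m k + (SL_mx k - 1%:M).
  by rewrite mulmxBl mul1mx addrA subrK.
by apply: mcongD => //; rewrite -[N]muln1; apply: mcongM => //; exact: Kcong_int Nk.
Qed.

Lemma SL_mulV_mx_gen (S : comNzRingType) (k : SL n S) : SL_mx k^-1%g *m k = 1%:M.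
Proof. by have /(congr1 (@SL_mx n S)) := mulVg k. Qed.

Lemma KcongV N k : Kcong N k -> Kcong N k^-1%g.
Proof.
move=> Nk; rewrite /Kcong.
have -> : SL_mx k^-1%g - 1%:M = - (SL_mx k^-1%g *m (SL_mx k - 1%:M)).
  by rewrite mulmxBr mulmx1 SL_mulV_mx_gen opprB.
apply: mcongN; rewrite -[N]mul1n; apply: mcongM => //.
exact/mcong_adj/(Kcong_int Nk).
Qed.

Lemma Kcong_conj g N : (0 < N)%N -> exists2 M, (0 < M)%N &
  forall k, Kcong M k -> Kcong N (g^-1 * k * g)%g.
Proof.
move=> N0; have [D D0 DP] := mcong_den (SL_mx g^-1%g).
have [E E0 EP] := mcong_den (SL_mx g).
exists (D * (E * N))%N; first by rewrite !muln_gt0 D0 E0.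
move=> k Mk; rewrite /Kcong.
have -> : SL_mx (g^-1 * k * g)%g - 1%:M = SL_mx g^-1%g *m (SL_mx k - 1%:M) *m g.
  by rewrite mulmxBr mulmxBl mulmx1 SL_mulV_mx_gen.
by apply: (mcong_Mden E0 EP); apply: (mcong_denM D0 DP).
Qed.

Lemma Kcong_rel g N : (0 < N)%N -> exists2 M, (0 < M)%N &
  forall h, mcong M (SL_mx h - SL_mx g) -> Kcong N (g^-1 * h)%g.
Proof.
move=> N0; have [D D0 DP] := mcong_den (SL_mx g^-1%g).
exists (D * N)%N; first by rewrite muln_gt0 D0.
move=> h Mh; rewrite /Kcong.
have -> : SL_mx (g^-1 * h)%g - 1%:M = SL_mx g^-1%g *m (SL_mx h - SL_mx g).
  by rewrite mulmxBr SL_mulV_mx_gen.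
exact: mcong_denM D0 DP Mh.
Qed.

Lemma mcong_rel g N : (0 < N)%N -> exists2 M, (0 < M)%N &
  forall k, Kcong M k -> mcong N (SL_mx (g * k)%g - SL_mx g).
Proof.
move=> N0; have [D D0 DP] := mcong_den (SL_mx g).
exists (D * N)%N; first by rewrite muln_gt0 D0.
move=> k Mk.
have -> : SL_mx (g * k)%g - SL_mx g = SL_mx g *m (SL_mx k - 1%:M).
  by rewrite mulmxBr mulmx1.
exact: mcong_denM D0 DP Mk.
Qed.

Lemma map_elem (S T : comNzRingType) (f : {rmorphism S -> T}) (i j : 'I_n) s :
  SL_map f (elem i j s) = elem i j (f s).
Proof.
apply: val_inj; apply/matrixP => a b; rewrite !mxE rmorphD rmorphM.
by rewrite !rmorph_nat [f (_ *+ _)]rmorphMn.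
Qed.

Lemma strong_approximation g N : (0 < N)%N ->
  exists gamma : SL n rat, Kcong N ((SL_map fin_adele_of_rat gamma)^-1 * g)%g.
Proof.
move=> N0; pose P g := forall N, (0 < N)%N ->
  exists gamma : SL n rat, Kcong N ((SL_map fin_adele_of_rat gamma)^-1 * g)%g.
apply: (SL_elem_ind (P := P) fin_adele_stable_range1) N0 => {N g} [N _|i j s g IH N N0].
  by exists 1%g; rewrite SL_map1 mulg1 invg1; exact: Kcong1.
have [gamma gP] := IH N N0; set c := SL_map _ gamma in gP *.
(* The new rational matrix is [elem i j q] times the old one, so the error [elem i j (s - q)] comes
   conjugated by c. Hence q is chosen at a level M that survives this conjugation. *)
have [M M0 MP] := Kcong_conj c N0.
have [q qP] := fin_adele_rat_dense s M0.
exists (elem i j q * gamma)%g; rewrite SL_mapM map_elem -/c invgM.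
have -> : (c^-1 * (elem i j (fin_adele_of_rat q))^-1 * (elem i j s * g) =
   (c^-1 * elem i j (s - fin_adele_of_rat q) * c) * (c^-1 * g))%g.
  by rewrite addrC elemD elemV !mulgA mulgK.
apply: KcongM => //; apply: MP => a b.
rewrite /= /elem_mx addrC addKr mxE mxE.
have [_|_] := eqVneq i j; first by rewrite mul0r; exact: fcong0.
rewrite mulr1n; case: (_ && _); last by rewrite mulr0; exact: fcong0.
by rewrite mulr1.
Qed.

End congruence_subgroups.

(** * The space of cosets *)

Section adelic_group.
Variables (R : realType) (n : nat).
Implicit Types (g h : SL n (adele R)) (r s : SL n R) (k l : SL n fin_adele).

Definition SL_re g : SL n R := SL_map (fst : {rmorphism adele R -> R}) g.
Definition SL_fi g : SL n fin_adele := SL_map (snd : {rmorphism adele R -> fin_adele}) g.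

Lemma SL_pair_proof r k :
  \det (\matrix_(i, j) ((r i j, k i j) : adele R)) == 1.
Proof.
set A := \matrix_(i, j) _.
have /(congr1 determinant) : map_mx fst A = r.
  by apply/matrixP => i j; rewrite !mxE.
have /(congr1 determinant) : map_mx snd A = k.
  by apply/matrixP => i j; rewrite !mxE.
rewrite !det_map_mx !SL_det => h2 h1.
by apply/eqP; rewrite [LHS]surjective_pairing h1 h2.
Qed.

Definition SL_pair r k : SL n (adele R) := MkSL (SL_pair_proof r k).

Lemma SL_re_pair r k : SL_re (SL_pair r k) = r.
Proof. by apply: val_inj; apply/matrixP => i j; rewrite !mxE. Qed.

Lemma SL_fi_pair r k : SL_fi (SL_pair r k) = k.
Proof. by apply: val_inj; apply/matrixP => i j; rewrite !mxE. Qed.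

Lemma SL_pairK g : SL_pair (SL_re g) (SL_fi g) = g.
Proof.
apply: val_inj; apply/matrixP => i j; rewrite !mxE.
by rewrite -surjective_pairing.
Qed.

Lemma SL_reM : {morph SL_re : g h / (g * h)%g}.
Proof. by move=> g h; exact: SL_mapM. Qed.

Lemma SL_fiM : {morph SL_fi : g h / (g * h)%g}.
Proof. by move=> g h; exact: SL_mapM. Qed.

Lemma SL_pairM r s k l : (SL_pair r k * SL_pair s l)%g = SL_pair (r * s)%g (k * l)%g.
Proof.
by rewrite -[LHS]SL_pairK SL_reM SL_fiM !SL_re_pair !SL_fi_pair.
Qed.

Lemma SL_iotaE r : SL_iota r = SL_pair r 1%g.
Proof. by apply: val_inj; apply/matrixP => i j; rewrite !mxE. Qed.

Lemma SL_iotaM r s : SL_iota (r * s)%g = (SL_iota r * SL_iota s)%g.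
Proof. by rewrite !SL_iotaE SL_pairM mulg1. Qed.

Lemma SL_pairE r k : SL_pair r k = (SL_iota r * SL_pair 1%g k)%g.
Proof. by rewrite SL_iotaE SL_pairM mulg1 mul1g. Qed.

Lemma SL_pair_comm r k : (SL_iota r * SL_pair 1%g k)%g = (SL_pair 1%g k * SL_iota r)%g.
Proof. by rewrite SL_iotaE !SL_pairM !mulg1 !mul1g. Qed.

Lemma SL_pair11 : SL_pair 1%g 1%g = 1%g.
Proof. by rewrite -[RHS]SL_pairK /SL_re /SL_fi !SL_map1. Qed.

Lemma SL_diagE (c : SL n rat) :
  SL_diag R c = SL_pair (SL_map ratr c) (SL_map fin_adele_of_rat c).
Proof. by apply: val_inj; apply/matrixP => i j; rewrite !mxE. Qed.

Lemma nbhs_SL_adele g (U : set (SL n (adele R))) : nbhs g U ->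
  exists2 e, 0 < e & exists2 N, (0 < N)%N & forall h,
    l1 (SL_mx (SL_re h) - SL_mx (SL_re g)) < e ->
    mcong N (SL_mx (SL_fi h) - SL_mx (SL_fi g)) -> U h.
Proof.
rewrite nbhsE => -[_ [[V oV <-] Vg] VU].
have : nbhs (SL_mx g) V by apply: open_nbhs_nbhs; split.
move=> [P gP PV].
have /choice[e He] : forall ij : 'I_n * 'I_n, exists eN : R * nat,
    [/\ 0 < eN.1, (0 < eN.2)%N & forall z : adele R,
      `|z.1 - (g ij.1 ij.2).1| < eN.1 -> fcong eN.2 (z.2 - (g ij.1 ij.2).2) -> P ij.1 ij.2 z].
  move=> [i j] /=; have [[Q1 Q2] [/= /nbhs_ballP[e /= e0 eQ1] /fin_adele_nbhsP[N N0 NQ2] QP]] := gP i j.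
  exists (e, N); split => // z ze zN; apply: (QP z); split => /=; last exact: NQ2.
  by apply: eQ1; rewrite /ball/= distrC.
exists (\big[Num.min/1]_ij (e ij).1).
  by apply/bigmin_gtP; split => // ij _; have [] := He ij.
exists (\prod_ij (e ij).2)%N; first by rewrite prodn_gt0// => ij; have [] := He ij.
move=> h he hN; apply: VU; apply: PV => i j.
have [_ _] := He (i, j); apply => /=.
  have := ler_l1 (SL_mx (SL_re h) - SL_mx (SL_re g)) i j; rewrite !mxE => /le_lt_trans; apply.
  by rewrite (lt_le_trans he)// (bigmin_le_cond _ (j := (i, j))).
have := hN i j; rewrite !mxE (bigD1 (i, j))//=.
exact: fcong_mulr.
Qed.

(** Neighbourhoods are described by right translation because it is the right action that descends
    to cosets. *)
Lemma nbhs_SL_adele_rel g (d : R) N (U : set (SL n (adele R))) : 0 < d -> (0 < N)%N ->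
  (forall r k, dist1 r < d -> Kcong N k -> U (g * SL_pair r k)%g) -> nbhs g U.
Proof.
move=> d0 N0 gU.
have [e e0 eP] := dist1_near (SL_re g) d0.
have [M M0 MP] := Kcong_rel (SL_fi g) N0.
have [c c0 cP] := l1_lt n n e0.
pose P (i j : 'I_n) : set (adele R) :=
  ball (SL_re g i j) c `*` [set y | fcong M (y - SL_fi g i j)].
pose V : set 'M[adele R]_n := [set A | forall i j, P i j (A i j)].
have nV : nbhs (SL_mx g) V.
  exists P => // i j; exists (ball (SL_re g i j) c, [set y | fcong M (y - SL_fi g i j)]) => //=.
  split; first by rewrite mxE; exact: nbhsx_ballx.
  by rewrite mxE; apply/fin_adele_nbhsP; exists M.
have /filterS : nbhs g (@SL_mx n (adele R) @^-1` V).
  exact: (@initial_continuous _ _ (@SL_mx n (adele R)) g).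
apply => h hV.
rewrite -[h](mulVKg g) -[(g^-1 * h)%g]SL_pairK; apply: gU.
  rewrite SL_reM /SL_re SL_mapV -/(SL_re _) -/(SL_re _); apply: eP; apply: cP => i j.
  by have [+ _] := hV i j; rewrite /ball/= distrC !mxE.
rewrite SL_fiM /SL_fi SL_mapV -/(SL_fi _) -/(SL_fi _); apply: MP => i j.
by have [_ +] := hV i j; rewrite /= !mxE.
Qed.

End adelic_group.

Section coset_space.
Variables (R : realType) (n : nat).
Local Notation X := (SLQ_quot n R).
Implicit Types (x y : X) (g h : SL n (adele R)) (r s : SL n R) (k l : SL n fin_adele).

Lemma SLQ_cosetK x : SLQ_coset (repr x) = x.
Proof. exact: reprK. Qed.

Lemma SLQ_rtransM g h x : SLQ_rtrans (g * h)%g x = SLQ_rtrans h (SLQ_rtrans g x).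
Proof. by rewrite -[x]SLQ_cosetK !SLQ_rtransE mulgA. Qed.

Lemma SLQ_rtrans1 x : SLQ_rtrans 1%g x = x.
Proof. by rewrite -[x]SLQ_cosetK !SLQ_rtransE mulg1. Qed.

(** A rational c approximates h_f g_f^-1 at the finite places. The remaining factor is conjugated by
    g_f, hence the level M, and the real component r absorbs c. *)
Lemma SLQ_transitive x y N : (0 < N)%N ->
  exists r k, Kcong N k /\ y = SLQ_rtrans (SL_pair r k) x.
Proof.
move=> N0; set g := repr x; set h := repr y.
have [M M0 MP] := Kcong_conj (SL_fi g) N0.
have [c cP] := strong_approximation (SL_fi h * (SL_fi g)^-1)%g M0.
set cf := SL_map fin_adele_of_rat c in cP.
pose cr : SL n R := SL_map ratr c.
exists ((SL_re g)^-1 * cr^-1 * SL_re h)%g, ((SL_fi g)^-1 * (cf^-1 * (SL_fi h * (SL_fi g)^-1)) * SL_fi g)%g.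
split; first exact: MP.
rewrite -[x]SLQ_cosetK -[y]SLQ_cosetK SLQ_rtransE; apply/esym/SLQ_cosetP.
exists c; rewrite SL_diagE -/cf -/cr -/g -/h -[h in LHS]SL_pairK -[g in RHS]SL_pairK !SL_pairM.
by congr SL_pair; rewrite SL_pairK -!mulgA !mulVKg // mulVg mulg1.
Qed.

Lemma SLQ_open_near (W : set X) x : open W -> W x ->
  exists2 d, 0 < d & exists2 N, (0 < N)%N & forall r k, dist1 r < d -> Kcong N k ->
    W (SLQ_rtrans (SL_pair r k) x).
Proof.
move=> oW Wx; set g := repr x.
have : nbhs g (@SLQ_coset n R @^-1` W).
  have oW' : open (@SLQ_coset n R @^-1` W) by [].
  by apply: open_nbhs_nbhs; split => //; rewrite /= SLQ_cosetK.
move=> /nbhs_SL_adele[d d0 [N N0 dNP]].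
have [M M0 MP] := mcong_rel (SL_fi g) N0.
exists (d / (l1 (SL_re g) + 1)); first by rewrite divr_gt0// ltr_pwDr// l1_ge0.
exists M => // r k rd kM.
rewrite -[x]SLQ_cosetK SLQ_rtransE; apply: dNP.
  rewrite SL_reM SL_re_pair.
  have -> : SL_mx (SL_re g * r)%g - SL_mx (SL_re g) = SL_re g *m (SL_mx r - 1%:M).
    by rewrite mulmxBr mulmx1.
  rewrite (le_lt_trans (l1M _ _))//.
  move: rd; rewrite ltr_pdivlMr; last by rewrite ltr_pwDr// l1_ge0.
  apply: le_lt_trans; rewrite mulrC ler_pM ?l1_ge0//; last by rewrite lerDl.
  by rewrite /dist1 lerDl l1_ge0.
by rewrite SL_fiM SL_fi_pair; exact: MP.
Qed.

Lemma SLQ_continuous_near (f : X -> R) x (e : R) : continuous f -> 0 < e ->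
  exists2 d, 0 < d & exists2 N, (0 < N)%N & forall r k, dist1 r < d -> Kcong N k ->
    `|f (SLQ_rtrans (SL_pair r k) x) - f x| < e.
Proof.
move=> /continuousP cf e0.
have /(_ x)[|d d0 [N N0 dN]] := SLQ_open_near (cf _ (ball_open (f x) e)).
  exact: ballxx.
by exists d => //; exists N => // r k rd kN; rewrite distrC; exact: dN.
Qed.

(** Together with [SLQ_open_near] this describes the quotient topology through small right
    translations of points instead of representatives. *)
Lemma SLQ_open (W : set X) :
  (forall x, W x -> exists2 d, 0 < d & exists2 N, (0 < N)%N & forall r k,
     dist1 r < d -> Kcong N k -> W (SLQ_rtrans (SL_pair r k) x)) -> open W.
Proof.
move=> HW; suff : open (@SLQ_coset n R @^-1` W) by [].
rewrite openE => g /= /HW[d d0 [N N0 dN]].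
apply: (nbhs_SL_adele_rel d0 N0) => r k rd kN.
by rewrite /= -SLQ_rtransE; exact: dN.
Qed.

Lemma SLQ_continuous (f : X -> R) :
  (forall x e, 0 < e -> exists2 d, 0 < d & exists2 N, (0 < N)%N & forall r k,
     dist1 r < d -> Kcong N k -> `|f (SLQ_rtrans (SL_pair r k) x) - f x| < e) ->
  continuous f.
Proof.
move=> Hf; apply/continuousP => A oA; apply: SLQ_open => x Ax.
have /nbhs_ballP[e /= e0 eA] : nbhs (f x) A by apply: open_nbhs_nbhs.
have [d d0 [N N0 dN]] := Hf x e e0.
exists d => //; exists N => // r k rd kN; apply: eA.
by rewrite /ball/= distrC; exact: dN.
Qed.

End coset_space.

(** * Test functions *)

Section test_functions.
Variables (R : realType) (n : nat).
Local Notation X := (SLQ_quot n R).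
Implicit Types (x y : X) (r s : SL n R) (k l : SL n fin_adele).

Definition real_act r x : X := SLQ_rtrans (SL_iota r) x.
Definition fin_act k x : X := SLQ_rtrans (SL_pair 1%g k) x.

Lemma real_actM r s x : real_act (r * s)%g x = real_act s (real_act r x).
Proof. by rewrite /real_act SL_iotaM SLQ_rtransM. Qed.

Lemma real_act1 x : real_act 1%g x = x.
Proof. by rewrite /real_act SL_iotaE SL_pair11 SLQ_rtrans1. Qed.

Lemma real_actK r x : real_act r^-1%g (real_act r x) = x.
Proof. by rewrite -real_actM mulgV real_act1. Qed.

Lemma fin_actM k l x : fin_act (k * l)%g x = fin_act l (fin_act k x).
Proof. by rewrite /fin_act -SLQ_rtransM SL_pairM mulg1. Qed.

Lemma real_fin_act r k x : real_act r (fin_act k x) = fin_act k (real_act r x).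
Proof. by rewrite /real_act /fin_act -!SLQ_rtransM SL_pair_comm. Qed.

Lemma pair_act r k x : SLQ_rtrans (SL_pair r k) x = fin_act k (real_act r x).
Proof. by rewrite SL_pairE SLQ_rtransM. Qed.

Lemma real_act_continuous r : continuous (real_act r : X -> X).
Proof.
apply/continuousP => W oW; apply: SLQ_open => x Wx.
have [d d0 [N N0 dN]] := SLQ_open_near oW Wx.
pose c := l1 (SL_mx r^-1%g) * l1 r + 1.
have c0 : 0 < c by rewrite ltr_pwDr// mulr_ge0// l1_ge0.
exists (d / c); first by rewrite divr_gt0.
exists N => // s k; rewrite ltr_pdivlMr// => sd kN.
rewrite /preimage/= pair_act real_fin_act -real_actM.
have -> : (s * r = r * (r^-1 * s * r))%g by rewrite !mulgA mulgV mul1g.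
rewrite real_actM -pair_act; apply: dN => //.
rewrite (le_lt_trans (dist1_conj _ _))// (le_lt_trans _ sd)// mulrC.
by rewrite ler_wpM2l ?dist1_ge0// lerDl.
Qed.

(** The constant L is the same at all points. The coset space is in general not compact, and the
    uniformity in x of the estimates below comes from here. *)
Definition test_fun (C L : R) (N : nat) (phi : X -> R) :=
  [/\ (0 < N)%N, 0 <= L, forall x, `|phi x| <= C,
      forall x k, Kcong N k -> phi (fin_act k x) = phi x &
      forall x r, `|phi (real_act r x) - phi x| <= L * dist1 r].

Lemma test_fun_continuous C L N phi : test_fun C L N phi -> continuous phi.
Proof.
move=> [N0 L0 _ phiK phiL]; apply: SLQ_continuous => x e e0.
exists (e / (L + 1)); first by rewrite divr_gt0// ltr_pwDr.
exists N => // r k + kN; rewrite pair_act phiK// ltr_pdivlMr; last by rewrite ltr_pwDr.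
by apply: le_lt_trans; rewrite (le_trans (phiL _ _))// mulrC ler_wpM2l ?dist1_ge0// lerDl.
Qed.

(** The logarithm makes it subadditive, since 1 + |rs - 1| <= (1 + |r - 1|) (1 + |s - 1|). This
    triangle inequality is what makes the inf-convolution [reg] Lipschitz. *)
Definition len r : R := ln (1 + l1 (SL_mx r - 1%:M)).

Lemma len_arg_ge1 r : 1 <= 1 + l1 (SL_mx r - 1%:M).
Proof. by rewrite lerDl l1_ge0. Qed.

Lemma len_ge0 r : 0 <= len r.
Proof. by rewrite ln_ge0// len_arg_ge1. Qed.

Lemma len1 : len 1%g = 0.
Proof. by rewrite /len subrr l10 addr0 ln1. Qed.

Lemma len_le_dist1 r : len r <= dist1 r.
Proof.
rewrite (@le_trans _ _ (l1 (SL_mx r - 1%:M)))//; last by rewrite lerDl l1_ge0.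
by rewrite le_ln1Dx// (lt_le_trans _ (l1_ge0 _))// ltrN10.
Qed.

Lemma lenM r s : len (r * s)%g <= len r + len s.
Proof.
rewrite /len -lnM ?posrE ?(lt_le_trans ltr01 (len_arg_ge1 _))//.
rewrite ler_ln ?posrE ?mulr_gt0 ?(lt_le_trans ltr01 (len_arg_ge1 _))//.
have -> : SL_mx (r * s)%g - 1%:M = (SL_mx r - 1%:M) *m (SL_mx s - 1%:M) +
    ((SL_mx r - 1%:M) + (SL_mx s - 1%:M)).
  rewrite mulmxBl mulmxBr !mulmx1 !mul1mx.
  rewrite -[SL_mx r *m s]/(SL_mx (r * s)%g); move: (SL_mx (r * s)%g) => P.
  by apply/matrixP => i j; rewrite !mxE; ring.
have := l1D ((SL_mx r - 1%:M) *m (SL_mx s - 1%:M)) ((SL_mx r - 1%:M) + (SL_mx s - 1%:M)).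
have := l1D (SL_mx r - 1%:M) (SL_mx s - 1%:M).
have := l1M (SL_mx r - 1%:M) (SL_mx s - 1%:M).
set a := l1 (SL_mx r - _); set b := l1 (SL_mx s - _).
rewrite (_ : (1 + a) * (1 + b) = 1 + a + b + a * b); [lra|ring].
Qed.

Lemma len_small (e : R) : 0 < e -> exists2 d, 0 < d & forall r, len r < d -> dist1 r < e.
Proof.
move=> e0; have [d d0 dP] := @dist1_small R n e e0.
exists (ln (1 + d)); first by rewrite ln_gt0// ltrDl.
move=> r; rewrite ltr_ln ?posrE ?(lt_le_trans ltr01 (len_arg_ge1 _)) ?addr_gt0//.
by rewrite ltrD2l; exact: dP.
Qed.

Section regularization.
Variables (f : X -> R) (C : R).
Hypothesis fC : forall x, `|f x| <= C.

(** The level m! is divisible by any given N > 0 once m >= N, so the admissible k shrink to the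
    identity as m grows. *)
Definition reg_set (m : nat) x : set R :=
  [set v | exists r k, Kcong m`! k /\ v = f (SLQ_rtrans (SL_pair r k) x) + m%:R * len r].

(* inf-convolution of f with m * len along SL_n(R), and with the indicator of
   the congruence subgroup of level m! at the finite places *)
Definition reg (m : nat) x : R := inf (reg_set m x).

Lemma reg_set_lb m x : lbound (reg_set m x) (- C).
Proof.
move=> _ [r [k [_ ->]]]; have := fC (SLQ_rtrans (SL_pair r k) x).
rewrite ler_norml => /andP[fC1 _]; rewrite (le_trans fC1)// lerDl.
by rewrite mulr_ge0// len_ge0.
Qed.

Lemma reg_le_elt m x v : reg_set m x v -> reg m x <= v.
Proof. by move=> xv; apply: ge_inf => //; exists (- C); exact: reg_set_lb. Qed.

Lemma reg_set_id m x : reg_set m x (f x).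
Proof.
exists 1%g, 1%g; split; first exact: Kcong1.
by rewrite SL_pair11 SLQ_rtrans1 len1 mulr0 addr0.
Qed.

Lemma reg_ge m x v : lbound (reg_set m x) v -> v <= reg m x.
Proof. by move=> xv; apply: lb_le_inf => //; exists (f x); exact: reg_set_id. Qed.

Lemma reg_le m x : reg m x <= f x.
Proof. exact/reg_le_elt/reg_set_id. Qed.

Lemma reg_bound m x : `|reg m x| <= C.
Proof.
rewrite ler_norml reg_ge/=; last exact: reg_set_lb.
by rewrite (le_trans (reg_le _ _))// (le_trans (ler_norm _)).
Qed.

Lemma reg_fin_act m x k : Kcong m`! k -> reg m (fin_act k x) = reg m x.
Proof.
move=> kN; apply/eqP; rewrite eq_le; apply/andP; split; apply: reg_ge => _ [r [l [lN ->]]].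
  apply: reg_le_elt; exists r, (k^-1 * l)%g; split.
    by apply: KcongM => //; exact: KcongV.
  by rewrite !pair_act real_fin_act -fin_actM mulVKg.
apply: reg_le_elt; exists r, (k * l)%g; split; first exact: KcongM.
by rewrite !pair_act real_fin_act -fin_actM.
Qed.

Lemma reg_real_act m x s : reg m x - m%:R * len s <= reg m (real_act s x).
Proof.
apply: reg_ge => _ [r [l [lN ->]]]; rewrite lerBlDr.
apply: (@le_trans _ _ (f (SLQ_rtrans (SL_pair (s * r)%g l) x) + m%:R * len (s * r)%g)).
  by apply: reg_le_elt; exists (s * r)%g, l.
rewrite !pair_act real_actM -addrA lerD2l -mulrDr ler_wpM2l//.
by rewrite addrC lenM.
Qed.

Lemma reg_test_fun m : test_fun C m%:R m`! (reg m).
Proof.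
split => [|||x k|x r]; [exact: fact_gt0|by []|exact: reg_bound|exact: reg_fin_act|].
rewrite ler_distl; apply/andP; split.
  apply: le_trans (reg_real_act m x r).
  by rewrite lerD2l lerN2 ler_wpM2l// len_le_dist1.
have := reg_real_act m (real_act r x) r^-1%g; rewrite real_actK lerBlDr => /le_trans; apply.
by rewrite lerD2l ler_wpM2l// -dist1V len_le_dist1.
Qed.

(** Either r is so small that continuity of f at x applies, or the penalty m * len r is at least 2C,
    the largest possible oscillation of f. *)
Lemma reg_cvg x (e : R) : continuous f -> 0 < e ->
  exists m0, forall m, (m0 <= m)%N -> f x - e <= reg m x.
Proof.
move=> cf e0; have [d d0 [N N0 dN]] := SLQ_continuous_near x cf e0.
have [c c0 cP] := len_small d0.
have C0 : 0 <= C by rewrite (le_trans _ (fC x)).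
pose m1 := Num.bound (2 * C / c).
exists (maxn N m1) => m; rewrite geq_max => /andP[Nm m1m].
apply: reg_ge => _ [r [k [kN ->]]].
have [rc|cr] := ltP (len r) c.
  have kN' : Kcong N k.
    have /dvdnP[q qE] : (N %| m`!)%N by rewrite dvdn_fact// N0.
    by apply: (@Kcong_mull _ N q); rewrite -qE.
  have := dN r k (cP _ rc) kN'; rewrite ltr_distl => /andP[/ltW fe _].
  by rewrite (le_trans fe)// lerDl mulr_ge0// len_ge0.
have mC : 2 * C <= m%:R * len r.
  apply: (@le_trans _ _ (m%:R * c)); last by rewrite ler_wpM2l.
  rewrite -ler_pdivrMr// (le_trans _ (_ : m1%:R <= _))// ?ler_nat//.
  by rewrite ltW// archi_boundP// divr_ge0 ?mulr_ge0// ltW.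
have := fC x; have := fC (SLQ_rtrans (SL_pair r k) x).
rewrite !ler_norml => /andP[h1 _] /andP[_ h2]; lra.
Qed.

End regularization.

End test_functions.

(** * Bounded measurable functions *)

Section bounded_measurable.
Context d (T : measurableType d) (R : realType).
Implicit Types phi psi : T -> R.

(** Almost all integrands are of this kind, integrated against finite measures, which makes
    integrability automatic; the main exception is the density in [transfer_ac]. *)
Definition bmf phi := measurable_fun setT phi /\ exists C, forall x, `|phi x| <= C.

Lemma bmf_cst c : bmf (fun=> c).
Proof. by split; [exact: measurable_cst|exists `|c|]. Qed.

Lemma bmfD phi psi : bmf phi -> bmf psi -> bmf (fun x => phi x + psi x).
Proof.
move=> [mp [C pC]] [mq [D qD]]; split; first exact: measurable_funD.
by exists (C + D) => x; rewrite (le_trans (ler_normD _ _))// lerD.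
Qed.

Lemma bmfN phi : bmf phi -> bmf (fun x => - phi x).
Proof.
move=> [mp [C pC]]; split; first exact: measurableT_comp.
by exists C => x; rewrite normrN.
Qed.

Lemma bmfB phi psi : bmf phi -> bmf psi -> bmf (fun x => phi x - psi x).
Proof. by move=> p q; apply: bmfD => //; exact: bmfN. Qed.

Lemma bmfM phi psi : bmf phi -> bmf psi -> bmf (fun x => phi x * psi x).
Proof.
move=> [mp [C pC]] [mq [D qD]]; split; first exact: measurable_funM.
by exists (C * D) => x; rewrite normrM ler_pM.
Qed.

Lemma bmfZ c phi : bmf phi -> bmf (fun x => c * phi x).
Proof. by apply: bmfM; exact: bmf_cst. Qed.

Lemma bmf_norm phi : bmf phi -> bmf (fun x => `|phi x|).
Proof.
move=> [mp [C pC]]; split; first exact: measurableT_comp.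
by exists C => x; rewrite normr_id.
Qed.

Lemma bmf_sum (I : Type) (r : seq I) (F : I -> T -> R) :
  (forall i, bmf (F i)) -> bmf (fun x => \sum_(i <- r) F i x).
Proof.
move=> HF; elim: r => [|i r IH].
  by under [X in bmf X]eq_fun do rewrite big_nil; exact: bmf_cst.
by under [X in bmf X]eq_fun do rewrite big_cons; exact: bmfD.
Qed.

Lemma bmf_comp d' (T' : measurableType d') phi (g : T' -> T) :
  bmf phi -> measurable_fun setT g ->
  measurable_fun setT (phi \o g) /\ exists C, forall x, `|phi (g x)| <= C.
Proof.
move=> [mp [C pC]] mg; split; first exact: measurableT_comp.
by exists C => x; exact: pC.
Qed.

Variable nu : {finite_measure set T -> \bar R}.
Local Notation E f := (\int[nu]_x f x).

Lemma bmf_integrable phi : bmf phi -> nu.-integrable setT (EFin \o phi).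
Proof.
move=> [mp [C pC]]; apply: measurable_bounded_integrable => //.
  by rewrite ltey_eq fin_num_measure.
exists C; split; first exact: num_real.
by move=> M CM x _ /=; rewrite (le_trans (pC x))// ltW.
Qed.

Lemma bmf_EFin phi : bmf phi -> (\int[nu]_x (phi x)%:E)%E = (E phi)%:E.
Proof.
by move=> bp; rewrite fineK//; apply: integrable_fin_num => //; exact: bmf_integrable.
Qed.

Lemma bmf_intD phi psi : bmf phi -> bmf psi ->
  E (fun x => phi x + psi x) = E phi + E psi.
Proof. by move=> bp bq; rewrite RintegralD//; exact: bmf_integrable. Qed.

Lemma bmf_intB phi psi : bmf phi -> bmf psi ->
  E (fun x => phi x - psi x) = E phi - E psi.
Proof. by move=> bp bq; rewrite RintegralB//; exact: bmf_integrable. Qed.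

Lemma bmf_intZ c phi : bmf phi -> E (fun x => c * phi x) = c * E phi.
Proof. by move=> bp; rewrite RintegralZl//; exact: bmf_integrable. Qed.

Lemma bmf_int_cst c : E (fun=> c) = c * fine (nu setT).
Proof. by rewrite Rintegral_cst. Qed.

Lemma bmf_int_sum (I : Type) (r : seq I) (F : I -> T -> R) :
  (forall i, bmf (F i)) -> E (fun x => \sum_(i <- r) F i x) = \sum_(i <- r) E (F i).
Proof.
move=> HF; elim: r => [|i r IH].
  rewrite big_nil -[RHS](mul0r (fine (nu setT))) -bmf_int_cst.
  by apply: eq_Rintegral => x _; rewrite big_nil.
rewrite big_cons -IH -bmf_intD//; last exact: bmf_sum.
by apply: eq_Rintegral => x _; rewrite big_cons.
Qed.

Lemma bmf_int_le phi psi : bmf phi -> bmf psi -> (forall x, phi x <= psi x) ->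
  E phi <= E psi.
Proof. by move=> bp bq pq; apply: le_Rintegral => //; exact: bmf_integrable. Qed.

Lemma bmf_int_norm phi : bmf phi -> `|E phi| <= E (fun x => `|phi x|).
Proof. by move=> bp; apply: le_normr_Rintegral => //; exact: bmf_integrable. Qed.

Lemma bmf_int_bound phi C : bmf phi -> (forall x, `|phi x| <= C) ->
  `|E phi| <= C * fine (nu setT).
Proof.
move=> bp pC; rewrite (le_trans (bmf_int_norm bp))// -bmf_int_cst.
by apply: bmf_int_le => //; [exact: bmf_norm|exact: bmf_cst].
Qed.

Lemma bounded_convergence (phi_ : nat -> T -> R) phi C :
  (forall j, measurable_fun setT (phi_ j)) -> (forall j x, `|phi_ j x| <= C) ->
  (forall x, phi_ ^~ x @ \oo --> phi x) ->
  bmf phi /\ E (phi_ j) @[j --> \oo] --> E phi.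
Proof.
move=> mp pC pcvg.
have mphi : measurable_fun setT phi.
  by apply: (measurable_fun_cvg mp) => x _; exact: pcvg.
have bphi : bmf phi.
  split => //; exists C => x.
  apply: (cvgr_to_le (cvg_norm (pcvg x))).
  by apply: nearW => j; exact: pC.
split => //; apply: fine_cvg; rewrite -bmf_EFin//.
have [//|//||||_ _] := @dominated_convergence _ T R nu setT measurableT
  (fun j x => (phi_ j x)%:E) (fun x => (phi x)%:E) (cst C%:E).
- by move=> j; exact/measurable_EFinP.
- exact/measurable_EFinP.
- apply: aeW => x _; apply: cvg_EFin; first exact: nearW.
  exact: pcvg.
- by apply/bmf_integrable/bmf_cst.
- by apply: aeW => x j _; rewrite /= lee_fin.
by [].
Qed.

(** The arithmetic-geometric inequality |phi| <= e + phi^2 / e, integrated. It converts L^2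
    estimates into L^1 ones. *)
Lemma bmf_int_L1 phi e : 0 < e -> bmf phi ->
  E (fun x => `|phi x|) <= e * fine (nu setT) + e^-1 * E (fun x => phi x * phi x).
Proof.
move=> e0 bp; rewrite -bmf_int_cst -bmf_intZ; last exact: bmfM.
rewrite -bmf_intD; [|exact: bmf_cst|by apply: bmfZ; exact: bmfM].
apply: bmf_int_le; [exact: bmf_norm|by apply: bmfD; [exact: bmf_cst|apply: bmfZ; exact: bmfM]|].
move=> x; rewrite -(ler_pM2l e0) mulrDr [e * (_^-1 * _)]mulrA mulfV ?gt_eqF// mul1r.
rewrite -[phi x * phi x]expr2 -real_normK ?num_real//.
set a := `|phi x|; have : 0 <= a := normr_ge0 _.
have := sqr_ge0 (a - e); rewrite sqrrB expr2; nra.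
Qed.

Lemma bmf_int_invariant (g : T -> T) phi : measurable_fun setT g ->
  (forall A, measurable A -> nu (g @^-1` A) = nu A) -> bmf phi ->
  E (fun x => phi (g x)) = E phi.
Proof.
move=> mg ginv [mp [C pC]]; congr fine.
have ip : nu.-integrable setT (EFin \o phi) by apply: bmf_integrable; split => //; exists C.
rewrite -(@integral_pushforward _ _ _ _ _ g mg nu setT (EFin \o phi))//=.
- by apply: eq_measure_integral => A mA _; exact: ginv.
- exact/measurable_EFinP.
- apply: (@bmf_integrable (phi \o g)); split; first exact: measurableT_comp.
  by exists C => x; exact: pC.
Qed.

End bounded_measurable.

Section bounded_fubini.
Context d1 d2 (T1 : measurableType d1) (T2 : measurableType d2) (R : realType).
Variables (m1 : {finite_measure set T1 -> \bar R}) (m2 : {finite_measure set T2 -> \bar R}).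
Variable h : T1 * T2 -> R.
Hypothesis bh : bmf h.

Lemma bmf_section1 x : bmf (fun y => h (x, y)).
Proof.
have [mh [C hC]] := bh; split; last by exists C.
exact: measurableT_comp.
Qed.

Lemma bmf_section2 y : bmf (fun x => h (x, y)).
Proof.
have [mh [C hC]] := bh; split; last by exists C.
exact: measurableT_comp.
Qed.

Let ih : (m1 \x m2)%E.-integrable setT (EFin \o h).
Proof.
have [mh [C hC]] := bh; apply: measurable_bounded_integrable => //.
  have := @product_measure1E _ _ _ _ _ m1 m2 setT setT measurableT measurableT.
  rewrite setXTT => H; apply: (@le_lt_trans _ _ (m1 setT * m2 setT)%E); first by rewrite -H.
  by rewrite ltey_eq fin_numM// fin_num_measure.
exists C; split; first exact: num_real.
by move=> M CM x _ /=; rewrite (le_trans (hC x))// ltW.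
Qed.

Lemma bmf_fubini1 : bmf (fun x => \int[m2]_y h (x, y)).
Proof.
have [mh [C hC]] := bh; split; last first.
  exists (C * fine (m2 setT)) => x.
  by apply: bmf_int_bound => //; exact: bmf_section1.
apply/measurable_EFinP; rewrite (_ : EFin \o _ = fubini_F m2 (EFin \o h)).
  exact: measurable_fubini_F ih.
by apply/funext => x; rewrite /fubini_F /= bmf_EFin//; exact: bmf_section1.
Qed.

Lemma bmf_fubini2 : bmf (fun y => \int[m1]_x h (x, y)).
Proof.
have [mh [C hC]] := bh; split; last first.
  exists (C * fine (m1 setT)) => x.
  by apply: bmf_int_bound => //; exact: bmf_section2.
apply/measurable_EFinP; rewrite (_ : EFin \o _ = fubini_G m1 (EFin \o h)).
  exact: measurable_fubini_G ih.
by apply/funext => x; rewrite /fubini_G /= bmf_EFin//; exact: bmf_section2.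
Qed.

Lemma bmf_fubini :
  \int[m1]_x (\int[m2]_y h (x, y)) = \int[m2]_y (\int[m1]_x h (x, y)).
Proof.
apply: EFin_inj; rewrite -!bmf_EFin; [|exact: bmf_fubini2|exact: bmf_fubini1].
transitivity (\int[m1]_x (\int[m2]_y (h (x, y))%:E))%E.
  by apply: eq_integral => x _; rewrite bmf_EFin//; exact: bmf_section1.
rewrite (Fubini ih); apply: eq_integral => y _.
by rewrite -bmf_EFin//; exact: bmf_section2.
Qed.

End bounded_fubini.

Lemma borel_continuous_measurable (T : ptopologicalType) (R : realType) (f : T -> R) :
  continuous f -> measurable_fun (setT : set (borel T)) (f : borel T -> R).
Proof.
move=> /continuousP cf; apply: (measurability _ (RGenOpens.measurableE R)).
move=> _ [_ [a [b ->]] <-]; rewrite setTI; apply: sub_sigma_algebra.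
exact/cf/interval_open.
Qed.

Lemma borel_open_measurable (T : ptopologicalType) (U : set T) :
  open U -> measurable (U : set (borel T)).
Proof. exact: sub_sigma_algebra. Qed.

Lemma borel_continuous_map (T U : ptopologicalType) (f : T -> U) :
  continuous f -> measurable_fun (setT : set (borel T)) (f : borel T -> borel U).
Proof.
move=> /continuousP cf.
apply: (@measurability _ _ (borel T) (borel U) _ _ open) => //.
by move=> _ [W oW <-]; rewrite setTI; apply: sub_sigma_algebra; exact: cf.
Qed.

(** * The mean ergodic theorem and the Mautner phenomenon *)

Section mean_ergodic.
Context d (T : measurableType d) (R : realType).
Variable nu : {finite_measure set T -> \bar R}.
Local Notation E f := (\int[nu]_x f x).

Definition qform (phi : T -> R) : R := E (fun x => phi x * phi x).

Lemma qform_ge0 phi : 0 <= qform phi.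
Proof. by apply: Rintegral_ge0 => x _; rewrite -expr2 sqr_ge0. Qed.

Lemma qform_parallelogram phi psi : bmf phi -> bmf psi ->
  qform (fun x => phi x - psi x) + 4 * qform (fun x => 2^-1 * (phi x + psi x)) =
  2 * qform phi + 2 * qform psi.
Proof.
move=> bp bq.
have bpp := bmfM bp bp; have bqq := bmfM bq bq; have bpq := bmfM bp bq.
have bD : bmf (fun x => (phi x - psi x) * (phi x - psi x)) by apply: bmfM; exact: bmfB.
have bS : bmf (fun x => 2^-1 * (phi x + psi x) * (2^-1 * (phi x + psi x))).
  by apply: bmfM; apply: bmfZ; exact: bmfD.
rewrite /qform -!bmf_intZ// -!bmf_intD//; [|exact: bmfZ..].
by apply: eq_Rintegral => x _; field.
Qed.

Lemma qformD phi psi : bmf phi -> bmf psi ->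
  qform (fun x => phi x + psi x) <= 2 * qform phi + 2 * qform psi.
Proof.
move=> bp bq; rewrite /qform -!bmf_intZ; [|exact: bmfM..].
rewrite -bmf_intD; [|by apply: bmfZ; exact: bmfM..].
apply: bmf_int_le; [by apply: bmfM; exact: bmfD|by apply: bmfD; apply: bmfZ; exact: bmfM|].
by move=> x; have := sqr_ge0 (phi x - psi x); rewrite expr2; nra.
Qed.

Lemma qformN phi : qform (fun x => - phi x) = qform phi.
Proof. by apply: eq_Rintegral => x _; rewrite mulrNN. Qed.

Lemma qform_small phi e : bmf phi -> (forall x, `|phi x| <= e) ->
  qform phi <= e * e * fine (nu setT).
Proof.
move=> bp pe; rewrite -[leLHS]ger0_norm; last exact: qform_ge0.
by apply: bmf_int_bound => [|x]; [exact: bmfM|rewrite normrM ler_pM].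
Qed.

Lemma qform_close phi psi C e : bmf phi -> bmf psi ->
  (forall x, `|phi x| <= C) -> (forall x, `|psi x| <= C) ->
  (forall x, `|phi x - psi x| <= e) ->
  qform phi <= qform psi + 2 * C * e * fine (nu setT).
Proof.
move=> bp bq pC qC pq; rewrite /qform -lerBlDl -bmf_intB; [|exact: bmfM..].
rewrite (le_trans (ler_norm _))//; apply: bmf_int_bound.
  by apply: bmfB; exact: bmfM.
move=> x; rewrite (_ : _ - _ = (phi x + psi x) * (phi x - psi x)); last by ring.
rewrite normrM ler_pM// (le_trans (ler_normD _ _))//.
by have := pC x; have := qC x; lra.
Qed.

Lemma sum_sqr_le (I : Type) (s : seq I) (a : I -> R) :
  (\sum_(i <- s) a i) ^+ 2 <= (size s)%:R * \sum_(i <- s) a i ^+ 2.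
Proof.
elim: s => [|i s IH]; first by rewrite !big_nil expr0n mulr0.
rewrite !big_cons /=; set S := \sum_(j <- s) a j in IH *.
set Q := \sum_(j <- s) a j ^+ 2 in IH *.
have Q0 : 0 <= Q by apply: sumr_ge0 => j _; exact: sqr_ge0.
rewrite -[(size s).+1%:R]natr1; have : 0 <= (size s)%:R :> R by [].
set m := (size s)%:R in IH *; move=> m0.
have key : 2 * (a i * S) <= m * a i ^+ 2 + Q.
  have [m00|] := eqVneq m 0.
    move: IH; rewrite m00 mul0r => S2.
    have : S ^+ 2 = 0 by apply/eqP; rewrite eq_le S2 sqr_ge0.
    by move/eqP; rewrite sqrf_eq0 => /eqP ->; rewrite mulr0 mulr0 mul0r add0r.
  move=> mn0; have mp : 0 < m by rewrite lt_neqAle eq_sym mn0.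
  rewrite -(ler_pM2l mp); have := sqr_ge0 (m * a i - S).
  rewrite sqrrB; nra.
by rewrite sqrrD; nra.
Qed.

(** Convexity of the square, through [sum_sqr_le]. *)
Lemma qform_avg (I : Type) (s : seq I) (F : I -> T -> R) c : (0 < size s)%N ->
  (forall i, bmf (F i)) -> (forall i, qform (F i) = c) ->
  qform (fun x => (size s)%:R^-1 * \sum_(i <- s) F i x) <= c.
Proof.
move=> s0 bF Fc; have s0' : 0 < (size s)%:R :> R by rewrite ltr0n.
apply: (@le_trans _ _ (E (fun x => (size s)%:R^-1 * \sum_(i <- s) F i x * F i x))).
  apply: bmf_int_le.
  - by apply: bmfM; apply: bmfZ; exact: bmf_sum.
  - by apply: bmfZ; apply: bmf_sum => i; exact: bmfM.
  move=> x; rewrite mulrACA -!expr2 -mulrA ler_pM2l ?invr_gt0//.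
  rewrite ler_pdivrMl// (le_trans (sum_sqr_le _ _))//.
rewrite bmf_intZ; last by apply: bmf_sum => i; exact: bmfM.
rewrite bmf_int_sum; last by move=> i; exact: bmfM.
rewrite (eq_bigr (fun=> c)); last by move=> i _; exact: Fc.
rewrite big_const_seq count_predT iter_addr_0 -[c *+ _]mulr_natl mulrA mulVf ?mul1r//.
by rewrite gt_eqF.
Qed.

Variable g : nat -> T -> T.
Hypothesis gD : forall i j x, g j (g i x) = g (i + j)%N x.
Hypothesis mg : forall i, measurable_fun setT (g i).
Hypothesis ginv : forall i A, measurable A -> nu (g i @^-1` A) = nu A.

Definition orbit_avg (s : seq nat) (phi : T -> R) (x : T) : R :=
  (size s)%:R^-1 * \sum_(i <- s) phi (g i x).

Definition cesaro (N : nat) := orbit_avg (iota 0 N).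

Lemma bmf_g i (phi : T -> R) : bmf phi -> bmf (fun x => phi (g i x)).
Proof. by move=> bp; apply: (bmf_comp bp (mg i)). Qed.

Lemma bmf_orbit_avg s phi : bmf phi -> bmf (orbit_avg s phi).
Proof. by move=> bp; apply: bmfZ; apply: bmf_sum => i; exact: bmf_g. Qed.

Lemma qform_g i phi : bmf phi -> qform (fun x => phi (g i x)) = qform phi.
Proof.
move=> bp; apply: (bmf_int_invariant (phi := fun x => phi x * phi x) (mg i) (@ginv i)).
exact: bmfM.
Qed.

Lemma orbit_avg_bound s phi C x : (0 < size s)%N -> (forall x, `|phi x| <= C) ->
  `|orbit_avg s phi x| <= C.
Proof.
move=> s0 pC; rewrite normrM ger0_norm ?invr_ge0// ler_pdivrMl ?ltr0n//.
rewrite (le_trans (ler_norm_sum _ _ _))// (le_trans (ler_sum _ (fun i _ => pC (g i x))))//.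
by rewrite big_const_seq count_predT iter_addr_0 mulr_natl.
Qed.

Lemma sum_shift (a : nat -> R) C j N : (forall i, `|a i| <= C) ->
  `|\sum_(i <- iota 0 N) a (i + j)%N - \sum_(i <- iota 0 N) a i| <= 2 * C * j%:R.
Proof.
move=> aC; elim: j => [|j IH].
  by under eq_bigr do rewrite addn0; rewrite subrr normr0 mulr0.
have -> : \sum_(i <- iota 0 N) a (i + j.+1)%N = \sum_(i <- iota 0 N) a (i + j)%N + (a (N + j)%N - a j).
  elim: N {IH} => [|N IH]; first by rewrite !big_nil add0n subrr addr0.
  rewrite -[N.+1]addn1 iotaD !big_cat/= !big_seq1 IH add0n addnS addn1 addSn.
  by ring.
rewrite addrAC (le_trans (ler_normD _ _))// -[j.+1%:R]natr1 mulrDr mulr1 lerD//.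
rewrite (le_trans (ler_normB _ _))//.
by have := aC (N + j)%N; have := aC j; lra.
Qed.

Lemma cesaro_orbit_avg s phi C N x : (0 < size s)%N -> (0 < N)%N ->
  (forall x, `|phi x| <= C) ->
  `|cesaro N (orbit_avg s phi) x - cesaro N phi x| <= 2 * C * (\sum_(j <- s) j)%:R / N%:R.
Proof.
move=> s0 N0 pC; have sp : 0 < (size s)%:R :> R by rewrite ltr0n.
have C0 : 0 <= C := le_trans (normr_ge0 _) (pC x).
rewrite /cesaro /orbit_avg size_iota -mulrBr normrM ger0_norm ?invr_ge0//.
rewrite mulrC ler_wpM2r ?invr_ge0//.
have -> : \sum_(i <- iota 0 N) (size s)%:R^-1 * \sum_(j <- s) phi (g j (g i x)) - \sum_(i <- iota 0 N) phi (g i x)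
   = (size s)%:R^-1 * \sum_(j <- s) (\sum_(i <- iota 0 N) phi (g (i + j)%N x) - \sum_(i <- iota 0 N) phi (g i x)).
  rewrite -mulr_sumr exchange_big/= sumrB mulrBr; congr (_ * _ - _).
    by apply: eq_bigr => j _; apply: eq_bigr => i _; rewrite gD.
  rewrite big_const_seq count_predT iter_addr_0 -[X in _ = _ * X]mulr_natl mulrA mulVf ?mul1r//.
  by rewrite gt_eqF.
rewrite normrM ger0_norm ?invr_ge0// ler_pdivrMl//.
rewrite (le_trans (ler_norm_sum _ _ _))//.
apply: (@le_trans _ _ (\sum_(j <- s) 2 * C * j%:R)).
  by apply: ler_sum => j _; apply: (@sum_shift (fun i => phi (g i x))).
by rewrite -mulr_sumr -natr_sum ler_peMl// ?mulr_ge0// ler1n.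
Qed.

(** Let c be the infimum of the squared norms of all orbit averages. Averaging a near-minimiser
    further does not increase its norm, and the result differs from w = [cesaro N phi] by O(1/N); so
    for large N the squared norm of w is at most c + e/4. The midpoint of w and a translate is again
    an orbit average, hence of squared norm at least c, and the parallelogram identity bounds the
    squared norm of the difference by 4 (c + e/4) - 4 c = e. The threshold N0 is chosen before m. *)
Lemma cesaro_almost_invariant phi e : bmf phi -> 0 < e ->
  exists N0, forall N, (N0 <= N)%N -> (0 < N)%N -> forall m,
    qform (fun x => cesaro N phi (g m x) - cesaro N phi x) <= e.
Proof.
move=> bp e0; have [mp [C pC]] := bp.
pose S := [set qform (orbit_avg s phi) | s in [set s | (0 < size s)%N]].
have S0 : S !=set0 by exists (qform (orbit_avg [:: 0%N] phi)); exists [:: 0%N].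
have Slb : has_lbound S by exists 0 => _ [s _ <-]; exact: qform_ge0.
have e8 : 0 < e / 8 by rewrite divr_gt0.
have [_ [s /= s0 <-] sP] := inf_adherent e8 (conj S0 Slb).
set c := inf S in sP.
have cle s' : (0 < size s')%N -> c <= qform (orbit_avg s' phi).
  by move=> s'0; apply: ge_inf => //; exists s'.
pose K := 2 * C * (2 * C * (\sum_(j <- s) j)%:R) * fine (nu setT).
exists (Num.bound (K / (e / 8))) => N NK N0 m.
set w := cesaro N phi.
have bw : bmf w by exact: bmf_orbit_avg.
have wc : qform w <= c + e / 4.
  have h0 : qform w <= qform (cesaro N (orbit_avg s phi)) +
      2 * C * (2 * C * (\sum_(j <- s) j)%:R / N%:R) * fine (nu setT).
    apply: qform_close => //; first exact/bmf_orbit_avg/bmf_orbit_avg.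
    - by move=> x; apply: orbit_avg_bound; rewrite ?size_iota.
    - move=> x; apply: orbit_avg_bound; rewrite ?size_iota// => y.
      exact: orbit_avg_bound.
    - by move=> x; rewrite distrC; exact: cesaro_orbit_avg.
  have h1 : qform (cesaro N (orbit_avg s phi)) <= qform (orbit_avg s phi).
    apply: (@qform_avg _ (iota 0 N) (fun i x => orbit_avg s phi (g i x))).
    - by rewrite size_iota.
    - by move=> i; exact/bmf_g/bmf_orbit_avg.
    - by move=> i; exact/qform_g/bmf_orbit_avg.
  have h2 : 2 * C * (2 * C * (\sum_(j <- s) j)%:R / N%:R) * fine (nu setT) <= e / 8.
    rewrite !mulrA -[2 * C * 2 * C * _ / _ * _]mulrAC.
    have -> : 2 * C * 2 * C * (\sum_(j <- s) j)%:R * fine (nu setT) = K by rewrite /K !mulrA.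
    rewrite ler_pdivrMr ?ltr0n// mulrC -ler_pdivrMr//.
    have [K0|K0] := leP 0 (K / (e / 8)); last first.
      by rewrite (le_trans (ltW K0)).
    by rewrite ltW// (lt_le_trans (archi_boundP K0))// ler_nat.
  lra.
have wmE : (fun x => w (g m x)) = orbit_avg [seq (m + i)%N | i <- iota 0 N] phi.
  apply/funext => x; rewrite /w /cesaro /orbit_avg size_map big_map.
  by congr (_ * _); apply: eq_bigr => i _; rewrite gD.
have bwm : bmf (fun x => w (g m x)) by exact: bmf_g.
have h := qform_parallelogram bwm bw.
(* The midpoint is the orbit average over the concatenation of the two lists of times. *)
have cm : c <= qform (fun x => 2^-1 * (w (g m x) + w x)).
  have -> : (fun x => 2^-1 * (w (g m x) + w x)) =
      orbit_avg ([seq (m + i)%N | i <- iota 0 N] ++ iota 0 N) phi.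
    apply/funext => x; have -> : w (g m x) = orbit_avg [seq (m + i)%N | i <- iota 0 N] phi x.
      by have := congr1 (fun f => f x) wmE.
    rewrite /w /cesaro /orbit_avg size_cat size_map size_iota big_cat/= -mulrDr mulrA.
    by congr (_ * _); rewrite addnn -muln2 natrM invfM mulrC.
  by apply: cle; rewrite size_cat size_iota addn_gt0 N0 orbT.
have := qform_g m bw => hm; lra.
Qed.

End mean_ergodic.

Section diagonal.
Variables (R : realType) (n : nat) (a b : 'I_n).
Hypothesis ab : a != b.

Definition diag2_row (c : R) : 'rV[R]_n :=
  \row_i (if i == a then c else if i == b then c^-1 else 1).

Lemma det_diag2 c : c != 0 -> \det (diag_mx (diag2_row c)) == 1.
Proof.
move=> c0; rewrite det_diag (bigD1 a)//= (bigD1 b) ?(eq_sym b)//= !mxE.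
rewrite !eqxx [b == a]eq_sym (negbTE ab) mulrA mulfV// mul1r big1// => i /andP[ia ib].
by rewrite mxE (negbTE ia) (negbTE ib).
Qed.

Definition diag2 c (c0 : c != 0) : SL n R := MkSL (det_diag2 c0).

Lemma elem_diag_mx (D : 'rV[R]_n) i j s : D 0 i != 0 ->
  elem_mx i j s *m diag_mx D = diag_mx D *m elem_mx i j (s * (D 0 j / D 0 i)).
Proof.
move=> d0; apply/matrixP => k l; rewrite mul_mx_diag mul_diag_mx.
rewrite mxE [in RHS]mxE !elem_mxE.
have [<-|kl] := eqVneq k l.
  have [->|ki] := eqVneq k i; last by rewrite !mulr0 !addr0 mulrC.
  have [->|ij] := eqVneq i j; first by rewrite !mulr0n !mul0r mulrC.
  by rewrite !mulr0 !addr0 mulrC.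
rewrite !add0r; have [->|ki] := eqVneq k i; last by rewrite !mulr0 mul0r.
have [->|lj] := eqVneq l j; last by rewrite !mulr0 mul0r.
rewrite !mulr1; case: (i != j); last by rewrite !mulr0n mul0r mulr0.
by rewrite !mulr1n; field.
Qed.

(** Writes a diagonal matrix with four unipotents, of which those at (b, a), with entries e and -c
    e, become arbitrarily small as m grows with m e = c - 1 fixed. This is the Mautner mechanism:
    near invariance under the large unipotents at (a, b) passes to the diagonal. *)
Lemma diag2_mautner (c m e : R) (c0 : c != 0) : m != 0 -> m * e = c - 1 ->
  diag2 c0 = (elem a b m * elem b a e * (elem a b (- (m / c)) * elem b a (- (c * e))))%g.
Proof.
move=> m0 me.
have h : (elem a b m * elem b a e = diag2 c0 * (elem b a (c * e) * elem a b (m / c)))%g.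
  have nba : b != a by rewrite eq_sym.
  apply: val_inj => /=; rewrite mul_diag_mx /elem_mx ab nba !mulr1n.
  rewrite !(mulmxDl, mulmxDr, mul1mx, mulmx1) -!(scalemxAr, scalemxAl) !mul_delta_mx.
  apply/matrixP => i j; rewrite !mxE.
  have eE : e = (c - 1) / m by rewrite -me mulrAC mulfV// mul1r.
  have abF := negbTE ab; have baF := negbTE nba.
  have [->|/negbTE ia] := eqVneq i a; last first.
    have [->|/negbTE ib] := eqVneq i b; rewrite ?eqxx ?baF ?abF /=; last first.
      by rewrite ?ia ?ib /=; ring.
    have [jE|/negbTE ja] := eqVneq j a; [subst j|]; rewrite ?eqxx ?baF ?abF /=.
      by rewrite eE; field; rewrite m0 c0.
    have [jE|/negbTE jb] := eqVneq j b; [subst j|]; rewrite ?eqxx ?baF ?abF /=.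
      by rewrite eE; field; rewrite m0 c0.
    by rewrite ?ja ?jb /=; ring.
  rewrite ?eqxx ?baF ?abF /=.
  have [jE|/negbTE ja] := eqVneq j a; [subst j|]; rewrite ?eqxx ?baF ?abF /=.
    by rewrite eE; field; rewrite m0 c0.
  have [jE|/negbTE jb] := eqVneq j b; [subst j|]; rewrite ?eqxx ?baF ?abF /=.
    by field.
  by rewrite ?ja ?jb /=; ring.
rewrite h -mulgA [X in (diag2 c0 * X)%g](_ : _ = 1%g) ?mulg1// -!mulgA.
by rewrite -elemV mulVKg -elemV mulgV.
Qed.

End diagonal.

Section mautner.
Variables (R : realType) (n : nat).
Local Notation X := (SLQ_quot n R).
Local Notation XB := (borel (SLQ_quot n R)).
Variable mu : probability XB R.
Hypothesis mu_inv : forall (g : SL n (adele R)) (A : set XB),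
  measurable A -> mu (SLQ_rtrans g @^-1` A) = mu A.
Implicit Types (r s : SL n R) (w phi : XB -> R).

Lemma real_act_measurable r : measurable_fun setT (real_act r : XB -> XB).
Proof. exact: (@borel_continuous_map X X (real_act r) (@real_act_continuous R n r)). Qed.

Lemma real_act_invariant r (A : set XB) : measurable A ->
  mu ((real_act r : XB -> XB) @^-1` A) = mu A.
Proof. exact: mu_inv. Qed.

Lemma bmf_real_act r w : bmf w -> bmf (fun x : XB => w (real_act r x)).
Proof. by move=> bw; exact: (bmf_comp bw (real_act_measurable r)). Qed.

Lemma int_real_act r w : bmf w -> \int[mu]_x w (real_act r x) = \int[mu]_x w x.
Proof.
move=> bw; exact: (@bmf_int_invariant _ XB R mu (real_act r : XB -> XB) w (real_act_measurable r) (@real_act_invariant r) bw).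
Qed.

(** Squared L^2 distance of w to its translate by r. Being squared, it obeys a triangle inequality
    with the factor 2 of [dqM], which is the origin of the constants 9, 55 and 22 below. *)
Definition dq w r : R := qform mu (fun x : XB => w (real_act r x) - w x).
Lemma qform_real_act r w : bmf w -> qform mu (fun x : XB => w (real_act r x)) = qform mu w.
Proof. by move=> bw; rewrite /qform (@int_real_act r (fun x : XB => w x * w x))//; exact: bmfM. Qed.

Lemma dq1 w : dq w 1%g = 0.
Proof.
rewrite /dq /qform; under eq_Rintegral do rewrite real_act1 subrr mul0r.
by rewrite Rintegral_cst// mul0r.
Qed.

Lemma dqV w r : bmf w -> dq w r^-1%g = dq w r.
Proof.
move=> bw; have bV := bmfB (bmf_real_act r^-1%g bw) bw.
rewrite /dq -(@qform_real_act r (fun x : XB => w (real_act r^-1%g x) - w x))// -qformN.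
by apply: eq_Rintegral => x _; rewrite real_actK opprB.
Qed.

Lemma dqM w r s : bmf w -> dq w (r * s)%g <= 2 * dq w r + 2 * dq w s.
Proof.
move=> bw; rewrite /dq -(@qform_real_act r (fun x : XB => w (real_act s x) - w x)); last first.
  by apply: bmfB => //; exact: bmf_real_act.
have b1 := bmfB (bmf_real_act r bw) bw.
have b2 : bmf (fun x : XB => w (real_act s (real_act r x)) - w (real_act r x)).
  by apply: (@bmf_real_act r (fun x : XB => w (real_act s x) - w x)); apply: bmfB => //; exact: bmf_real_act.
apply: le_trans (qformD mu b1 b2); rewrite le_eqVlt; apply/orP; left; apply/eqP.
by apply: eq_Rintegral => x _; rewrite real_actM; congr (_ * _); ring.
Qed.

Definition lip (L : R) w := forall x r, `|w (real_act r x) - w x| <= L * dist1 r.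

Lemma l1_delta (c : R) (i j : 'I_n) : l1 (c *: delta_mx i j) = `|c|.
Proof.
rewrite /l1 (bigD1 i)//= (bigD1 j)//= !mxE !eqxx mulr1.
rewrite big1 => [|l lj]; last by rewrite !mxE (negbTE lj) andbF mulr0 normr0.
rewrite big1 ?addr0// => k ki; rewrite big1// => l _.
by rewrite !mxE (negbTE ki) mulr0 normr0.
Qed.

Lemma dist1_elem (i j : 'I_n) (c : R) : dist1 (elem i j c) <= 2 * `|c|.
Proof.
have key (e : R) : l1 (SL_mx (elem i j e) - 1%:M) <= `|e|.
  by rewrite /= /elem_mx addrC addKr l1_delta; case: (i != j); rewrite ?normr0.
rewrite /dist1 elemV; have := key c; have := key (- c); rewrite normrN; lra.
Qed.

Lemma dq_elem_small L w e : 0 <= L -> bmf w -> lip L w -> 0 < e ->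
  exists2 d, 0 < d & forall i j c, `|c| < d -> dq w (elem i j c) <= e.
Proof.
move=> L0 bw lw e0; pose d := Num.min 1 (e / (4 * (L * L) + 1)).
have D0 : 0 < 4 * (L * L) + 1 by rewrite ltr_pwDr// mulr_ge0// mulr_ge0.
exists d => [|i j c]; first by rewrite lt_min ltr01 divr_gt0.
rewrite lt_min ltr_pdivlMr// => /andP[c1 cd].
have bd := bmfB (bmf_real_act (elem i j c) bw) bw.
have /le_trans : dq w (elem i j c) <= L * (2 * `|c|) * (L * (2 * `|c|)) * fine (mu setT).
  apply: qform_small => // x.
  by rewrite (le_trans (lw _ _))// ler_wpM2l// dist1_elem.
apply; rewrite (@probability_setT _ XB R mu) mulr1.
have c0 := normr_ge0 c; have LL : 0 <= L * L by rewrite mulr_ge0.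
have cc : `|c| * `|c| <= `|c| by rewrite ler_piMl// ltW.
have := ler_wpM2l LL cc.
rewrite (_ : L * (2 * `|c|) * (L * (2 * `|c|)) = 4 * (L * L * (`|c| * `|c|))); last by ring.
move: cd; rewrite mulrDr mulr1 mulrCA [`|c| * _]mulrC; lra.
Qed.

Variables a b : 'I_n.
Hypothesis ab : a != b.

Let c_neq0 k : (2 ^+ k : R) != 0.
Proof. by rewrite expf_neq0. Qed.

Section almost_invariant.
Variables (w : XB -> R) (L e : R).
Hypotheses (L0 : 0 <= L) (bw : bmf w) (lw : lip L w) (e0 : 0 < e).
Hypothesis uw : forall m : nat, dq w (elem a b m%:R) <= e.

Lemma dq_diag2 k : dq w (diag2 ab (c_neq0 k)) <= 9 * e.
Proof.
have e8 : 0 < e / 8 by rewrite divr_gt0.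
have [d d0 dP] := dq_elem_small L0 bw lw e8.
pose c : R := 2 ^+ k.
have c1 : 1 <= c by rewrite exprn_ege1// ler1n.
have c0 : 0 < c by rewrite (lt_le_trans ltr01).
pose M := (Num.bound (c / d)).+1.
have M0 : 0 < M%:R :> R by [].
have Md : c / d < M%:R.
  rewrite (lt_le_trans (archi_boundP _))// ?ler_nat//.
  by rewrite divr_ge0// ltW.
have cM : c / M%:R < d by rewrite ltr_pdivrMr// mulrC -ltr_pdivrMr.
(* With c = 2^k both m and m / c = M are natural numbers, to which [uw] applies, and M > c / d makes
   the entries E and c E of the other two factors smaller than d. [dqM] then gives 2 (2e + e/4)
   twice, that is 9e. *)
pose m := (2 ^ k * M)%N.
have mE : m%:R = c * M%:R :> R by rewrite natrM natrX.
have m0 : m%:R != 0 :> R by rewrite mE mulf_neq0// gt_eqF.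
pose E := (c - 1) / m%:R.
have E0 : 0 <= E by rewrite divr_ge0// subr_ge0.
have cE : c * E = (c - 1) / M%:R.
  by rewrite /E mE; field; rewrite !gt_eqF.
have cEd : `|c * E| < d.
  rewrite cE ger0_norm ?divr_ge0 ?subr_ge0//.
  by rewrite (le_lt_trans _ cM)// ler_pM2r ?invr_gt0// gerBl.
have Ed : `|E| < d.
  apply: le_lt_trans cEd.
  by rewrite (ger0_norm E0) ger0_norm ?ler_peMl// mulr_ge0// ltW.
have mEc : m%:R * E = c - 1 by rewrite mulrC divfK.
rewrite (diag2_mautner ab (c_neq0 k) m0 mEc).
have mc : m%:R / c = M%:R by rewrite mE mulrAC mulfV ?mul1r// gt_eqF.
rewrite -/c mc; have u1 := uw m.
have u2 : dq w (elem a b (- M%:R)) <= e by rewrite -elemV dqV//; exact: uw.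
have u3 := dP b a E Ed.
have u4 : dq w (elem b a (- (c * E))) <= e / 8 by apply: dP; rewrite normrN.
have := dqM (elem a b m%:R * elem b a E)%g (elem a b (- M%:R) * elem b a (- (c * E)))%g bw.
have := dqM (elem a b m%:R) (elem b a E) bw.
have := dqM (elem a b (- M%:R)) (elem b a (- (c * E))) bw.
lra.
Qed.

(** The ratio is c or c^2 up to inversion as soon as the position (i, j) meets {a, b}, so
    conjugating by the diagonal matrix or by its inverse contracts that entry. *)
Lemma diag2_ratio (c : R) i j : 1 <= c -> i != j ->
  (i \in [:: a; b]) || (j \in [:: a; b]) ->
  let rho := diag2_row a b c 0 j / diag2_row a b c 0 i in
  (`|rho| <= c^-1) || (`|rho^-1| <= c^-1).
Proof.
move=> c1; have c0 : 0 < c by rewrite (lt_le_trans ltr01).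
have ci0 : 0 <= c^-1 by rewrite invr_ge0 ltW.
have ci : c^-1 <= 1 by rewrite invf_le1.
have cc : c^-1 * c^-1 <= c^-1 by rewrite ler_piMl.
have nba : (b == a) = false by rewrite eq_sym (negbTE ab).
rewrite !inE !mxE /=.
have [->|ia] := eqVneq i a.
  rewrite eq_sym => ja _; rewrite (negbTE ja); apply/orP; left.
  by case: ifP => _; rewrite ?mul1r ger0_norm ?mulr_ge0.
have [->|ib] := eqVneq i b.
  move=> jb _; apply/orP; right; rewrite invfM !invrK.
  have [ja|ja] := eqVneq j a; first by rewrite ger0_norm ?mulr_ge0.
  by rewrite [j == b]eq_sym (negbTE jb) invr1 mul1r ger0_norm.
move=> ij /=; have [ja _|ja /= jb] := eqVneq j a.
  by rewrite divr1 orbC ger0_norm ?lexx.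
by rewrite jb divr1 ger0_norm ?lexx.
Qed.

(** Conjugation by a large diagonal matrix shrinks the entry s below d, where the Lipschitz bound
    applies. Two uses of [dqM] give 2 (2 * 9e + 2 * e/8) + 2 * 9e, which is less than 55e. *)
Lemma dq_elem_ab i j (s : R) : i != j -> (i \in [:: a; b]) || (j \in [:: a; b]) ->
  dq w (elem i j s) <= 55 * e.
Proof.
move=> ij ijab; have e8 : 0 < e / 8 by rewrite divr_gt0.
have [d d0 dP] := dq_elem_small L0 bw lw e8.
pose k := Num.bound (`|s| / d); pose c : R := 2 ^+ k.
have c1 : 1 <= c by rewrite exprn_ege1// ler1n.
have c0 : 0 < c by rewrite (lt_le_trans ltr01).
have sc : `|s| * c^-1 < d.
  rewrite ltr_pdivrMr// mulrC -ltr_pdivrMr//.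
  have : `|s| / d < k%:R by apply: archi_boundP; rewrite divr_ge0// ltW.
  by move/lt_le_trans; apply; rewrite /c -natrX ler_nat ltnW// ltn_expl.
set D := diag2 ab (c_neq0 k); have DP : dq w D <= 9 * e := dq_diag2 k.
have DV : dq w D^-1%g <= 9 * e by rewrite dqV.
set rho := diag2_row a b c 0 j / diag2_row a b c 0 i.
have d_neq0 l : diag2_row a b c 0 l != 0.
  by rewrite mxE; case: ifP => // _; [rewrite gt_eqF|case: ifP => // _; rewrite ?invr_neq0// ?gt_eqF ?oner_neq0].
have EDs t : (elem i j t * D = D * elem i j (t * rho))%g.
  by apply: val_inj; rewrite /= elem_diag_mx.
have rho0 : rho != 0 by rewrite mulf_neq0 ?invr_neq0.
have [rc|rc] := orP (diag2_ratio c1 ij ijab).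
  have -> : elem i j s = (D * elem i j (s * rho) * D^-1)%g by rewrite -EDs mulgK.
  have h : dq w (elem i j (s * rho)) <= e / 8.
    by apply: dP; rewrite normrM (le_lt_trans _ sc)// ler_wpM2l.
  have := dqM (D * elem i j (s * rho))%g D^-1%g bw.
  have := dqM D (elem i j (s * rho)) bw; lra.
have -> : elem i j s = (D^-1 * elem i j (s / rho) * D)%g.
  by rewrite -mulgA EDs mulKg divfK.
have h : dq w (elem i j (s / rho)) <= e / 8.
  by apply: dP; rewrite normrM (le_lt_trans _ sc)// ler_wpM2l.
have := dqM (D^-1 * elem i j (s / rho))%g D bw.
have := dqM D^-1%g (elem i j (s / rho)) bw; lra.
Qed.

(** Positions that avoid a and b are reached by commutators of positions through a. Three uses of
    [dqM] on four factors bounded by 55e give 4, 10 and then 22 times 55e. *)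
Lemma dq_elem i j (s : R) : dq w (elem i j s) <= 22 * (55 * e).
Proof.
have [->|ij] := eqVneq i j.
  by rewrite elem_id dq1 !mulr_ge0// ltW.
have [ijab|] := boolP ((i \in [:: a; b]) || (j \in [:: a; b])).
  by have := dq_elem_ab s ij ijab; have := e0; lra.
rewrite negb_or !inE !negb_or => /andP[/andP[ia ib] /andP[ja jb]].
rewrite -[s]mulr1 (@elem_comm _ _ i a j s 1)//; last by rewrite eq_sym.
have aj : a != j by rewrite eq_sym.
have h1 t : dq w (elem i a t) <= 55 * e by apply: dq_elem_ab => //; rewrite !inE eqxx orbT.
have h2 t : dq w (elem a j t) <= 55 * e by apply: dq_elem_ab => //; rewrite !inE eqxx.
have := dqM (elem i a s * elem a j 1 * elem i a (- s))%g (elem a j (- 1)) bw.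
have := dqM (elem i a s * elem a j 1)%g (elem i a (- s)) bw.
have := dqM (elem i a s) (elem a j 1) bw.
have := h1 s; have := h1 (- s); have := h2 1; have := h2 (- 1); lra.
Qed.

End almost_invariant.

Definition horo_avg (N : nat) (phi : XB -> R) : XB -> R :=
  cesaro (fun k => real_act (elem a b k%:R) : XB -> XB) N phi.

Lemma bmf_horo_avg N phi : bmf phi -> bmf (horo_avg N phi).
Proof. by apply: bmf_orbit_avg => k; exact: real_act_measurable. Qed.

(** The constant L' depends on N. It only determines how small the entries must be in
    [dq_elem_small]; the bound of [dq_elem] is free of it. *)
Lemma horo_avg_lip N phi L : 0 <= L -> lip L phi -> exists2 L', 0 <= L' & lip L' (horo_avg N phi).
Proof.
move=> L0 pL.
pose u k : SL n R := elem a b k%:R.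
pose c k := l1 (SL_mx (u k)^-1%g) * l1 (u k).
have c0 k : 0 <= c k by rewrite mulr_ge0// l1_ge0.
exists (N%:R^-1 * \sum_(k <- iota 0 N) L * c k).
  by rewrite mulr_ge0 ?invr_ge0// sumr_ge0// => k _; rewrite mulr_ge0.
move=> x r; rewrite /horo_avg /cesaro /orbit_avg size_iota -mulrBr normrM.
rewrite ger0_norm ?invr_ge0// -mulrA ler_wpM2l ?invr_ge0//.
rewrite -sumrB mulr_suml (le_trans (ler_norm_sum _ _ _))// ler_sum// => k _.
rewrite -!real_actM -/(u k).
have -> : (r * u k = u k * ((u k)^-1 * r * u k))%g by rewrite !mulgA mulgV mul1g.
rewrite real_actM (le_trans (pL _ _))// -mulrA ler_wpM2l//.
exact: dist1_conj.
Qed.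

Theorem horo_avg_almost_invariant phi L e : 0 <= L -> bmf phi -> lip L phi -> 0 < e ->
  exists N0, forall N, (N0 <= N)%N -> (0 < N)%N -> forall i j (s : R),
    dq (horo_avg N phi) (elem i j s) <= e.
Proof.
move=> L0 bp lp e0; have e1 : 0 < e / 22 / 55 by rewrite !divr_gt0.
pose g k := real_act (elem a b k%:R) : XB -> XB.
have gD i j x : g j (g i x) = g (i + j)%N x by rewrite /g -real_actM -elemD natrD.
have mg i : measurable_fun setT (g i) by exact: real_act_measurable.
have ginv i (A : set XB) : measurable A -> mu (g i @^-1` A) = mu A.
  exact: real_act_invariant.
have [N0 HN0] := cesaro_almost_invariant gD mg ginv bp e1.
exists N0 => N N0N Npos i j s.
have [L' L'0 lL'] := horo_avg_lip N L0 lp.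
have := dq_elem L'0 (bmf_horo_avg N bp) lL' e1 (fun m => HN0 N N0N Npos m) i j s.
by rewrite [55 * _]mulrC divfK// [22 * _]mulrC divfK.
Qed.

End mautner.

(** * Lebesgue measure on R^(n+1) *)

Section lebesgue_outer_measure.
Variables (R : realType) (n : nat).
Local Notation V := 'rV[R]_n.+1.
Local Notation outer := (@lebesgue_outer R n).
Implicit Types (A B : set V) (a b x : V).

Definition vol a b : R := \prod_i (b 0 i - a 0 i).

Definition box_cover A (F : nat -> V * V) :=
  (forall k i, (F k).1 0 i <= (F k).2 0 i) /\ A `<=` \bigcup_k box (F k).1 (F k).2.

Lemma vol_ge0 a b : (forall i, a 0 i <= b 0 i) -> 0 <= vol a b.
Proof. by move=> ab; apply: prodr_ge0 => i _; rewrite subr_ge0. Qed.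

Lemma outer_le_cover A F : box_cover A F ->
  (outer A <= \sum_(k <oo) (vol (F k).1 (F k).2)%:E)%E.
Proof. by move=> AF; apply: ereal_inf_lbound; exists F. Qed.

Lemma outer_ge A (v : \bar R) :
  (forall F, box_cover A F -> v <= \sum_(k <oo) (vol (F k).1 (F k).2)%:E)%E -> (v <= outer A)%E.
Proof. by move=> H; apply: le_ereal_inf_tmp => _ [F AF <-]; exact: H. Qed.

Lemma outer_ge0 A : (0 <= outer A)%E.
Proof.
apply: outer_ge => F [F0 _]; apply: nneseries_ge0 => k _ _.
by rewrite lee_fin vol_ge0.
Qed.

Lemma vol_degenerate a : vol a a = 0.
Proof. by rewrite /vol big_ord_recl subrr mul0r. Qed.

Lemma outer_box a b : (forall i, a 0 i <= b 0 i) -> (outer (box a b) <= (vol a b)%:E)%E.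
Proof.
move=> ab; have := @outer_le_cover (box a b) (fun k => if k is 0%N then (a, b) else (0, 0)).
move=> /(_ _)/le_trans; apply.
  split; first by case => [|k] i /=; [exact: ab|exact: lexx].
  by move=> x xab; exists 0%N.
rewrite nneseries_recl//; last first.
  by move=> k _; rewrite lee_fin; apply: vol_ge0 => i; case: k => [|k] /=; [exact: ab|exact: lexx].
rewrite /= eseries0 ?adde0// => k k0 _ /=.
by case: k k0 => // k _; rewrite vol_degenerate.
Qed.

Lemma outer0 : outer set0 = 0%E.
Proof.
apply/eqP; rewrite eq_le outer_ge0 andbT.
have := @outer_le_cover set0 (fun=> (0, 0)).
move=> /(_ _)/le_trans; apply; first by split.
by rewrite eseries0// => k _ _; rewrite vol_degenerate.
Qed.

Lemma outer_le : {homo outer : A B / A `<=` B >-> (A <= B)%E}.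
Proof.
move=> A B AB; apply: outer_ge => F [F0 BF]; apply: outer_le_cover; split => //.
exact: subset_trans AB BF.
Qed.

Lemma outer_sigma_subadditive : sigma_subadditive outer.
Proof.
move=> A; have [[i ioo]|] := pselect (exists i, outer (A i) = +oo%E).
  rewrite (eseries_pinfty _ _ ioo) ?leey// => k _.
  by rewrite -ltNye (lt_le_trans _ (outer_ge0 _)).
rewrite -forallNE => Aoo.
suff add2e (e : {posnum R}) :
    (outer (\bigcup_n A n) <= \sum_(i <oo) outer (A i) + e%:num%:E)%E.
  by apply/lee_addgt0Pr => _/posnumP[].
rewrite (le_trans _ (epsilon_trick _ _ _))//; last first.
  by move=> k; exact: outer_ge0.
pose P k (B : nat -> V * V) := box_cover (A k) B /\
  (\sum_(i <oo) (vol (B i).1 (B i).2)%:E <= outer (A k) + (e%:num / (2 ^ k.+1)%:R)%:E)%E.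
have [G PG] : {G : (nat -> V * V)^nat & forall k, P k (G k)}.
  apply: (@choice _ _ P) => k; rewrite /P.
  have en1 : 0 < e%:num / (2 ^ k.+1)%:R by [].
  have fA : outer (A k) \is a fin_num.
    rewrite ge0_fin_numE; last exact: outer_ge0.
    by rewrite ltey; apply/eqP/Aoo.
  have [_ [B AB <-] /ltW BE] := lb_ereal_inf_adherent en1 fA.
  by exists B.
pose vG (p : nat * nat) : \bar R := (vol (G p.1 p.2).1 (G p.1 p.2).2)%:E.
have vG_ge0 p : (0 <= vG p)%E.
  by rewrite lee_fin; apply: vol_ge0 => i; have [[+ _] _] := PG p.1; apply.
apply: (@le_trans _ _ (\esum_(p in setT) vG p)%E).
  have /card_esym/ppcard_eqP[f] := card_nat2.
  have := @outer_le_cover (\bigcup_k A k) (fun k => G (f k).1 (f k).2).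
  move=> /(_ _)/le_trans; apply.
    split; first by move=> k i; have [[+ _] _] := PG (f k).1; apply.
    move=> t [i _ Ait]; have [[_ /(_ t Ait)[j _ Gt]] _] := PG i.
    by exists (f^-1%FUN (i, j)) => //; rewrite invK ?inE.
  rewrite (_ : (\sum_(k <oo) _)%E = (\sum_(k <oo) vG (f k))%E)//.
  rewrite nneseries_esumT//.
  by rewrite (reindex_esum setT setT f).
rewrite (_ : esum _ _ = (\sum_(i <oo) \sum_(j <oo) vG (i, j))%E); last first.
  pose J : nat -> set (nat * nat) := fun i => [set (i, j) | j in setT].
  rewrite (_ : setT = \bigcup_k J k); last first.
    by rewrite predeqE => -[i j]; split => // _; exists i => //; exists j.
  rewrite esum_bigcupT//=; last first.
    apply/trivIsetP => i j _ _ ij.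
    rewrite predeqE => -[k m] /=; split => //= -[] [_] _ [<-{k} _].
    by move=> [m' _] [] /esym/eqP; rewrite (negbTE ij).
  rewrite nneseries_esumT; last by move=> k; exact: nneseries_ge0.
  apply: eq_esum => i _; rewrite nneseries_esumT//.
  rewrite (reindex_esum setT (J i) (pair i))//; split.
  - by move=> j _; exists j.
  - by move=> j k _ _ [].
  - by move=> _ [j _ <-]; exists j.
apply: lee_nneseries => [k _ _|k _]; last by have [_] := PG k.
by apply: nneseries_ge0 => j _ _; exact: vG_ge0.
Qed.

HB.instance Definition _ := isOuterMeasure.Build R V outer
  outer0 outer_ge0 outer_le outer_sigma_subadditive.

End lebesgue_outer_measure.

Section lebesgue_measure_rV.
Variables (R : realType) (n : nat).
Local Notation V := 'rV[R]_n.+1.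
Local Notation outer := (@lebesgue_outer R n).
Implicit Types (A B : set V) (a b x : V).

(** Each covering box is cut at height c along the axis i into two boxes whose volumes add up
    exactly, since min(u, c) + max(u, c) = u + c at both ends. *)
Lemma halfspace_caratheodory i c : outer.-caratheodory [set x : V | x 0 i <= c].
Proof.
apply: le_caratheodory_measurable => X; apply: outer_ge => F [F0 XF].
pose lo (x : V) : V := \row_l if l == i then Num.min (x 0 l) c else x 0 l.
pose hi (x : V) : V := \row_l if l == i then Num.max (x 0 l) c else x 0 l.
have volE (a b : V) : vol a b = vol (lo a) (lo b) + vol (hi a) (hi b).
  rewrite /vol (bigD1 i)//= [X in _ = X + _](bigD1 i)//= [X in _ = _ + X](bigD1 i)//=.
  rewrite !mxE eqxx.
  under [X in _ * X + _]eq_bigr => l li do rewrite !mxE (negbTE li).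
  under [X in _ + _ * X]eq_bigr => l li do rewrite !mxE (negbTE li).
  rewrite -mulrDl; congr (_ * _).
  by have := minr_to_max (a 0 i) c; have := minr_to_max (b 0 i) c; lra.
have lo_le (a b : V) : (forall l, a 0 l <= b 0 l) -> forall l, lo a 0 l <= lo b 0 l.
  move=> ab l; rewrite !mxE; case: ifP => // _.
  by rewrite le_min !ge_min ab lexx orbT.
have hi_le (a b : V) : (forall l, a 0 l <= b 0 l) -> forall l, hi a 0 l <= hi b 0 l.
  move=> ab l; rewrite !mxE; case: ifP => // _.
  by rewrite ge_max !le_max ab lexx orbT.
apply: (@le_trans _ _ (\sum_(k <oo) (vol (lo (F k).1) (lo (F k).2))%:E +
   \sum_(k <oo) (vol (hi (F k).1) (hi (F k).2))%:E)%E); last first.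
  rewrite -nneseriesD.
  - by apply: lee_nneseries => [k _ _|k _]; rewrite -EFinD -volE// lee_fin vol_ge0.
  - by move=> k _; rewrite lee_fin vol_ge0//; exact: lo_le.
  - by move=> k _; rewrite lee_fin vol_ge0//; exact: hi_le.
apply: leeD.
  apply: (@outer_le_cover _ _ _ (fun k => (lo (F k).1, lo (F k).2))); split.
    by move=> k; exact: lo_le.
  move=> x [/XF[k _ Fx] /= xc]; exists k => // l; rewrite !mxE.
  by have /andP[h1 h2] := Fx l; case: eqP => [li|_] /=; rewrite ?h1 ?h2// ge_min le_min h1 h2 li xc.
apply: (@outer_le_cover _ _ _ (fun k => (hi (F k).1, hi (F k).2))); split.
  by move=> k; exact: hi_le.
move=> x [/XF[k _ Fx] /= /negP]; rewrite -ltNge => /ltW xc; exists k => // l; rewrite !mxE.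
by have /andP[h1 h2] := Fx l; case: eqP => [li|_] /=; rewrite ?h1 ?h2// ge_max le_max h1 h2 li xc.
Qed.

Definition obox a b : set V := [set x | forall i, a 0 i < x 0 i <= b 0 i].

Lemma caratheodory_bigcap_ord m (A : 'I_m -> set V) :
  (forall i, outer.-caratheodory (A i)) -> outer.-caratheodory [set x | forall i, A i x].
Proof.
move=> mA; rewrite (_ : mkset _ = ~` \bigcup_(k in setT)
    (if insub k is Some i then ~` A i else set0)).
  apply: caratheodory_measurable_setC; apply: caratheodory_measurable_bigcup => k.
  case: insub => [i|]; last exact: caratheodory_measurable_set0.
  exact/caratheodory_measurable_setC/mA.
apply/seteqP; split => [x /= Ax [k _]|x /= nA i].
  by case: insubP => // i _ _; apply; exact: Ax.
apply: contrapT => nAi; apply: nA; exists (val i) => //.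
by rewrite valK.
Qed.

Lemma obox_caratheodory a b : outer.-caratheodory (obox a b).
Proof.
apply: (@caratheodory_bigcap_ord _ (fun i => [set x : V | a 0 i < x 0 i <= b 0 i])) => i.
rewrite (_ : mkset _ = [set x : V | x 0 i <= b 0 i] `\` [set x : V | x 0 i <= a 0 i]).
  by apply: caratheodory_measurable_setD; exact: halfspace_caratheodory.
apply/seteqP; split => x /=.
  by move=> /andP[ax ->]; split => //; apply/negP; rewrite -ltNge.
by move=> [-> /negP]; rewrite -ltNge => ->.
Qed.

(** The half-open boxes with rational corners that lie in A are countably many and cover A. *)
Lemma open_caratheodory A : open A -> outer.-caratheodory A.
Proof.
move=> oA; pose q (a : 'rV[rat]_n.+1) : V := map_mx ratr a.
pose C k := if (unpickle k : option ('rV[rat]_n.+1 * 'rV[rat]_n.+1)) is Some ab then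
  (if `[< obox (q ab.1) (q ab.2) `<=` A >] then obox (q ab.1) (q ab.2) else set0) else set0.
rewrite (_ : A = \bigcup_k C k).
  apply: caratheodory_measurable_bigcup => k; rewrite /C.
  case: unpickle => [[a b]|]; last exact: caratheodory_measurable_set0.
  by case: ifP => _; [exact: obox_caratheodory|exact: caratheodory_measurable_set0].
apply/seteqP; split => [x Ax|x [k _]]; last first.
  by rewrite /C; case: unpickle => // ab; case: asboolP => // + ?; apply.
have /nbhs_ballP[e /= e0 eA] : nbhs x A by apply: open_nbhs_nbhs.
have /choice[a Ha] : forall i, exists r : rat, x 0 i - e < ratr r < x 0 i.
  move=> i; have /rat_in_itvoo[r] : x 0 i - e < x 0 i by rewrite gtrBl.
  by rewrite in_itv/= => ?; exists r.
have /choice[b Hb] : forall i, exists r : rat, x 0 i < ratr r < x 0 i + e.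
  move=> i; have /rat_in_itvoo[r] : x 0 i < x 0 i + e by rewrite ltrDl.
  by rewrite in_itv/= => ?; exists r.
pose a' : 'rV[rat]_n.+1 := \row_i a i; pose b' : 'rV[rat]_n.+1 := \row_i b i.
have xab : obox (q a') (q b') x.
  by move=> i; rewrite !mxE; have /andP[_ ->] := Ha i; have /andP[/ltW -> _] := Hb i.
have abA : obox (q a') (q b') `<=` A.
  move=> y yab; apply: eA; split => // i j; rewrite ord1 /ball/= distrC ltr_distl.
  have /andP[h1 _] := Ha j; have /andP[_ h2] := Hb j.
  have := yab j; rewrite !mxE => /andP[h3 h4].
  by rewrite (lt_trans h1 h3) (le_lt_trans h4 h2).
exists (pickle (a', b')) => //; rewrite /C pickleK /=.
by case: asboolP.
Qed.

Local Notation VB := (borel V).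

Lemma borel_caratheodory (A : set VB) : measurable A -> outer.-caratheodory A.
Proof.
apply: smallest_sub => [|B]; last exact: open_caratheodory.
split.
- exact: caratheodory_measurable_set0.
- by move=> B mB; rewrite setTD; exact: caratheodory_measurable_setC.
- by move=> F mF; exact: caratheodory_measurable_bigcup.
Qed.

Definition ell (A : set VB) : \bar R := outer A.

Lemma ell0 : ell set0 = 0%E. Proof. exact: outer0. Qed.

Lemma ell_ge0 A : (0 <= ell A)%E. Proof. exact: outer_ge0. Qed.

Lemma ell_sigma_additive : semi_sigma_additive ell.
Proof.
move=> F mF tF mUF.
apply: (@caratheodory_measure_sigma_additive R V outer F) => //.
  by move=> k; exact: borel_caratheodory.
exact: borel_caratheodory.
Qed.

HB.instance Definition _ := isMeasure.Build _ VB R ell ell0 ell_ge0 ell_sigma_additive.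
Lemma elem_mulmx (i j : 'I_n.+1) s x l :
  (x *m elem_mx i j s) 0 l = x 0 l + x 0 i * s * ((i != j) && (l == j))%:R.
Proof.
rewrite /elem_mx mulmxDr mulmx1 mxE; congr (_ + _).
rewrite -scalemxAr mxE mxE (bigD1 i)//= big1 ?addr0 => [|k ki]; last first.
  by rewrite mxE (negbTE ki) mulr0.
by rewrite mxE eqxx/=; case: (i != j); rewrite ?mulr1n ?mulr0n ?mul0r ?mulr0//= mulrCA mulrA.
Qed.

(** The box is cut into M+1 slabs of thickness h across the axis i. On a slab the shear is a
    translation up to an error |s| h along the axis j, so the image fits in a box enlarged by that
    much on both sides; the total excess volume is O(1/M). *)
Lemma outer_shear_box (i j : 'I_n.+1) s a b : (forall l, a 0 l <= b 0 l) ->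
  (outer [set x *m elem_mx i j s | x in box a b] <= (vol a b)%:E)%E.
Proof.
move=> ab; have [->|ij] := eqVneq i j.
  have -> : [set x *m elem_mx j j s | x in box a b] = box a b.
    apply/seteqP; split => [_ [x xab <-] l|x xab].
      by rewrite elem_mulmx eqxx mulr0 addr0; exact: xab.
    exists x => //; apply/rowP => l; by rewrite elem_mulmx eqxx mulr0 addr0.
  exact: outer_box.
pose P := \prod_(l | (l != i) && (l != j)) (b 0 l - a 0 l).
pose Li := b 0 i - a 0 i; pose Lj := b 0 j - a 0 j.
have ji : j != i by rewrite eq_sym.
have volE (a' b' : V) : vol a' b' = (b' 0 i - a' 0 i) * ((b' 0 j - a' 0 j) *
    \prod_(l | (l != i) && (l != j)) (b' 0 l - a' 0 l)).
  by rewrite /vol (bigD1 i)//= (bigD1 j).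
have P0 : 0 <= P by apply: prodr_ge0 => l _; rewrite subr_ge0.
have Li0 : 0 <= Li by rewrite subr_ge0.
have Lj0 : 0 <= Lj by rewrite subr_ge0.
suff H M : (outer [set x *m elem_mx i j s | x in box a b] <=
    (vol a b)%:E + (P * Li * (2 * `|s| * Li) / M.+1%:R)%:E)%E.
  apply/lee_addgt0Pr => e e0.
  pose K := P * Li * (2 * `|s| * Li).
  have K0 : 0 <= K by rewrite !mulr_ge0.
  apply: le_trans (H (Num.bound (K / e))) _; rewrite leeD2l// lee_fin -/K.
  rewrite ler_pdivrMr// mulrC -ler_pdivrMr// ltW//.
  rewrite (lt_le_trans (archi_boundP _)) ?ler_nat// divr_ge0//.
  exact/ltW.
have M0 : 0 < M.+1%:R :> R by [].
pose h := Li / M.+1%:R.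
have h0 : 0 <= h by rewrite divr_ge0.
pose lo k : V := \row_l if l == i then a 0 i + k%:R * h
  else if l == j then a 0 j + s * (a 0 i + k%:R * h) - `|s| * h else a 0 l.
pose hi k : V := \row_l if l == i then a 0 i + k.+1%:R * h
  else if l == j then b 0 j + s * (a 0 i + k%:R * h) + `|s| * h else b 0 l.
have lohi k l : lo k 0 l <= hi k 0 l.
  rewrite !mxE; case: ifP => _.
    by rewrite lerD2l ler_wpM2r// ler_nat.
  case: ifP => // _; have := ab j; have : 0 <= `|s| * h by rewrite mulr_ge0.
  lra.
have volk k : vol (lo k) (hi k) = h * ((Lj + 2 * `|s| * h) * P).
  rewrite volE !mxE !eqxx (negbTE ji); congr (_ * (_ * _)).
  - by rewrite -natr1; ring.
  - by rewrite /Lj; ring.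
  - by apply: eq_bigr => l /andP[li lj]; rewrite !mxE (negbTE li) (negbTE lj).
have sub : [set x *m elem_mx i j s | x in box a b] `<=`
    \big[setU/set0]_(k < M.+1) box (lo k) (hi k).
  move=> _ [x xab <-].
  have [xi1 xi2] := andP (xab i).
  have [k kM /andP[k1 k2]] : exists2 k, (k < M.+1)%N &
      a 0 i + k%:R * h <= x 0 i <= a 0 i + k.+1%:R * h.
    (* For h = 0 the box is flat along i and slab 0 contains every point; otherwise t locates the
       slab. *)
    have [h00|hn0] := eqVneq h 0.
      exists 0%N => //; rewrite h00 !mulr0 addr0 xi1 /=.
      have : Li = 0 by move/eqP: h00; rewrite mulf_eq0 invr_eq0 (gt_eqF M0) orbF => /eqP.
      by rewrite /Li => /eqP; rewrite subr_eq0 => /eqP <-.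
    have hp : 0 < h by rewrite lt_neqAle eq_sym hn0.
    pose t := (x 0 i - a 0 i) / h.
    have t0 : 0 <= t by rewrite divr_ge0// subr_ge0.
    have th : x 0 i = a 0 i + t * h by rewrite divfK// subrKC.
    have tM : t <= M.+1%:R.
      rewrite ler_pdivrMr// mulrC divfK ?gt_eqF//.
      by rewrite /Li lerD2r.
    (* At the far face t = M+1 truncation would give the index M+1, so the last slab M is taken. *)
    have [tM1|tM1] := eqVneq t M.+1%:R.
      exists M => //; by rewrite th tM1 lexx andbT lerD2l ler_wpM2r// ler_nat.
    have /andP[tr1 tr2] := Num.Theory.truncn_itv t0.
    exists (Num.truncn t).
      by rewrite -(ltr_nat R) (le_lt_trans tr1)// lt_neqAle tM1.
    by rewrite th !lerD2l !ler_wpM2r// ltW.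
  suff : (\bigcup_(k < M.+1) box (lo k) (hi k)) (x *m elem_mx i j s) by rewrite bigcup_mkord.
  exists k => // l.
  rewrite elem_mulmx ij !mxE /=; case: (eqVneq l i) => [->|li].
    by rewrite [i == j](negbTE ij) mulr0 addr0 k1 k2.
  case: (eqVneq l j) => [->|lj]; last by rewrite mulr0 addr0; exact: xab.
  rewrite mulr1; have [xj1 xj2] := andP (xab j).
  pose u := x 0 i - (a 0 i + k%:R * h).
  have u0 : 0 <= u by rewrite subr_ge0.
  have uh : u <= h.
    by move: k2; rewrite -[k.+1%:R]natr1 mulrDl mul1r /u; lra.
  have xiE : x 0 i = u + (a 0 i + k%:R * h) by rewrite subrK.
  have su : `|s * u| <= `|s| * h by rewrite normrM (ger0_norm u0) ler_wpM2l.
  move: su; rewrite ler_norml => /andP[su1 su2].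
  rewrite xiE [_ * s]mulrC mulrDr; lra.
apply: le_trans (outer_le sub) _.
apply: le_trans (outer_measure_subadditive _ (fun k => box (lo k) (hi k)) _) _.
apply: (@le_trans _ _ (\sum_(k < M.+1) (h * ((Lj + 2 * `|s| * h) * P))%:E)%E).
  by apply: lee_sum => k _; rewrite -(volk k); apply: outer_box.
rewrite sumEFin -EFinD lee_fin sumr_const card_ord -mulr_natl volE -/P -/Li -/Lj.
rewrite le_eqVlt; apply/orP; left; apply/eqP; rewrite /h; field.
by rewrite gt_eqF.
Qed.

Lemma outer_shear (i j : 'I_n.+1) s A :
  (outer [set x *m elem_mx i j s | x in A] <= outer A)%E.
Proof.
apply: outer_ge => F [F0 AF].
apply: (@le_trans _ _ (\sum_(k <oo) outer [set x *m elem_mx i j s | x in box (F k).1 (F k).2])%E).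
  apply: le_trans (outer_sigma_subadditive _); apply: outer_le.
  by move=> _ [x /AF[k _ Fx] <-]; exists k => //; exists x.
apply: lee_nneseries => [k _ _|k _]; first exact: outer_ge0.
exact: outer_shear_box.
Qed.

(** Shears do not increase outer measure, so together with their inverses they preserve it, and they
    generate SL(n+1, R). The set A is arbitrary. *)
Lemma outer_mulmx (g : SL n.+1 R) A :
  outer ((fun x : V => x *m g) @^-1` A) = outer A.
Proof.
have step (i j : 'I_n.+1) s B :
    (outer ((fun x : V => x *m elem_mx i j s) @^-1` B) <= outer B)%E.
  apply: le_trans (outer_shear i j (- s) B); apply: outer_le => x Bx.
  exists (x *m elem_mx i j s) => //; rewrite -mulmxA.
  have /(congr1 (@SL_mx _ _)) /= -> : (elem i j s * elem i j (- s) = 1)%g.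
    by rewrite -elemD subrr elem0.
  by rewrite mulmx1.
have stepE (i j : 'I_n.+1) s B :
    outer ((fun x : V => x *m elem_mx i j s) @^-1` B) = outer B.
  apply/eqP; rewrite eq_le step /=.
  have := step i j (- s) ((fun x : V => x *m elem_mx i j s) @^-1` B).
  rewrite -comp_preimage (_ : _ \o _ = id)//.
  apply/funext => x /=; rewrite -mulmxA.
  have /(congr1 (@SL_mx _ _)) /= -> : (elem i j (- s) * elem i j s = 1)%g.
    by rewrite -elemD addNr elem0.
  by rewrite mulmx1.
pose P (g : SL n.+1 R) := forall A, outer ((fun x : V => x *m g) @^-1` A) = outer A.
suff H : forall g, P g by exact: H.
apply: (SL_elem_ind (P := P) (@field_stable_range1 R)) => {g A} [A|i j s g IH A].
  by congr outer; apply/seteqP; split => x /=; rewrite mulmx1.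
rewrite -(IH A) -[in RHS](stepE i j s); congr outer.
by apply/seteqP; split => x /=; rewrite mulmxA.
Qed.

End lebesgue_measure_rV.

(** * Parabolic elements and the expanding flow *)

Section flow.
Variables (R : realType) (n : nat).
Local Notation SLR := (SL n.+1 R).
Local Notation V := 'rV[R]_n.+1.
Implicit Types (g h p : SLR) (z w : V) (t : R).

(* the parabolic subgroup contracted by conjugation with Phi t, t >= 0 *)
Definition par p := forall j, j != ord0 -> p ord0 j = 0.

Lemma PhiV t : ((Phi n.+1 t)^-1 = Phi n.+1 (- t))%g.
Proof.
apply: (mulgI (Phi n.+1 t)); rewrite mulgV; apply: val_inj; rewrite /= mulmx_diag.
apply/matrixP => i j; rewrite !mxE; case: eqP => // _; rewrite !mulr1n -expRD.
by case: ifP => _; rewrite ?mulrN -?opprD ?opprK subrr ?oppr0 expR0.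
Qed.

Lemma Phi_conjE t (P : 'M[R]_n.+1) i j :
  (SL_mx (Phi n.+1 t)^-1%g *m P *m SL_mx (Phi n.+1 t)) i j =
  expR ((if j == ord0 then - (n%:R * t) else t) - (if i == ord0 then - (n%:R * t) else t)) * P i j.
Proof.
rewrite -!val_eqE PhiV /= mul_mx_diag mxE mul_diag_mx mxE !mxE.
rewrite [LHS]mulrAC -expRD; congr (expR _ * _); rewrite addrC; congr (_ + _).
by case: ifP => _ //; rewrite mulrN.
Qed.

(** Conjugation multiplies the entries (i, 0), i != 0, by e^(-(n+1)t) and fixes (0, 0) and the lower
    right block. The entries that it would expand, the rest of the first row, vanish in P. *)
Lemma l1_Phi_conj t (P : 'M[R]_n.+1) : 0 <= t -> (forall j, j != ord0 -> P ord0 j = 0) ->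
  l1 (SL_mx (Phi n.+1 t)^-1%g *m P *m SL_mx (Phi n.+1 t)) <= l1 P.
Proof.
move=> t0 P0; apply: ler_sum => i _; apply: ler_sum => j _.
rewrite Phi_conjE normrM ger0_norm ?expR_ge0//.
have nt : 0 <= n%:R * t by rewrite mulr_ge0.
case: (eqVneq j ord0) => [->|j0]; case: (eqVneq i ord0) => [->|i0].
- by rewrite subrr expR0 mul1r.
- by rewrite /= ler_piMl// -[leRHS]expR0 ler_expR; lra.
- by rewrite P0// normr0 mulr0.
- by rewrite subrr expR0 mul1r.
Qed.

Lemma dist1_Phi_conj t p : 0 <= t -> par p -> par p^-1%g ->
  dist1 ((Phi n.+1 t)^-1 * p * Phi n.+1 t)%g <= dist1 p.
Proof.
move=> t0 pp pV.
have key q : par q -> l1 (SL_mx ((Phi n.+1 t)^-1 * q * Phi n.+1 t)%g - 1%:M) <= l1 (SL_mx q - 1%:M).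
  move=> pq; have -> : SL_mx ((Phi n.+1 t)^-1 * q * Phi n.+1 t)%g - 1%:M =
      SL_mx (Phi n.+1 t)^-1%g *m (SL_mx q - 1%:M) *m SL_mx (Phi n.+1 t).
    by rewrite mulmxBr mulmxBl mulmx1 SL_mulV_mx.
  apply: l1_Phi_conj => // j j0.
  by rewrite !mxE pq// eq_sym (negbTE j0) subrr.
rewrite /dist1 lerD ?key//.
by rewrite !invgM invgK mulgA key.
Qed.

Lemma Phi_elem t (i j : 'I_n.+1) (s : R) : exists s',
  (elem i j s * Phi n.+1 t = Phi n.+1 t * elem i j s')%g.
Proof.
eexists; apply: val_inj; rewrite /= elem_diag_mx//.
by rewrite mxE gt_eqF// expR_gt0.
Qed.

Lemma Phi_elem0 t (j : 'I_n.+1) (s : R) : j != ord0 ->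
  (elem ord0 j s * Phi n.+1 t = Phi n.+1 t * elem ord0 j (s * expR (n.+1%:R * t)))%g.
Proof.
move=> j0; apply: val_inj; rewrite /= elem_diag_mx; last by rewrite mxE gt_eqF// expR_gt0.
congr (_ *m elem_mx _ _ (_ * _)).
rewrite !mxE /= (_ : (j : nat) == 0%N = false); last by rewrite -[RHS](negbTE j0).
rewrite -expRN -expRD opprK -natr1 mulrDl mul1r addrC; congr expR.
Qed.

(** Counts elementary factors and ignores the size of their entries, so that conjugation by [Phi t],
    which rescales each entry, preserves it. [dq_elen] converts the count into a bound. *)
Inductive elen : nat -> SLR -> Prop :=
| elen1 : elen 0 1%g
| elenM k i j s g of elen k g : elen k.+1 (elem i j s * g)%g.

Lemma elen_elem i j s : elen 1 (elem i j s).
Proof. by rewrite -[elem i j s]mulg1; apply: elenM; exact: elen1. Qed.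

Lemma elen_mul k l g h : elen k g -> elen l h -> elen (k + l) (g * h)%g.
Proof.
elim=> [|{}k i j s {}g _ IH] lh; first by rewrite mul1g.
by rewrite -mulgA addSn; apply: elenM; exact: IH.
Qed.

Lemma elen_inv k g : elen k g -> elen k g^-1%g.
Proof.
elim=> [|{}k i j s {}g _ IH]; first by rewrite invg1; exact: elen1.
by rewrite invgM elemV -addn1; apply: elen_mul => //; exact: elen_elem.
Qed.

Lemma elen_Phi_conj k g t : elen k g -> elen k ((Phi n.+1 t)^-1 * g * Phi n.+1 t)%g.
Proof.
elim=> [|{}k i j s {}g _ IH]; first by rewrite mulg1 mulVg; exact: elen1.
have [s' es'] := Phi_elem t i j s.
have -> : ((Phi n.+1 t)^-1 * (elem i j s * g) * Phi n.+1 t =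
    elem i j s' * ((Phi n.+1 t)^-1 * g * Phi n.+1 t))%g.
  have -> : elem i j s = (Phi n.+1 t * elem i j s' * (Phi n.+1 t)^-1)%g by rewrite -es' mulgK.
  by rewrite -!mulgA mulKg.
exact: elenM.
Qed.

(** The unipotent matrix whose first row is 1 followed by the c_j with j != 0, and which is the
    identity below; the factor at j = ord0 is trivial. *)
Definition horo (c : V) : SLR := (\prod_(j <- enum 'I_n.+1) elem ord0 j (c 0 j))%g.

Lemma elen_horo c : elen n.+1 (horo c).
Proof.
rewrite /horo -{1}[n.+1]card_ord cardE; elim: (enum _) => [|j s IH].
  by rewrite big_nil; exact: elen1.
by rewrite big_cons /=; apply: elenM.
Qed.

Lemma horo_comm c j (s : R) : j != ord0 -> (elem ord0 j s * horo c = horo c * elem ord0 j s)%g.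
Proof.
move=> j0; rewrite /horo; elim: (enum _) => [|l r IH]; first by rewrite big_nil mulg1 mul1g.
rewrite big_cons -mulgA -IH !mulgA; congr (_ * _)%g.
have [->|l0] := eqVneq l ord0; first by rewrite elem_id mulg1 mul1g.
apply: val_inj; rewrite /= /elem_mx ![ord0 == _]eq_sym j0 l0.
rewrite !(mulmxDl, mulmxDr, mul1mx, mulmx1) -!(scalemxAr, scalemxAl) !mul_delta_mx_cond.
rewrite (negbTE j0) (negbTE l0) !mulr0n !scaler0 !addr0.
by rewrite -!addrA; congr (_ + _); rewrite addrC.
Qed.

Lemma mul_horo z (c : V) : (forall j, j != ord0 -> z 0 j + z 0 0 * c 0 j = 0) ->
  z *m horo c = z 0 0 *: delta_mx 0 0.
Proof.
move=> zc; have H (r : seq 'I_n.+1) w : uniq r -> forall l,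
    (w *m SL_mx (\prod_(j <- r) elem ord0 j (c 0 j))%g) 0 l =
    w 0 l + w 0 0 * c 0 l * ((l != ord0) && (l \in r))%:R.
  elim: r w => [|j r IH] w /=; first by move=> _ l; rewrite big_nil mulmx1 andbF mulr0 addr0.
  move=> /andP[jr ur] l; rewrite big_cons /= mulmxA IH// !elem_mulmx.
  rewrite inE (_ : (ord0 != j) && (0 == j) = false) ?mulr0 ?addr0; last by rewrite andbC; case: eqVneq.
  rewrite -addrA; congr (_ + _).
  have [->|lj] := eqVneq l j; last by rewrite andbF mulr0 add0r.
  by rewrite (negbTE jr) !andbF !andbT mulr0 addr0 eq_sym.
apply/rowP => l; rewrite H ?enum_uniq// mem_enum !mxE eqxx /=.
have [->|l0] := eqVneq l 0; first by rewrite mulr0 addr0 mulr1.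
by rewrite mulr1 zc// mulr0.
Qed.

Lemma par_row p (c : R) : (delta_mx 0 0 : V) *m p = c *: delta_mx 0 0 -> par p.
Proof.
move=> /rowP h j j0; have := h j; rewrite -rowE !mxE eqxx/=.
by rewrite (negbTE j0) mulr0 => <-; congr (SL_mx p _ j).
Qed.

Lemma par_diag_proof p : par p -> \det (\matrix_(i, j)
  (if (i != ord0) && (j == ord0) then 0 else p i j)) == 1.
Proof.
move=> pp; rewrite -(SL_det p).
set D := \matrix_(i, j) _; pose p' : 'M[R]_(1 + n) := p; pose D' : 'M[R]_(1 + n) := D.
rewrite -[\det D]/(\det D') -[\det (SL_mx p)]/(\det p').
have l0 k : lshift n k = ord0 :> 'I_(1 + n) by apply: val_inj; rewrite /= ord1.
have r0 (k : 'I_n) : rshift 1 k != ord0 :> 'I_(1 + n) by [].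
have -> : D' = block_mx (ulsubmx p') 0 0 (drsubmx p').
  rewrite -[D']submxK; congr block_mx; apply/matrixP => i j; rewrite !mxE ?l0 ?eqxx//.
  by rewrite pp.
rewrite det_ublock -[in X in _ == X](submxK p') (_ : ursubmx p' = 0) ?det_lblock//.
by apply/matrixP => i j; rewrite !mxE l0 pp.
Qed.

(** The limit of (Phi t)^-1 p (Phi t) as t tends to infinity: only the first column below the corner
    decays, see [par_diag_cvg]. *)
Definition par_diag p (pp : par p) : SLR := MkSL (par_diag_proof pp).

Lemma par_diag_cvg p (pp : par p) t : 0 <= t ->
  l1 (SL_mx ((Phi n.+1 t)^-1 * p * Phi n.+1 t)%g - SL_mx (par_diag pp)) <=
  expR (- (n.+1%:R * t)) * l1 (SL_mx p).
Proof.
move=> t0; rewrite /l1 mulr_sumr; apply: ler_sum => i _; rewrite mulr_sumr; apply: ler_sum => j _.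
have := Phi_conjE t p i j; rewrite !mxE => ->.
have [->|j0] := eqVneq j ord0; have [->|i0] := eqVneq i ord0 => /=.
- by rewrite subrr expR0 mul1r subrr normr0 mulr_ge0// expR_ge0.
- rewrite subr0 normrM ger0_norm ?expR_ge0// ler_wpM2r// ler_expR -natr1; lra.
- by rewrite pp// mulr0 subrr normr0 mulr0.
- by rewrite subrr expR0 mul1r subrr normr0 mulr_ge0// expR_ge0.
Qed.

End flow.

(** * Polar coordinates *)

Section polar.
Variables (R : realType) (n : nat).
Local Notation V := 'rV[R]_n.+1.
Local Notation VB := (borel V).
Implicit Types (z w x : V) (v : sphere R n) (g h : SL n.+1 R).

Definition norm2 z : R := Num.sqrt (\sum_i z 0 i ^+ 2).

Lemma norm2_sqr z : norm2 z ^+ 2 = \sum_i z 0 i ^+ 2.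
Proof. by rewrite sqr_sqrtr// sumr_ge0// => i _; exact: sqr_ge0. Qed.

Lemma norm2_ge0 z : 0 <= norm2 z. Proof. exact: sqrtr_ge0. Qed.

Lemma norm2_coord z i : `|z 0 i| <= norm2 z.
Proof.
rewrite -(ler_pXn2r (n := 2))// ?nnegrE ?norm2_ge0// norm2_sqr real_normK ?num_real//.
by rewrite (bigD1 i)//= lerDl sumr_ge0// => j _; exact: sqr_ge0.
Qed.

Lemma norm2_gt0 z : z != 0 -> 0 < norm2 z.
Proof.
move=> z0; rewrite lt_neqAle norm2_ge0 andbT eq_sym; apply: contra_neq z0 => z0.
apply/rowP => i; have := norm2_coord z i; rewrite z0 normr_le0 => /eqP ->.
by rewrite mxE.
Qed.

Lemma norm2Z (r : R) z : 0 <= r -> norm2 (r *: z) = r * norm2 z.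
Proof.
move=> r0; rewrite /norm2; under eq_bigr do rewrite mxE exprMn.
by rewrite -mulr_sumr sqrtrM ?sqr_ge0// sqrtr_sqr ger0_norm.
Qed.

Lemma norm2_sphere v : norm2 (sphere_val v) = 1.
Proof. by rewrite /norm2 (eqP (sphere_valP v)) sqrtr1. Qed.

Lemma sphere_neq0 v : sphere_val v != 0.
Proof.
apply/eqP => v0; have := norm2_sphere v; rewrite v0 /norm2 big1 ?sqrtr0; last first.
  by move=> i _; rewrite mxE expr0n.
by move/eqP; rewrite eq_sym oner_eq0.
Qed.

Definition radial z : V := (norm2 z)^-1 *: z.

(** At z = 0 the value is the default [point], which makes [nrm] total; it is continuous at all
    other points. *)
Definition nrm z : sphere R n := insubd (point : sphere R n) (radial z).

Lemma nrm_val z : z != 0 -> sphere_val (nrm z) = radial z.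
Proof.
move=> z0; rewrite /nrm /insubd insubT//=; apply/eqP.
under eq_bigr do rewrite mxE exprMn.
rewrite -mulr_sumr -norm2_sqr -exprMn mulVf ?expr1n// gt_eqF// norm2_gt0//.
Qed.

Lemma nrm_ray (r : R) v : 0 < r -> nrm (r *: sphere_val v) = v.
Proof.
move=> r0; apply: val_inj; rewrite /= nrm_val; last first.
  by rewrite scaler_eq0 negb_or gt_eqF//= sphere_neq0.
by rewrite /radial norm2Z ?ltW// norm2_sphere mulr1 scalerA mulVf ?scale1r// gt_eqF.
Qed.

Lemma norm2_continuous : continuous norm2.
Proof.
move=> z; apply: (@continuous_comp _ _ _ (fun x : V => \sum_i x 0 i ^+ 2) Num.sqrt); last exact: sqrt_continuous.
have := @continuous_big R 'I_n.+1 +%R 0 xpredT (@add_continuous R) V (index_enum _) (fun i x => x 0 i ^+ 2).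
apply => i _ {}z.
apply: (@continuous_comp _ _ _ (fun x : V => x 0 i) (fun y : R => y ^+ 2)); first exact: coord_continuous.
exact: exprn_continuous.
Qed.

Lemma radial_continuous z : z != 0 -> {for z, continuous radial}.
Proof.
move=> z0; apply: (@cvgZ _ _ V (nbhs z) _ (fun x => (norm2 x)^-1) id); last exact: cvg_id.
apply: (@continuous_comp V R R norm2 GRing.inv); first exact: norm2_continuous.
by apply: inv_continuous; rewrite gt_eqF// norm2_gt0.
Qed.

Lemma neq0_open : open [set z : V | z != 0].
Proof.
have -> : [set z : V | z != 0] = ~` [set 0].
  by apply/seteqP; split => z /= /eqP.
by apply: closed_openC; apply: accessible_closed_set1; apply: hausdorff_accessible; exact: norm_hausdorff.
Qed.

Lemma sphere_nbhs v (U : set (sphere R n)) : nbhs v U ->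
  exists B : set V, [/\ open B, B (sphere_val v) & forall w : sphere R n, B (sphere_val w) -> U w].
Proof.
rewrite nbhsE => -[D [[B oB BD] Dv] DU]; exists B; split => //.
  by move: Dv; rewrite -BD.
by move=> w Bw; apply: DU; rewrite -BD.
Qed.

Lemma sphere_val_continuous : continuous (@sphere_val R n).
Proof. exact: (@initial_continuous (sphere R n) _ (@sphere_val R n)). Qed.

Lemma nrm_continuous z : z != 0 -> {for z, continuous nrm}.
Proof.
move=> z0 U /= /sphere_nbhs[B [oB Bz BU]]; rewrite nrm_val// in Bz.
have nB : nbhs z (radial @^-1` B) by apply: radial_continuous => //; exact: open_nbhs_nbhs.
have n0 : nbhs z [set x : V | x != 0] by apply: open_nbhs_nbhs; split => //; exact: neq0_open.
suff : nbhs z (nrm @^-1` U) by [].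
by apply: filterS (filterI nB n0) => x [Bx x0]; apply: BU; rewrite nrm_val.
Qed.

Lemma sphere_closed1 v : closed [set v].
Proof.
have -> : [set v] = (@sphere_val R n) @^-1` [set sphere_val v].
  by apply/seteqP; split => w /= => [->//|/val_inj].
apply: preimage_closed; first by move=> w _; exact: sphere_val_continuous.
by apply: accessible_closed_set1; apply: hausdorff_accessible; exact: norm_hausdorff.
Qed.

End polar.

(** The preimage of an open set is open apart from the point a, which is itself a Borel set. Applied
    to [nrm], singular at 0, and to K, singular at v0. *)
Lemma borel_measurable_but_one (T U : ptopologicalType) (f : T -> U) (a : T) :
  closed [set a] -> (forall x, x != a -> {for x, continuous f}) ->
  measurable_fun (setT : set (borel T)) (f : borel T -> borel U).
Proof.
move=> ca cf.
have ma : measurable ([set a] : set (borel T)).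
  by rewrite -[X in measurable X]setCK; apply: measurableC; apply: borel_open_measurable; exact: closed_openC.
apply: (@measurability _ _ (borel T) (borel U) setT f (@open U)) => // _ [D oD <-].
rewrite setTI.
have -> : f @^-1` D = (f @^-1` D `&` ~` [set a]) `|` (f @^-1` D `&` [set a]).
  by rewrite -setIUr setUC setUv setIT.
apply: measurableU.
  apply: borel_open_measurable; rewrite openE => x [Dx xa].
  have xa' : x != a by apply/eqP.
  apply: filterI; first by apply: (cf x xa'); exact: open_nbhs_nbhs.
  by apply: open_nbhs_nbhs; split => //; exact: closed_openC.
have [Da|nDa] := pselect (D (f a)).
  by rewrite (_ : _ `&` _ = [set a])//; apply/seteqP; split => x /= [] // ->.
by rewrite (_ : _ `&` _ = set0)//; apply/seteqP; split => x //= [] + xa; rewrite xa.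
Qed.

Section rotation_to_e1.
Variables (R : realType) (n : nat) (K : sphere R n -> SL n.+1 R) (v0 : sphere R n).
Hypothesis K_e1 : forall v, sphere_val v *m K v = delta_mx 0 0.
Hypothesis K_smooth : forall v, v != v0 -> smooth_at (fun w => SL_mx (K w)) v.
Local Notation V := 'rV[R]_n.+1.
Local Notation VB := (borel V).
Implicit Types (z w : V) (v : sphere R n) (g h : SL n.+1 R).

Definition kap z := K (nrm z).

Lemma kap_row z : z != 0 -> z *m kap z = norm2 z *: delta_mx 0 0.
Proof.
move=> z0; rewrite -(K_e1 (nrm z)) nrm_val// /radial -scalemxAl scalerA mulfV ?scale1r//.
by rewrite gt_eqF// norm2_gt0.
Qed.

Lemma par_kap h w z : w != 0 -> z != 0 -> w *m h = z -> par ((kap w)^-1 * h * kap z)%g.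
Proof.
move=> w0 z0 wh; apply: (@par_row _ _ _ (norm2 z / norm2 w)).
have E : w *m kap w *m SL_mx ((kap w)^-1 * h * kap z)%g = z *m kap z.
  by rewrite -mulmxA -SL_mxM !mulgA mulgV mul1g SL_mxM mulmxA wh.
move: E; rewrite !kap_row// -scalemxAl => /(congr1 (fun y => (norm2 w)^-1 *: y)).
by rewrite !scalerA mulVf ?scale1r 1?mulrC// gt_eqF// norm2_gt0.
Qed.

Lemma K_continuous v i j : v != v0 -> {for v, continuous (fun u => K u i j)}.
Proof.
move=> /K_smooth[U [F [oU Uv /(_ i j 0%N) /(_ _ Uv) cF FK]]].
move=> A /=; rewrite FK// => /cF nA.
have nU : nbhs v ((@sphere_val R n) @^-1` U) by apply: sphere_val_continuous; exact: open_nbhs_nbhs.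
have nA' := @sphere_val_continuous R n v _ nA.
suff : nbhs v ((fun u => K u i j) @^-1` A) by [].
have nAU : nbhs v ((@sphere_val R n) @^-1` ((fun x => F x i j) @^-1` A) `&` (@sphere_val R n) @^-1` U) by exact: filterI.
by apply: filterS nAU => u [/= Au Uu]; rewrite FK.
Qed.

Lemma K_measurable i j : measurable_fun setT (fun v : borel (sphere R n) => K v i j : R).
Proof.
have idm := @borel_continuous_measurable R R id (fun x => @cvg_id _ (nbhs x)).
have mK : measurable_fun setT ((fun v => K v i j) : borel (sphere R n) -> borel R).
  apply: (@borel_measurable_but_one (sphere R n) R (fun v => K v i j) v0); first exact: sphere_closed1.
  by move=> v; exact: K_continuous.
exact: (measurableT_comp idm mK).
Qed.

Lemma nrm_measurable : measurable_fun setT (@nrm R n : VB -> borel (sphere R n)).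
Proof.
apply: (@borel_measurable_but_one V (sphere R n) (@nrm R n) 0); last exact: nrm_continuous.
by apply: accessible_closed_set1; apply: hausdorff_accessible; exact: norm_hausdorff.
Qed.

Lemma kap_measurable i j : measurable_fun setT (fun z : VB => kap z i j : R).
Proof. exact: (measurableT_comp (K_measurable i j) nrm_measurable). Qed.

(** The condition z_0 != 0 makes the coordinates [horo_coord] of z meaningful, and the second
    condition keeps away from the singular direction of K. The complement is null, see
    [outer_OmegaC]. *)
Definition Omega : set V := [set z : V | z 0 0 != 0 /\ nrm z != v0].

Lemma Omega_neq0 z : Omega z -> z != 0.
Proof. by move=> [+ _]; apply: contra_neq => ->; rewrite mxE. Qed.

Lemma Omega_open : open Omega.
Proof.
rewrite openE => z Oz; have z0 := Omega_neq0 Oz; have [z00 zv0] := Oz.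
have o1 : open [set y : R | y != 0].
  have -> : [set y : R | y != 0] = ~` [set 0] by apply/seteqP; split => y /= /eqP.
  by apply: closed_openC; apply: accessible_closed_set1; apply: hausdorff_accessible; exact: norm_hausdorff.
have o2 : open [set v | v != v0].
  have -> : [set v | v != v0] = ~` [set v0] by apply/seteqP; split => v /= /eqP.
  by apply: closed_openC; exact: sphere_closed1.
have n1 : nbhs z [set x : V | x 0 0 != 0].
  by apply: (@coord_continuous R 1 n.+1 0 0 z [set y | y != 0]); exact: open_nbhs_nbhs.
have n2 : nbhs z [set x : V | nrm x != v0].
  suff : (nrm x @[x --> z]) [set v | v != v0] by [].
  by apply: nrm_continuous => //; exact: open_nbhs_nbhs.
exact: filterI.
Qed.

Lemma kap_continuous z i j : Omega z -> {for z, continuous (fun x => kap x i j)}.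
Proof.
move=> Oz; apply: (@continuous_comp _ _ _ (@nrm R n) (fun v => K v i j)).
  by apply: nrm_continuous; exact: Omega_neq0.
by apply: K_continuous; case: Oz.
Qed.

End rotation_to_e1.

(** * Integrals against restrictions of a measure *)

Section restricted_measure.
Context d (T : measurableType d) (R : realType).
Implicit Types (A B U : set T) (h : T -> R).

Lemma bmf_indic A : measurable A -> bmf (\1_A : T -> R).
Proof.
move=> mA; split; first exact: measurable_indic.
by exists 1 => x; rewrite indicE; case: (_ \in _); rewrite ?normr1// normr0.
Qed.

Lemma bmf_int_indic (nu : {finite_measure set T -> \bar R}) A : measurable A ->
  \int[nu]_x (\1_A x : R) = fine (nu A).
Proof. by move=> mA; rewrite /Rintegral integral_indic// setIT. Qed.

Lemma bmf_int_pushforward d' (T' : measurableType d') (nu : {finite_measure set T -> \bar R})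
    (nu' : {finite_measure set T' -> \bar R}) (g : T -> T') (h : T' -> R) :
  measurable_fun setT g -> (forall P, measurable P -> nu (g @^-1` P) = nu' P) -> bmf h ->
  \int[nu]_x h (g x) = \int[nu']_x h x.
Proof.
move=> mg gnu bh; have [mh [C hC]] := bh; congr fine.
rewrite -(@integral_pushforward _ _ _ _ _ g mg nu setT (EFin \o h))//=.
- by apply: eq_measure_integral => A mA _; exact: gnu.
- exact/measurable_EFinP.
- apply: (@bmf_integrable _ _ _ _ (h \o g)); split; first exact: measurableT_comp.
  by exists C => x; exact: hC.
Qed.

Variable m : {measure set T -> \bar R}.

(** Moves integrals over different sets A to one measure, on U, so that they can be subtracted under
    a single integral sign. *)
Lemma restr_int_sub A U (mA : measurable A) (mU : measurable U)
    (Aoo : (m A < +oo)%E) (Uoo : (m U < +oo)%E) h : A `<=` U -> bmf h ->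
  \int[mfrestr mA Aoo]_x h x = \int[mfrestr mU Uoo]_x (\1_A x * h x).
Proof.
move=> AU bh; have [mh [C hC]] := bh.
have CA : \int[mfrestr mA Aoo]_x h x = \int[mfrestr mA Aoo]_x (\1_A x * h x).
  apply/eqP; rewrite -subr_eq0 -normr_le0 -bmf_intB//; last by apply: bmfM => //; exact: bmf_indic.
  have b1 : bmf (fun x => h x - \1_A x * h x) by apply: bmfB => //; apply: bmfM => //; exact: bmf_indic.
  apply: le_trans (bmf_int_norm _ b1) _.
  apply: le_trans (_ : _ <= \int[mfrestr mA Aoo]_x (C * \1_(~` A) x)) _.
    apply: bmf_int_le; [exact: bmf_norm|by apply: bmfZ; apply: bmf_indic; exact: measurableC|] => x.
    rewrite !indicE in_setC; case: (x \in A) => /=; first by rewrite mul1r subrr normr0 mulr0.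
    by rewrite mul0r subr0 mulr1.
  rewrite bmf_intZ; last by apply: bmf_indic; exact: measurableC.
  rewrite bmf_int_indic; last exact: measurableC.
  have e0 : mfrestr mA Aoo (~` A) = 0%E by rewrite /mfrestr /= /mrestr setICl measure0.
  by rewrite (_ : fine _ = 0) ?mulr0//; rewrite -[RHS]/(fine 0%E) -e0.
rewrite CA /Rintegral; congr fine.
have e (k : {finite_measure set T -> \bar R}) :
    (\int[k]_x (\1_A x * h x)%:E = \int[k]_(x in A) (h x)%:E)%E.
  rewrite [RHS]integral_mkcond; apply: eq_integral => x _.
  by rewrite patchE indicE; case: ifP => _; rewrite ?mul1r ?mul0r.
rewrite !e; apply: eq_measure_integral => B mB BA.
change (m (B `&` A) = m (B `&` U)).
by rewrite !setIidl//; exact: subset_trans AU.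
Qed.

(* Scheffe's trick: since m A = m B, the symmetric difference is controlled by A \ B. *)
Lemma restr_int_diff A B (mA : measurable A) (mB : measurable B)
    (Aoo : (m A < +oo)%E) (Boo : (m B < +oo)%E) h C : m A = m B ->
  measurable_fun setT h -> (forall x, `|h x| <= C) ->
  `|\int[mfrestr mB Boo]_x h x - \int[mfrestr mA Aoo]_x h x| <=
  2 * C * \int[mfrestr mA Aoo]_x (1 - \1_B x).
Proof.
move=> AB mh hC; have bh : bmf h by split => //; exists C.
have bA := bmf_indic mA; have bB := bmf_indic mB.
have mU : measurable (A `|` B) by exact: measurableU.
have Uoo : (m (A `|` B) < +oo)%E.
  by apply: le_lt_trans (measureU2 _ _ _) _ => //; rewrite lte_add_pinfty.
have b1 : bmf (fun x => 1 - \1_B x : R) by apply: bmfB => //; exact: bmf_cst.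
rewrite (@restr_int_sub B _ mB mU Boo Uoo)// ?(@restr_int_sub A _ mA mU Aoo Uoo _ _ bh) ?(@restr_int_sub A _ mA mU Aoo Uoo _ _ b1);
  do ?[by move=> x; left|by move=> x; right].
rewrite -bmf_intB; [|exact: bmfM|exact: bmfM].
have bd : bmf (fun x => \1_B x * h x - \1_A x * h x) by apply: bmfB; exact: bmfM.
apply: le_trans (bmf_int_norm _ bd) _.
set k := mfrestr mU Uoo.
(* Equal measures make this integral vanish, and |1_B - 1_A| = (1_B - 1_A) + 2 * 1_A (1 - 1_B), so
   only the part of A outside B remains. *)
have e0 : \int[k]_x (\1_B x - \1_A x) = 0.
  rewrite bmf_intB// !bmf_int_indic//.
  change (fine (m (B `&` (A `|` B))) - fine (m (A `&` (A `|` B))) = 0).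
  by rewrite setIidl; [rewrite setIidl; [rewrite AB subrr|move=> x; left]|move=> x; right].
have bt : bmf (fun x => \1_B x - \1_A x + 2 * (\1_A x * (1 - \1_B x)) : R).
  by apply: bmfD; [exact: bmfB|apply: bmfZ; exact: bmfM].
have -> : 2 * C * \int[k]_x (\1_A x * (1 - \1_B x)) =
    \int[k]_x (C * (\1_B x - \1_A x + 2 * (\1_A x * (1 - \1_B x)))).
  rewrite bmf_intZ// bmf_intD; [|exact: bmfB|by apply: bmfZ; exact: bmfM].
  by rewrite e0 add0r bmf_intZ ?mulrA 1?[2 * C]mulrC//; exact: bmfM.
apply: bmf_int_le; [exact: bmf_norm|exact: bmfZ|] => x.
have C0 : 0 <= C by exact: le_trans (hC x).
have hx := hC x; rewrite -mulrBl normrM mulrC ler_pM//.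
by rewrite !indicE; case: (x \in B); case: (x \in A); rewrite /= ?subrr ?subr0 ?sub0r ?normrN ?normr0 ?normr1; lra.
Qed.

Lemma restr_int_cvg0 A (mA : measurable A) (Aoo : (m A < +oo)%E) (h : nat -> T -> R) C :
  (forall j, measurable_fun setT (h j)) -> (forall j x, `|h j x| <= C) ->
  (forall x, A x -> h ^~ x @ \oo --> 0) ->
  \int[mfrestr mA Aoo]_x (h j x) @[j --> \oo] --> 0.
Proof.
move=> mh hC h0.
have bA := bmf_indic mA.
have bh j : bmf (h j) by split => //; exists C.
have -> : (fun j => \int[mfrestr mA Aoo]_x (h j x)) = (fun j => \int[mfrestr mA Aoo]_x (\1_A x * h j x)).
  by apply/funext => j; exact: restr_int_sub.
have [|||_] := @bounded_convergence _ T R (mfrestr mA Aoo) (fun j x => \1_A x * h j x) (fun=> 0) C.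
- by move=> j; have [] := bmfM bA (bh j).
- move=> j x; rewrite normrM indicE; case: (_ \in _); rewrite ?normr1 ?mul1r// normr0 mul0r.
  exact: le_trans (hC j x).
- move=> x; have [Ax|nAx] := pselect (A x).
    rewrite (_ : (fun j => _) = h ^~ x); first exact: h0.
    by apply/funext => j; rewrite indicE mem_set// mul1r.
  rewrite (_ : (fun j => _) = (fun=> 0)); first exact: cvg_cst.
  by apply/funext => j; rewrite indicE memNset// mul0r.
by rewrite bmf_int_cst mul0r.
Qed.

End restricted_measure.

(** * Measurable families of matrices and joint measurability *)

Section measurable_families.
Context d (E : measurableType d) (R : realType) (n : nat).
Implicit Types r s : E -> SL n R.

Definition mSL r := forall i j, measurable_fun setT (fun z => r z i j : R).

Lemma mSL_cst g : mSL (fun=> g).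
Proof. by move=> i j; exact: measurable_cst. Qed.

Lemma mSL_mul r s : mSL r -> mSL s -> mSL (fun z => r z * s z)%g.
Proof.
move=> mr ms i j; rewrite (_ : (fun z => _) = fun z => \sum_k r z i k * s z k j); last first.
  by apply/funext => z; rewrite SL_mxM mxE.
by apply: measurable_sum => k; exact: measurable_funM.
Qed.

Lemma measurable_det m (A : E -> 'M[R]_m) :
  (forall i j, measurable_fun setT (fun z => A z i j)) -> measurable_fun setT (fun z => \det (A z)).
Proof.
move=> mA; apply: measurable_sum => s; apply: measurable_funM; first exact: measurable_cst.
by apply: measurable_prod => i _; exact: mA.
Qed.

Lemma mSL_inv r : mSL r -> mSL (fun z => (r z)^-1%g).
Proof.
move=> mr i j.
rewrite (_ : (fun z => _) = fun z => (-1) ^+ (j + i) * \det (row' j (col' i (SL_mx (r z))))); last first.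
  by apply/funext => z; rewrite /= mxE.
apply: measurable_funM; first exact: measurable_cst.
apply: measurable_det => k l; rewrite (_ : (fun z => _) = fun z => r z (lift j k) (lift i l)).
  exact: mr.
by apply/funext => z; rewrite !mxE.
Qed.

Lemma measurable_dist1 r : mSL r -> measurable_fun setT (fun z => dist1 (r z)).
Proof.
have key s : mSL s -> measurable_fun setT (fun z => l1 (SL_mx (s z) - 1%:M)).
  move=> ms; apply: measurable_sum => i; apply: measurable_sum => j.
  apply: measurableT_comp; first exact: normr_measurable.
  rewrite (_ : (fun z => _) = fun z => s z i j - (1%:M : 'M[R]_n) i j).
    by apply: measurable_funB; [exact: ms|exact: measurable_cst].
  by apply/funext => z; rewrite !mxE.
move=> mr; apply: measurable_funD; apply: key => //; exact: mSL_inv.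
Qed.

End measurable_families.

Section jointly_measurable.
Context d1 d2 (T : measurableType d1) (E : measurableType d2) (R : realType).

Definition jbmf (h : T -> E -> R) := bmf (fun u : T * E => h u.1 u.2).

Lemma jbmf_sum (I : Type) (s : seq I) (h : I -> T -> E -> R) : (forall i, jbmf (h i)) ->
  jbmf (fun x z => \sum_(i <- s) h i x z).
Proof. by move=> bh; apply: bmf_sum. Qed.

Lemma jbmfB (h k : T -> E -> R) : jbmf h -> jbmf k -> jbmf (fun x z => h x z - k x z).
Proof. exact: bmfB. Qed.

Lemma jbmfZ c (h : T -> E -> R) : jbmf h -> jbmf (fun x z => c * h x z).
Proof. exact: bmfZ. Qed.

Lemma jbmf_norm (h : T -> E -> R) : jbmf h -> jbmf (fun x z => `|h x z|).
Proof. exact: bmf_norm. Qed.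

Lemma jbmf_comp (g : T -> T) (h : T -> E -> R) : measurable_fun setT g -> jbmf h -> jbmf (fun x z => h (g x) z).
Proof.
move=> mg [mh [C hC]]; split; last by exists C => u; exact: (hC (g u.1, u.2)).
have m2 : measurable_fun setT (fun u : T * E => (g u.1, u.2)).
  apply: measurable_fun_pair; last exact: measurable_snd.
  by apply: measurableT_comp => //; exact: measurable_fst.
exact: (measurableT_comp mh m2).
Qed.

Lemma jbmf_section1 (h : T -> E -> R) x : jbmf h -> bmf (h x).
Proof. by move=> /bmf_section1/(_ x). Qed.

Lemma jbmf_section2 (h : T -> E -> R) z : jbmf h -> bmf (h ^~ z).
Proof. by move=> /bmf_section2/(_ z). Qed.

Variables (m1 : {finite_measure set T -> \bar R}) (m2 : {finite_measure set E -> \bar R}).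

Lemma jbmf_int1 (h : T -> E -> R) : jbmf h -> bmf (fun x => \int[m2]_z h x z).
Proof. by move=> /bmf_fubini1; apply. Qed.

Lemma jbmf_int2 (h : T -> E -> R) : jbmf h -> bmf (fun z => \int[m1]_x h x z).
Proof. by move=> /bmf_fubini2; apply. Qed.

Lemma jbmf_fubini (h : T -> E -> R) : jbmf h ->
  \int[m1]_x (\int[m2]_z h x z) = \int[m2]_z (\int[m1]_x h x z).
Proof. by move=> /bmf_fubini; apply. Qed.

(* Pointwise limit of functions that are constant in z on the pieces where a
   fixed member of a dense sequence is close to r z. *)
Lemma jbmf_SL n (psi : SL n R -> T -> R) (r : E -> SL n R) C :
  (forall g, measurable_fun setT (psi g)) -> (forall g x, `|psi g x| <= C) ->
  (forall (g : SL n R) x e, 0 < e -> exists2 d, 0 < d & forall s : SL n R,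
     dist1 (g^-1 * s)%g < d -> `|psi s x - psi g x| <= e) ->
  mSL r -> jbmf (fun x z => psi (r z) x).
Proof.
move=> mpsi psiC cpsi mr; split; last by exists C.
have [q qd] := dense_SL_seq R n.
pose P k j : set E := [set z | dist1 ((r z)^-1 * q j)%g < k.+1%:R^-1].
have mP k j : measurable (P k j).
  have m1' : measurable_fun setT (fun z => dist1 ((r z)^-1 * q j)%g).
    by apply: measurable_dist1; apply: mSL_mul; [exact: mSL_inv|exact: mSL_cst].
  have := measurable_fun_ltr m1' (@measurable_cst _ _ _ _ setT (k.+1%:R^-1 : R)).
  by move=> /(_ measurableT [set true]); rewrite setTI; apply.
have mD k j : measurable (seqDU (P k) j).
  by apply: measurableD => //; exact: bigsetU_measurable.
have Pex k z : exists j, seqDU (P k) j z.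
  have [j zj] : exists j, P k j z by exact: qd.
  have : (\bigcup_j P k j) z by exists j.
  by rewrite seqDU_bigcup_eq => -[i _]; exists i.
pose h k m (u : T * E) : R := \sum_(j < m) \1_(seqDU (P k) j) u.2 * psi (q j) u.1.
have hE k u j m : seqDU (P k) j u.2 -> (j < m)%N -> h k m u = psi (q j) u.1.
  move=> uj jm; rewrite /h (bigD1 (Ordinal jm))//= indicE mem_set// mul1r big1 ?addr0// => i ij.
  rewrite indicE memNset ?mul0r// => ui; move/eqP: ij; apply; apply: val_inj => /=.
  have := @trivIset_seqDU _ (P k) i j I I; apply; by exists u.2.
have mh k m : measurable_fun setT (h k m).
  apply: measurable_sum => j.
  have m1' : measurable_fun setT (\1_(seqDU (P k) j) : E -> R) by exact: measurable_indic.
  have m2' : measurable_fun setT (snd : T * E -> E) by exact: measurable_snd.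
  have m3' : measurable_fun setT (fst : T * E -> T) by exact: measurable_fst.
  exact: measurable_funM (measurableT_comp m1' m2') (measurableT_comp (mpsi (q j)) m3').
(* [H k] freezes r at the chosen dense element on each piece; at a given point the partial sums
   [h k m] are eventually equal to it. *)
pose H k u : R := psi (q (projT1 (cid (Pex k u.2)))) u.1.
have mH k : measurable_fun setT (H k).
  apply: (measurable_fun_cvg (mh k)) => u _; apply: cvg_near_cst.
  rewrite /H; case: cid => j uj /=; exists j.+1 => // m /= jm; exact: hE.
apply: (measurable_fun_cvg mH) => u _; apply/cvgrPdist_le => e e0.
have [d d0 hd] := cpsi (r u.2) u.1 e e0.
have [k0 hk0] : exists k0 : nat, d^-1 < k0%:R.
  by exists (Num.bound d^-1); apply: archi_boundP; rewrite invr_ge0 ltW.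
exists k0 => // k /= kk; rewrite /H; case: cid => j [uj _] /=; rewrite distrC; apply: hd.
apply: lt_trans uj _; rewrite -[ltRHS]invrK ltf_pV2 ?posrE ?invr_gt0 ?ltr0n//.
by apply: lt_le_trans hk0 _; rewrite ler_nat; exact: leq_trans kk _.
Qed.

End jointly_measurable.

(** * Averages over expanding translates *)

Section row_action.
Variables (R : realType) (n : nat).
Local Notation V := 'rV[R]_n.+1.
Implicit Types (z w : V) (g h : SL n.+1 R).

Lemma dist1_small1 (e : R) : 0 < e -> exists2 d, 0 < d & forall g,
  dist1 g < d -> l1 (SL_mx g - 1%:M) < e /\ l1 (SL_mx g^-1%g - 1%:M) < e.
Proof.
move=> e0; exists e => // g; rewrite /dist1 => ge.
have h1 := l1_ge0 (SL_mx g - 1%:M); have h2 := l1_ge0 (SL_mx g^-1%g - 1%:M).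
by split; apply: le_lt_trans ge; rewrite ?lerDl ?lerDr.
Qed.

Lemma mulmx_near (U : set V) z : nbhs z U -> exists2 d, 0 < d &
  forall h, dist1 h < d -> U (z *m h).
Proof.
move=> /nbhs_ballP[e /= e0 eU]; have l0 := l1_ge0 z.
have [d d0 hd] := dist1_small1 (e0 : 0 < e).
exists (e / (l1 z + 1)); first by rewrite divr_gt0// ltr_wpDl.
move=> h hh; apply: eU; split => // i j; rewrite /ball /= ord1.
have -> : z 0 j - (z *m h) 0 j = - (z *m (SL_mx h - 1%:M)) 0 j.
  by rewrite mulmxBr mulmx1 !mxE opprB.
rewrite normrN (le_lt_trans (ler_l1 _ _ _))// (le_lt_trans (l1M _ _))//.
have hl : l1 (SL_mx h - 1%:M) < e / (l1 z + 1).
  by apply: le_lt_trans hh; rewrite lerDl l1_ge0.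
apply: le_lt_trans (_ : _ <= (l1 z + 1) * l1 (SL_mx h - 1%:M)) _.
  by rewrite ler_wpM2r// ?l1_ge0// lerDl.
by rewrite mulrC -ltr_pdivlMr// ltr_wpDl.
Qed.

Lemma mulmx_measurable (g : 'M[R]_n.+1) :
  measurable_fun setT ((fun z : V => z *m g) : borel V -> borel V).
Proof.
apply: (@borel_continuous_map V V) => z U /nbhs_ballP[e /= e0 eU].
have l0 : 0 <= l1 g by exact: l1_ge0.
suff : nbhs z ((fun x : V => x *m g) @^-1` U) by [].
apply/nbhs_ballP; exists (e / ((1 * n.+1)%:R * l1 g + 1)) => /=.
  by rewrite divr_gt0// ltr_wpDl// mulr_ge0.
move=> w [_ zw]; apply: eU; split => // i j; rewrite /ball /=.
have -> : (z *m g) i j - (w *m g) i j = ((z - w) *m g) i j by rewrite mulmxBl !mxE.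
apply: le_lt_trans (ler_l1 _ _ _) _; apply: le_lt_trans (l1M _ _) _.
set d := e / _ in zw.
have d0 : 0 < d by rewrite divr_gt0// ltr_wpDl// mulr_ge0.
have de : d * ((1 * n.+1)%:R * l1 g + 1) = e by rewrite divfK// gt_eqF// ltr_wpDl// mulr_ge0.
clearbody d.
apply: le_lt_trans (_ : _ <= ((1 * n.+1)%:R * d) * l1 g) _.
  rewrite ler_wpM2r// l1_le// => k l; rewrite !mxE ltW//; exact: zw.
by rewrite -de mulrDr mulr1 mulrA [d * _]mulrC ltrDl.
Qed.

End row_action.

Section rotation_near.
Variables (R : realType) (n : nat) (K : sphere R n -> SL n.+1 R) (v0 : sphere R n).
Hypothesis K_e1 : forall v, sphere_val v *m K v = delta_mx 0 0.
Hypothesis K_smooth : forall v, v != v0 -> smooth_at (fun w => SL_mx (K w)) v.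
Local Notation V := 'rV[R]_n.+1.
Local Notation VB := (borel V).
Local Notation kap := (kap K).
Local Notation Omega := (Omega v0).
Implicit Types (z w : V) (g h : SL n.+1 R).

Lemma kap_near z (e : R) : Omega z -> 0 < e ->
  nbhs z [set w | l1 (SL_mx (kap w) - SL_mx (kap z)) < e].
Proof.
move=> Oz e0; have [d d0 hd] := @l1_lt R n.+1 n.+1 e e0.
have : nbhs z [set w | forall i j, `|kap w i j - kap z i j| < d].
  apply: (@filter_forall V _ (fun i w => forall j, `|kap w i j - kap z i j| < d) _ (nbhs_filter z)) => i.
  apply: (@filter_forall V _ (fun j w => `|kap w i j - kap z i j| < d) _ (nbhs_filter z)) => j.
  have /cvgrPdist_lt/(_ d d0) := @kap_continuous _ _ K v0 K_smooth z i j Oz.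
  by apply: (@filterS _ _ (nbhs_filter z)) => w; rewrite distrC.
by apply: (@filterS _ _ (nbhs_filter z)) => w zw; apply: hd => i j; rewrite !mxE; exact: zw.
Qed.

(** The inverse cocycle is (kap z)^-1 times g^-1 kap w with w = z g^-1, and g^-1 kap w tends to kap
    z as g tends to 1, by continuity of kap at z. *)
Lemma kap_cocycle_near z (e : R) : Omega z -> 0 < e -> exists2 d, 0 < d & forall g, dist1 g < d ->
  Omega (z *m SL_mx g^-1%g) /\ dist1 ((kap (z *m SL_mx g^-1%g))^-1 * g * kap z)%g < e.
Proof.
move=> Oz e0; have [d1 d10 hd1] := dist1_near (kap z) e0.
have lz := l1_ge0 (SL_mx (kap z)).
have [d2 d20 hd2] : exists2 d, 0 < d & forall h, dist1 h < d ->
    Omega (z *m h) /\ l1 (SL_mx (kap (z *m h)) - SL_mx (kap z)) < Num.min 1 (d1 / 2).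
  have : nbhs z (Omega `&` [set w | l1 (SL_mx (kap w) - SL_mx (kap z)) < Num.min 1 (d1 / 2)]).
    apply: (@filterI _ _ (nbhs_filter z)); first by apply: open_nbhs_nbhs; split => //; exact: Omega_open.
    by apply: kap_near; rewrite ?lt_min ?ltr01 ?divr_gt0.
  by move=> /mulmx_near[d d0 hd]; exists d.
pose d3 := d1 / 2 / (l1 (SL_mx (kap z)) + 1).
have d30 : 0 < d3 by rewrite !divr_gt0// ltr_wpDl.
exists (Num.min d2 d3); first by rewrite lt_min d20.
move=> g; rewrite lt_min => /andP[gd2 gd3].
have [Ow] := hd2 g^-1%g (eq_ind_r (fun y => y < d2) gd2 (dist1V g)).
set w := z *m _ in Ow *; rewrite lt_min => /andP[w1 wd]; split => //.
rewrite -dist1V !invgM invgK !mulgA -mulgA; apply: hd1.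
have -> : SL_mx (g^-1 * kap w)%g - SL_mx (kap z) =
    (SL_mx g^-1%g - 1%:M) *m kap w + (SL_mx (kap w) - SL_mx (kap z)).
  by rewrite mulmxBl mul1mx addrA subrK.
apply: le_lt_trans (l1D _ _) _; rewrite [ltRHS]splitr ltr_leD//; last exact: ltW.
apply: le_lt_trans (l1M _ _) _.
have lw : l1 (SL_mx (kap w)) <= l1 (SL_mx (kap z)) + 1.
  have -> : SL_mx (kap w) = SL_mx (kap z) + (SL_mx (kap w) - SL_mx (kap z)) by rewrite addrC subrK.
  by apply: le_trans (l1D _ _) _; rewrite lerD2l ltW.
apply: le_lt_trans (_ : _ <= l1 (SL_mx g^-1%g - 1%:M) * (l1 (SL_mx (kap z)) + 1)) _.
  by rewrite ler_wpM2l// l1_ge0.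
rewrite -ltr_pdivlMr ?ltr_wpDl//; apply: le_lt_trans gd3.
by rewrite /dist1 lerDr l1_ge0.
Qed.

End rotation_near.

Section expanding_average.
Variables (R : realType) (n : nat) (K : sphere R n -> SL n.+1 R) (v0 : sphere R n).
Hypothesis K_e1 : forall v, sphere_val v *m K v = delta_mx 0 0.
Hypothesis K_smooth : forall v, v != v0 -> smooth_at (fun w => SL_mx (K w)) v.
Local Notation V := 'rV[R]_n.+1.
Local Notation VB := (borel V).
Local Notation X := (SLQ_quot n.+1 R).
Local Notation XB := (borel (SLQ_quot n.+1 R)).
Local Notation kap := (kap K).
Local Notation Omega := (Omega v0).
Local Notation SLR := (SL n.+1 R).
Implicit Types (z w : V) (g h : SLR) (x y : X) (t : R).
Variable mu : probability XB R.
Variables (C L : R) (N : nat) (phi : X -> R).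
Hypothesis phi_test : test_fun C L N phi.
Variable A : set V.
Hypotheses (A_open : open A) (A_Omega : A `<=` Omega).
Hypothesis mA : measurable (A : set VB).
Hypothesis Aoo : (@ell R n A < +oo)%E.
Local Notation nuA := (@mfrestr _ VB R A (@ell R n) mA Aoo).

Lemma phi_measurable : measurable_fun setT (phi : XB -> R).
Proof. by apply: borel_continuous_measurable; exact: test_fun_continuous phi_test. Qed.

Lemma phi_bound x : `|phi x| <= C. Proof. by case: phi_test. Qed.

Lemma phi_lip x g : `|phi (real_act g x) - phi x| <= L * dist1 g.
Proof. by case: phi_test. Qed.

Lemma L_ge0 : 0 <= L. Proof. by case: phi_test. Qed.

Lemma C_ge0 : 0 <= C. Proof. exact: le_trans (phi_bound point). Qed.

Lemma phi_diff x y : `|phi x - phi y| <= 2 * C.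
Proof. by rewrite (le_trans (ler_normB _ _))// mulr2n mulrDl !mul1r lerD// phi_bound. Qed.

Lemma phi_jbmf (r : VB -> SLR) : mSL r ->
  jbmf (fun (x : XB) (z : VB) => phi (real_act (r z) x)).
Proof.
apply: (@jbmf_SL _ _ XB VB R n.+1 (fun g (x : XB) => phi (real_act g x)) r C).
- by move=> g; exact: (measurableT_comp phi_measurable (@real_act_measurable R n.+1 g)).
- by move=> g x; exact: phi_bound.
- move=> g x e e0; exists (e / (L + 1)); first by rewrite divr_gt0// ltr_wpDl// L_ge0.
  move=> s hs; have -> : real_act s x = real_act (g^-1 * s)%g (real_act g x).
    by rewrite -real_actM mulVKg.
  apply: le_trans (phi_lip _ _) _.
  apply: le_trans (_ : _ <= (L + 1) * dist1 (g^-1 * s)%g) _.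
    by rewrite ler_wpM2r ?dist1_ge0// lerDl.
  by rewrite mulrC -ler_pdivlMr ?ltW// ltr_wpDl// L_ge0.
Qed.

Lemma mSL_kap_Phi t : mSL (fun z : VB => kap z * Phi n.+1 t)%g.
Proof.
apply: mSL_mul; last exact: mSL_cst.
by move=> i j; exact: (kap_measurable K_smooth).
Qed.

Definition avgF t x : R := \int[nuA]_z phi (real_act (kap z * Phi n.+1 t)%g x).

Lemma avg_section (r : VB -> SLR) x : mSL r -> bmf (fun z : VB => phi (real_act (r z) x)).
Proof. by move=> /phi_jbmf/jbmf_section1; apply. Qed.

Lemma bmf_avgF t : bmf (avgF t : XB -> R).
Proof.
exact: (@jbmf_int1 _ _ XB VB R mu nuA _ (phi_jbmf (mSL_kap_Phi t))).
Qed.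

Lemma avgF_bound t x : `|avgF t x| <= C * fine (ell A).
Proof.
have -> : ell A = nuA setT by rewrite -[RHS]/(ell (setT `&` A)) setTI.
apply: bmf_int_bound; last by move=> z; exact: phi_bound.
exact: avg_section (mSL_kap_Phi t).
Qed.

Definition cocycle g z : SLR := ((kap (z *m SL_mx g^-1%g))^-1 * g * kap z)%g.

Definition good g : set VB := A `&` [set z | Omega (z *m SL_mx g^-1%g)].

(** For z in A the Lipschitz bound is used where z g^-1 stays in [Omega], the trivial bound 2C
    elsewhere. The cap 2C provides the majorant for dominated convergence in [defect_cvg]. *)
Definition slack g z : R :=
  \1_(good g) z * Num.min (2 * C) (L * dist1 (cocycle g z)) + \1_(~` good g) z * (2 * C).

Lemma measurable_mulmx_preimage (g : 'M[R]_n.+1) (B : set VB) : measurable B ->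
  measurable ([set z | B (z *m g)] : set VB).
Proof.
move=> mB; have := @mulmx_measurable R n g measurableT B mB.
by rewrite setTI.
Qed.

Lemma good_measurable g : measurable (good g).
Proof.
apply: measurableI => //; apply: measurable_mulmx_preimage.
by apply: borel_open_measurable; exact: Omega_open.
Qed.

Lemma slack_measurable g : measurable_fun setT (slack g : VB -> R).
Proof.
have mg := good_measurable g.
have mk : mSL (fun z : VB => kap z) by move=> i j; exact: (kap_measurable K_smooth).
have mkg : mSL (fun z : VB => kap (z *m SL_mx g^-1%g)).
  move=> i j; exact: (measurableT_comp (kap_measurable K_smooth i j) (@mulmx_measurable R n (SL_mx g^-1%g))).
have mc : mSL (cocycle g : VB -> SLR).
  by apply: mSL_mul => //; apply: mSL_mul; [exact: mSL_inv|exact: mSL_cst].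
apply: measurable_funD; apply: measurable_funM.
- exact: measurable_indic.
- by apply: measurable_minr => //; apply: measurable_funM => //; exact: measurable_dist1.
- by apply: measurable_indic; exact: measurableC.
- exact: measurable_cst.
Qed.

Lemma slack_ge0 g z : 0 <= slack g z <= 2 * C.
Proof.
have c0 : 0 <= 2 * C by rewrite mulr_ge0// C_ge0.
have l0 : 0 <= L * dist1 (cocycle g z) by rewrite mulr_ge0 ?L_ge0// dist1_ge0.
rewrite /slack !indicE in_setC; case: (z \in _); rewrite /= !(mul1r, mul0r, addr0, add0r).
  by rewrite le_min c0 l0 ge_min lexx.
by rewrite c0 lexx.
Qed.

Lemma translate_slack g t x z : 0 <= t ->
  `|phi (real_act (g * (kap z * Phi n.+1 t))%g x) -
    phi (real_act (kap (z *m SL_mx g^-1%g) * Phi n.+1 t)%g x)| <= slack g z.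
Proof.
move=> t0; have [[Az Ow]|ng] := pselect (good g z); last first.
  rewrite /slack !indicE in_setC memNset//= mul0r add0r mul1r; exact: phi_diff.
rewrite /slack !indicE in_setC mem_set//= mul0r addr0 mul1r le_min phi_diff /=.
set w := z *m _ in Ow *.
have z0 := Omega_neq0 (A_Omega Az); have w0 := Omega_neq0 Ow.
have wz : w *m g = z by rewrite /w -mulmxA SL_mulV_mx mulmx1.
have zw : z *m SL_mx g^-1%g = w by [].
have p1 : par (cocycle g z) := par_kap K_e1 w0 z0 wz.
have p2 : par (cocycle g z)^-1%g.
  rewrite /cocycle !invgM invgK mulgA; exact: (par_kap K_e1 z0 w0 zw).
(* [Phi t] is moved to the left of the cocycle; conjugating a parabolic element by it does not
   increase [dist1] when t >= 0, which removes t from the bound. *)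
have -> : (g * (kap z * Phi n.+1 t) = kap w * Phi n.+1 t * ((Phi n.+1 t)^-1 * cocycle g z * Phi n.+1 t))%g.
  by rewrite /cocycle -/w !mulgA mulgK mulgV mul1g.
rewrite real_actM; apply: le_trans (phi_lip _ _) _.
by rewrite ler_wpM2l ?L_ge0// dist1_Phi_conj.
Qed.

Definition defect g : R :=
  \int[nuA]_z slack g z + 2 * C * \int[nuA]_z (1 - \1_([set z | A (z *m g)]) z).

(* Substituting z := z g^-1 and writing g * kap z = kap (z g^-1) * cocycle g z
   leaves the contracted cocycle and the symmetric difference of A and A g^-1. *)
Lemma avgF_translate g t x : 0 <= t -> `|avgF t (real_act g x) - avgF t x| <= defect g.
Proof.
move=> t0; pose A' : set VB := [set z | A (z *m g)].
have mA' : measurable A' by exact: measurable_mulmx_preimage.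
have eA : @ell R n A = ell A' by exact/esym/outer_mulmx.
have A'oo : (ell A' < +oo)%E by rewrite -eA.
pose h z := phi (real_act (kap z * Phi n.+1 t)%g x).
have bh : bmf (h : VB -> R) by exact: avg_section (mSL_kap_Phi t).
have bhg : bmf (fun z : VB => h (z *m SL_mx g^-1%g)).
  exact: (bmf_comp bh (@mulmx_measurable R n (SL_mx g^-1%g))).
have bg : bmf (fun z : VB => phi (real_act (g * (kap z * Phi n.+1 t))%g x)).
  by apply: avg_section; apply: mSL_mul; [exact: mSL_cst|exact: mSL_kap_Phi].
have bs : bmf (slack g : VB -> R).
  split; first exact: slack_measurable.
  by exists (2 * C) => z; have /andP[s0 s1] := slack_ge0 g z; rewrite ger0_norm.
have cv : \int[nuA]_z h (z *m SL_mx g^-1%g) = \int[@mfrestr _ VB R A' (@ell R n) mA' A'oo]_z h z.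
  apply: (bmf_int_pushforward (@mulmx_measurable R n (SL_mx g^-1%g))) => //.
  move=> B mB; change (ell ([set z | B (z *m SL_mx g^-1%g)] `&` A) = ell (B `&` A')).
  apply: etrans (outer_mulmx g^-1%g (B `&` A')); congr lebesgue_outer.
  by apply/seteqP; split => z [Bz Az]; split => //; move: Az; rewrite /A' /= -mulmxA SL_mulV_mx mulmx1.
have -> : avgF t (real_act g x) = \int[nuA]_z phi (real_act (g * (kap z * Phi n.+1 t))%g x).
  by rewrite /avgF; congr Rintegral; apply/funext => z; rewrite -real_actM.
(* The intermediate integral is that of h (z g^-1): [slack] bounds the first difference, and a
   change of variables turns the second into a comparison of A with A g^-1. *)
rewrite -[X in `|X - _|](subrK (\int[nuA]_z h (z *m SL_mx g^-1%g))) -addrA.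
apply: le_trans (ler_normD _ _) _; apply: lerD; last first.
  rewrite cv; apply: restr_int_diff => //; first by case: bh.
  by move=> z; exact: phi_bound.
rewrite -bmf_intB//; apply: le_trans (bmf_int_norm _ (bmfB bg bhg)) _.
by apply: bmf_int_le => //; [exact/bmf_norm/bmfB|move=> z; exact: translate_slack].
Qed.

Lemma defect_cvg (g : nat -> SLR) : dist1 (g j) @[j --> \oo] --> 0 -> defect (g j) @[j --> \oo] --> 0.
Proof.
move=> g0.
have near (d : R) : 0 < d -> \forall j \near \oo, dist1 (g j) < d.
  move=> d0; have /cvgrPdist_lt/(_ d d0) := g0.
  by apply: filterS => j; rewrite sub0r normrN ger0_norm// dist1_ge0.
rewrite -[X in _ --> X](addr0 0) -[X in _ --> _ + X](mulr0 (2 * C)).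
apply: cvgD; last (apply: cvgM; first exact: cvg_cst).
- apply: (@restr_int_cvg0 _ _ _ _ _ mA Aoo _ (2 * C)).
  + by move=> j; exact: slack_measurable.
  + by move=> j z; have /andP[s0 s1] := slack_ge0 (g j) z; rewrite ger0_norm.
  + move=> z Az; apply/cvgrPdist_le => e e0.
    have [d d0 hd] := kap_cocycle_near K_smooth (A_Omega Az) (divr_gt0 e0 (ltr_wpDl L_ge0 ltr01)).
    apply: filterS (near d d0) => j /hd[Oj dj].
    have /andP[s0 _] := slack_ge0 (g j) z; rewrite sub0r normrN ger0_norm//.
    rewrite /slack !indicE in_setC mem_set//= mul0r addr0 mul1r ge_min; apply/orP; right.
    apply: le_trans (_ : _ <= (L + 1) * dist1 (cocycle (g j) z)) _.
      by rewrite ler_wpM2r ?dist1_ge0// lerDl.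
    by rewrite mulrC -ler_pdivlMr ?ltW// ltr_wpDl// L_ge0.
- apply: (@restr_int_cvg0 _ _ _ _ _ mA Aoo _ 1).
  + move=> j; apply: measurable_funB; first exact: measurable_cst.
    by apply: measurable_indic; exact: measurable_mulmx_preimage.
  + by move=> j z; rewrite indicE; case: (_ \in _); rewrite /= ?subrr ?subr0 ?normr0 ?normr1.
  + move=> z Az; have [d d0 hd] := mulmx_near (open_nbhs_nbhs (conj A_open Az)).
    apply: cvg_near_cst; apply: filterS (near d d0) => j /hd Aj.
    by rewrite indicE mem_set//= subrr.
Qed.

(** [defect g] contains neither t nor x, so its convergence to 0 as g tends to 1 gives an estimate
    uniform in both. The argument by contradiction passes to a sequence of g, as dominated
    convergence requires. *)
Lemma avgF_equicontinuous (e : R) : 0 < e -> exists2 d, 0 < d & forall g, dist1 g < d ->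
  forall t x, 0 <= t -> `|avgF t (real_act g x) - avgF t x| <= e.
Proof.
move=> e0.
suff [d d0 hd] : exists2 d, 0 < d & forall g, dist1 g < d -> defect g <= e.
  by exists d => // g /hd gd t x t0; exact: le_trans (avgF_translate g x t0) gd.
apply: contrapT => H.
have G j : exists g, dist1 g < j.+1%:R^-1 /\ e < defect g.
  apply: contrapT => Hj; apply: H; exists j.+1%:R^-1; first by rewrite invr_gt0.
  by move=> g gj; rewrite leNgt; apply/negP => eg; apply: Hj; exists g.
pose g j := projT1 (cid (G j)).
have gP j : dist1 (g j) < j.+1%:R^-1 /\ e < defect (g j) by exact: projT2 (cid (G j)).
have g0 : dist1 (g j) @[j --> \oo] --> 0.
  apply/cvgrPdist_lt => d d0; have /cvgrPdist_lt/(_ d d0) := @cvg_harmonic R.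
  apply: filterS => j; rewrite !sub0r !normrN !ger0_norm ?dist1_ge0// ?harmonic_ge0//.
  by apply: lt_trans; case: (gP j).
have /cvgrPdist_lt/(_ e e0)[j0 _ hj] := defect_cvg g0.
have := hj j0 (leqnn _); rewrite /= sub0r normrN ltNge; move/negP; apply.
by apply: le_trans (ler_norm _); apply: ltW; case: (gP j0).
Qed.

End expanding_average.

(** * Averages along the contracted unipotent orbit *)

Section horospherical_average.
Variables (R : realType) (n : nat) (K : sphere R n -> SL n.+1 R).
Hypothesis K_e1 : forall v, sphere_val v *m K v = delta_mx 0 0.
Local Notation V := 'rV[R]_n.+1.
Local Notation X := (SLQ_quot n.+1 R).
Local Notation XB := (borel (SLQ_quot n.+1 R)).
Local Notation kap := (kap K).
Local Notation SLR := (SL n.+1 R).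
Local Notation Ph := (Phi n.+1).
Implicit Types (z : V) (g h : SLR) (x y : X) (t : R).
Variable mu : probability XB R.
Hypothesis mu_inv : forall (g : SL n.+1 (adele R)) (B : set XB),
  measurable B -> mu (SLQ_rtrans g @^-1` B) = mu B.
Variables (C L : R) (N : nat) (phi : X -> R).
Hypothesis phi_test : test_fun C L N phi.
Variable b : 'I_n.+1.
Hypothesis b0 : b != ord0.

Let mphi := phi_measurable phi_test.
Let L0 : 0 <= L := L_ge0 phi_test.
Let C0 : 0 <= C := C_ge0 phi_test.

Lemma dq_elen (w : XB -> R) e : bmf w -> 0 <= e -> (forall i j s, dq mu w (elem i j s) <= e) ->
  forall m g, elen m g -> dq mu w g <= 4 ^+ m * e.
Proof.
move=> bw e0 we m g; elim=> [|{}m i j s {}g _ IH]; first by rewrite dq1 mulr_ge0.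
apply: le_trans (dqM mu_inv _ _ bw) _.
apply: le_trans (_ : _ <= 2 * e + 2 * (4 ^+ m * e)) _; first by rewrite lerD// ler_wpM2l.
have p1 : 1 <= (4 : R) ^+ m by rewrite exprn_ege1// ler1n.
by rewrite exprS -mulrA; nra.
Qed.

(* the step of the unipotent orbit that Phi t expands to unit length *)
Definition step t : R := expR (- (n.+1%:R * t)).

Definition unip t (k : nat) : SLR := elem ord0 b (k%:R * step t).

(** For fixed z, the average of the integrand of [avgF] over the M points obtained from x by
    [unip t k]. [H_near] compares [avgF] with its integral over z. *)
Definition theta t M z x : R :=
  (size (iota 0 M))%:R^-1 * \sum_(k <- iota 0 M) phi (real_act (unip t k * (kap z * Ph t))%g x).

Definition horo_coord z : V := \row_j - (z 0 j / z 0 0).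

(** Both kap z and [horo] map z to a multiple of e_1, so their quotient fixes the line of e_1. The
    choice c_j = -z_j / z_0 clears the other coordinates of z. *)
Lemma kap_horo z : z 0 0 != 0 -> exists p : SLR, par p /\ kap z = (horo (horo_coord z) * p)%g.
Proof.
move=> z0; have zn : z != 0 by apply: contra_neq z0 => ->; rewrite mxE.
exists ((horo (horo_coord z))^-1 * kap z)%g; split; last by rewrite mulVKg.
apply: (@par_row _ _ _ (norm2 z / z 0 0)).
have zh : z *m horo (horo_coord z) = z 0 0 *: delta_mx 0 0.
  by apply: mul_horo => j _; rewrite mxE mulrN mulrCA mulfV// mulr1 subrr.
have : z 0 0 *: ((delta_mx 0 0 : V) *m SL_mx ((horo (horo_coord z))^-1 * kap z)%g) = norm2 z *: delta_mx 0 0.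
  by rewrite scalemxAl -zh -mulmxA -SL_mxM mulVKg kap_row.
move=> /(congr1 (fun u => (z 0 0)^-1 *: u)); rewrite !scalerA mulVf// scale1r => ->.
by rewrite mulrC.
Qed.

Lemma lip_conj g : lip (L * (l1 (SL_mx g^-1%g) * l1 (SL_mx g))) (fun x : XB => phi (real_act g x)).
Proof.
move=> x r; have -> : real_act g (real_act r x) = real_act (g^-1 * r * g)%g (real_act g x).
  by rewrite -!real_actM mulgA mulVKg.
apply: le_trans (phi_lip phi_test _ _) _.
by rewrite -mulrA ler_wpM2l// dist1_conj.
Qed.

Lemma bmf_phi_act g : bmf (fun x : XB => phi (real_act g x)).
Proof. by apply: bmf_real_act; split; [exact: mphi|exists C; exact: phi_bound phi_test]. Qed.

Lemma bmf_theta t M z : bmf (theta t M z : XB -> R).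
Proof. by apply: bmfZ; apply: bmf_sum => k; exact: bmf_phi_act. Qed.

Lemma avg_dist (M : nat) (u v : nat -> R) e : 0 <= e -> (forall k, (k < M)%N -> `|u k - v k| <= e) ->
  `|(size (iota 0 M))%:R^-1 * (\sum_(k <- iota 0 M) u k) -
    (size (iota 0 M))%:R^-1 * (\sum_(k <- iota 0 M) v k)| <= e.
Proof.
move=> e0 uv; rewrite size_iota -mulrBr -sumrB normrM ger0_norm ?invr_ge0//.
have [->|M0] := posnP M; first by rewrite invr0 mul0r.
rewrite ler_pdivrMl ?ltr0n//; apply: le_trans (ler_norm_sum _ _ _) _.
rewrite big_seq; apply: le_trans (_ : _ <= \sum_(k <- iota 0 M | k \in iota 0 M) e) _.
  by apply: ler_sum => k; rewrite mem_iota => /andP[_]; exact: uv.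
rewrite -big_seq.
by rewrite big_const_seq count_predT size_iota iter_addr_0 mulr_natl.
Qed.

(* kap z = horo c * p with p parabolic; Phi t turns the unipotent step into a unit
   step to the right of horo c, and p into its block diagonal part up to o(1). *)
Lemma theta_horo z p (pp : par p) t M x : z 0 0 != 0 -> kap z = (horo (horo_coord z) * p)%g ->
  `|theta t M z x - horo_avg ord0 b M (fun y : XB => phi (real_act (par_diag pp) y))
      (real_act (horo (horo_coord z) * Ph t)%g x)|
  <= L * dist1 ((par_diag pp)^-1 * ((Ph t)^-1 * p * Ph t))%g.
Proof.
move=> z0 kz; apply: avg_dist; first by rewrite mulr_ge0// dist1_ge0.
move=> k _; set c := horo_coord z; set pt := ((Ph t)^-1 * p * Ph t)%g; set D := par_diag pp.
set y := real_act (elem ord0 b k%:R) (real_act (horo c * Ph t)%g x).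
have -> : real_act (unip t k * (kap z * Ph t))%g x = real_act pt y.
  rewrite /y -!real_actM; congr (real_act _ x).
  have e1 : (unip t k * Ph t = Ph t * elem ord0 b k%:R)%g.
    rewrite /unip Phi_elem0//; congr (_ * elem _ _ _)%g.
    by rewrite -mulrA /step -expRD addNr expR0 mulr1.
  rewrite kz !mulgA /unip horo_comm// -!mulgA; congr (_ * _)%g.
  by rewrite /pt !mulgA -e1 !mulgK.
have -> : real_act pt y = real_act (D^-1 * pt)%g (real_act D y) by rewrite -real_actM mulVKg.
exact: phi_lip phi_test _ _.
Qed.

(** By [theta_horo], theta is close to a unit-step average [psi] evaluated at h x, where only h
    depends on t. Moving E past h replaces it by r = h^-1 E h, whose entries may grow with t but
    which has a fixed number of elementary factors, so the Mautner estimate applies. D, and with it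
    T and M0, depend on z; this is enough under the integral over z. *)
Lemma theta_almost_invariant z i j (s : R) (e : R) : z 0 0 != 0 -> 0 < e ->
  exists T M0, forall t M, T <= t -> (M0 <= M)%N -> (0 < M)%N ->
    \int[mu]_x `|theta t M z (real_act (elem i j s) x) - theta t M z x| <= e.
Proof.
move=> z0 e0; have [p [pp kz]] := kap_horo z0.
set D := par_diag pp; pose phiD := fun y : XB => phi (real_act D y).
pose L' := L * (l1 (SL_mx D^-1%g) * l1 (SL_mx D)).
have L'0 : 0 <= L' by rewrite !mulr_ge0// l1_ge0.
have bD : bmf phiD by exact: bmf_phi_act.
(* h^-1 E h is the conjugate by [Phi t] of horo^-1 E horo, a product of n+1, 1 and n+1 elementary
   matrices. *)
pose m := (n.+1 + (1 + n.+1))%N; pose d := e / 4.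
have d0 : 0 < d by rewrite divr_gt0.
(* [dq_elen] multiplies by 4^m, so [dq] at r is at most d^2 and the L^1 norm of the increment at
   most d + d^2 / d = 2d. With the error d at each of two points the sum is 4d = e. *)
pose e2 := d * d / 4 ^+ m.
have e20 : 0 < e2 by rewrite divr_gt0 ?mulr_gt0// exprn_gt0.
have ab : ord0 != b by rewrite eq_sym.
have [M0 HM] := horo_avg_almost_invariant mu_inv ab L'0 bD (lip_conj D) e20.
have [d1 d10 hd1] := dist1_near D (divr_gt0 d0 (ltr_wpDl L0 ltr01)).
have lp := l1_ge0 (SL_mx p).
(* By e^x >= 1 + x, this T makes e^(-(n+1)t) times the norm of p smaller than d1, so that p may be
   replaced by its block diagonal part D. *)
exists (Num.max 0 ((l1 (SL_mx p) + 1) / d1)), M0 => t M; rewrite ge_max => /andP[t0 tT] MM M1.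
set E := elem i j s; pose h := (horo (horo_coord z) * Ph t)%g.
pose psi := horo_avg ord0 b M phiD.
have bpsi : bmf psi by exact: bmf_horo_avg.
have ept : L * dist1 (D^-1 * ((Ph t)^-1 * p * Ph t))%g <= d.
  apply: le_trans (_ : _ <= (L + 1) * dist1 (D^-1 * ((Ph t)^-1 * p * Ph t))%g) _.
    by rewrite ler_wpM2r ?dist1_ge0// lerDl.
  rewrite mulrC -ler_pdivlMr ?ltW// ?ltr_wpDl//; apply: hd1.
  apply: le_lt_trans (par_diag_cvg pp t0) _.
  rewrite expRN mulrC ltr_pdivrMr ?expR_gt0//.
  apply: lt_le_trans (_ : l1 (SL_mx p) + 1 <= _); first by rewrite ltrDl.
  rewrite mulrC -ler_pdivrMr//; apply: le_trans tT _.
  apply: le_trans (_ : 1 + n.+1%:R * t <= _); last exact: expR_ge1Dx.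
  have n1 : 1 <= (n.+1%:R : R) by rewrite ler1n.
  by nra.
have key x : `|theta t M z x - psi (real_act h x)| <= d.
  exact: le_trans (theta_horo pp t M x z0 kz) ept.
have b1 : bmf (fun x : XB => psi (real_act h (real_act E x)) - psi (real_act h x)).
  by apply: bmfB; [apply: (@bmf_real_act _ _ E (fun x : XB => psi (real_act h x)))|]; exact: bmf_real_act.
apply: le_trans (_ : _ <= \int[mu]_x (2 * d + `|psi (real_act h (real_act E x)) - psi (real_act h x)|)) _.
  apply: bmf_int_le.
  - apply: bmf_norm; apply: bmfB; last exact: bmf_theta.
    by apply: bmf_real_act; exact: bmf_theta.
  - by apply: bmfD; [exact: bmf_cst|exact: bmf_norm].
  - move=> x; have k1 := key x; have k2 := key (real_act E x).
    rewrite [X in `|X|](_ : _ = (theta t M z (real_act E x) - psi (real_act h (real_act E x))) -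
      (theta t M z x - psi (real_act h x)) + (psi (real_act h (real_act E x)) - psi (real_act h x))); last by ring.
    apply: le_trans (ler_normD _ _) _; rewrite lerD2r.
    by apply: le_trans (ler_normB _ _) _; rewrite mulr2n mulrDl !mul1r lerD.
rewrite bmf_intD; [|exact: bmf_cst|exact: bmf_norm].
have mu1 : fine (mu setT) = 1 by rewrite probability_setT.
rewrite (bmf_int_cst mu) [X in _ * X]mu1 mulr1.
pose r := (h^-1 * E * h)%g.
have -> : \int[mu]_x `|psi (real_act h (real_act E x)) - psi (real_act h x)| =
    \int[mu]_x `|psi (real_act r x) - psi x|.
  have bw : bmf (fun x : XB => `|psi (real_act r x) - psi x|).
    by apply: bmf_norm; apply: bmfB => //; exact: bmf_real_act.
  rewrite -(int_real_act mu_inv h bw).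
  congr Rintegral; apply/funext => x; rewrite /= -!real_actM.
  by rewrite /r !mulgA mulgV mul1g.
have b2 : bmf (fun x : XB => psi (real_act r x) - psi x) by apply: bmfB => //; exact: bmf_real_act.
have er : elen m r.
  have -> : r = ((Ph t)^-1 * ((horo (horo_coord z))^-1 * (E * horo (horo_coord z))) * Ph t)%g.
    by rewrite /r /h invgM -!mulgA.
  apply: elen_Phi_conj; apply: elen_mul; first by apply: elen_inv; exact: elen_horo.
  by apply: elen_mul; [exact: elen_elem|exact: elen_horo].
have dr : dq mu psi r <= d * d.
  have -> : d * d = 4 ^+ m * e2 by rewrite /e2 [RHS]mulrC divfK// gt_eqF// exprn_gt0.
  by apply: dq_elen er => //; [exact: ltW|move=> i' j' s'; exact: HM].
have := bmf_int_L1 mu d0 b2; rewrite [X in d * X]mu1 mulr1.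
rewrite -[\int[mu]_x (_ * _)]/(dq mu psi r) => h1.
have h2 : d^-1 * dq mu psi r <= d by rewrite ler_pdivrMl.
by move: h1 h2; rewrite /d; lra.
Qed.

End horospherical_average.

(** * Orbit neighbourhoods have positive measure *)

Section orbit_neighbourhoods.
Variables (R : realType) (n : nat).
Local Notation X := (SLQ_quot n R).
Local Notation XB := (borel (SLQ_quot n R)).
Implicit Types (x y : X) (g r v : SL n R).
Variable mu : probability XB R.
Hypothesis mu_inv : forall (g : SL n (adele R)) (B : set XB),
  measurable B -> mu (SLQ_rtrans g @^-1` B) = mu B.

Definition orbit_nbhs x (d : R) (N : nat) : set X :=
  [set y | exists v k, [/\ dist1 v < d, Kcong N k & y = SLQ_rtrans (SL_pair v k) x]].

Lemma dist1_mulr v r : dist1 (v * r)%g <= dist1 v + (l1 (SL_mx v) + l1 (SL_mx v^-1%g)) * dist1 r.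
Proof.
have h1 : l1 (SL_mx (v * r)%g - 1%:M) <= l1 (SL_mx v - 1%:M) + l1 (SL_mx v) * l1 (SL_mx r - 1%:M).
  have -> : SL_mx (v * r)%g - 1%:M = (SL_mx v - 1%:M) + SL_mx v *m (SL_mx r - 1%:M).
    by rewrite mulmxBr mulmx1 [RHS]addrC addrA subrK.
  by apply: le_trans (l1D _ _) _; rewrite lerD2l l1M.
have h2 : l1 (SL_mx (v * r)^-1%g - 1%:M) <=
    l1 (SL_mx v^-1%g - 1%:M) + l1 (SL_mx v^-1%g) * l1 (SL_mx r^-1%g - 1%:M).
  have -> : SL_mx (v * r)^-1%g - 1%:M = (SL_mx v^-1%g - 1%:M) + (SL_mx r^-1%g - 1%:M) *m SL_mx v^-1%g.
    by rewrite invgM mulmxBl mul1mx [RHS]addrC addrA subrK.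
  by apply: le_trans (l1D _ _) _; rewrite lerD2l mulrC l1M.
rewrite /dist1; set a := l1 (SL_mx r - _) in h1 *; set a' := l1 (SL_mx r^-1%g - _) in h2 *.
have [p1 p2 p3 p4] : [/\ 0 <= a, 0 <= a', 0 <= l1 (SL_mx v) & 0 <= l1 (SL_mx v^-1%g)] by split; exact: l1_ge0.
by move: h1 h2; nra.
Qed.

Lemma orbit_nbhs_open x (d : R) N : (0 < N)%N -> open (orbit_nbhs x d N).
Proof.
move=> N0; apply: SLQ_open => _ [v [k [vd kN ->]]].
set c := l1 (SL_mx v) + l1 (SL_mx v^-1%g).
have c0 : 0 <= c by rewrite addr_ge0// l1_ge0.
exists ((d - dist1 v) / (c + 1)); first by rewrite divr_gt0 ?subr_gt0// ltr_wpDl.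
exists N => // r l rd lN; exists (v * r)%g, (k * l)%g; split.
- apply: le_lt_trans (dist1_mulr _ _) _; rewrite -ltrBrDl.
  apply: le_lt_trans (_ : _ <= (c + 1) * dist1 r) _.
    by rewrite ler_wpM2r ?dist1_ge0// lerDl.
  by rewrite mulrC -ltr_pdivlMr// ltr_wpDl.
- exact: KcongM.
- by rewrite -SL_pairM SLQ_rtransM.
Qed.

(** By transitivity, the preimages of W under a dense sequence of elements of SL_n(R) cover the
    space. They all have the measure of W, which therefore cannot be zero. *)
Lemma orbit_nbhs_measure x (d : R) N : 0 < d -> (0 < N)%N -> (0 < mu (orbit_nbhs x d N))%E.
Proof.
move=> d0 N0; set W : set XB := orbit_nbhs x d N.
have mW : measurable W by apply: borel_open_measurable; exact: orbit_nbhs_open.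
rewrite lt_neqAle measure_ge0 andbT; apply/eqP => W0.
have [q qd] := dense_SL_seq R n.
pose Q j : set XB := (real_act (q j) : XB -> XB) @^-1` W.
have mQ j : measurable (Q j) by rewrite -[Q j]setTI; exact: (real_act_measurable (q j)).
have Q0 j : mu (Q j) = 0%E by rewrite W0; exact: real_act_invariant.
have cover : [set: XB] `<=` \bigcup_j Q j.
  move=> y _; have [r [k [kN yE]]] := SLQ_transitive x y N0.
  have [j hj] := qd r^-1%g d d0; exists j => //; rewrite invgK in hj.
  exists (r * q j)%g, k; split => //.
  by rewrite yE !pair_act real_fin_act real_actM.
have := measure_sigma_subadditive mu mQ measurableT cover.
have mu1 : mu setT = 1%E := probability_setT mu.
rewrite [X in (X <= _)%E]mu1 eseries0; last by move=> j _ _; exact: Q0.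
by rewrite leNgt lte01.
Qed.

End orbit_neighbourhoods.

Section expanding_average_limit.
Variables (R : realType) (n : nat) (K : sphere R n -> SL n.+1 R) (v0 : sphere R n).
Hypothesis K_e1 : forall v, sphere_val v *m K v = delta_mx 0 0.
Hypothesis K_smooth : forall v, v != v0 -> smooth_at (fun w => SL_mx (K w)) v.
Local Notation V := 'rV[R]_n.+1.
Local Notation VB := (borel V).
Local Notation X := (SLQ_quot n.+1 R).
Local Notation XB := (borel (SLQ_quot n.+1 R)).
Local Notation kap := (kap K).
Local Notation SLR := (SL n.+1 R).
Local Notation Ph := (Phi n.+1).
Implicit Types (z : V) (g h : SLR) (x y : X).
Variable mu : probability XB R.
Hypothesis mu_inv : forall (g : SL n.+1 (adele R)) (B : set XB),
  measurable B -> mu (SLQ_rtrans g @^-1` B) = mu B.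
Variables (C L : R) (N : nat) (phi : X -> R).
Hypothesis phi_test : test_fun C L N phi.
Variable A : set V.
Hypotheses (A_open : open A) (A_Omega : A `<=` Omega v0).
Hypothesis mA : measurable (A : set VB).
Hypothesis Aoo : (@ell R n A < +oo)%E.
Local Notation nuA := (@mfrestr _ VB R A (@ell R n) mA Aoo).
Local Notation F := (avgF K phi mA Aoo).
Variable b : 'I_n.+1.
Hypothesis b0 : b != ord0.
Variable t : nat -> R.
Hypotheses (t_ge0 : forall j, 0 <= t j) (t_oo : t j @[j --> \oo] --> +oo).

(** About e^(t j) steps: their number tends to infinity, while the whole piece of orbit has length
    about e^(-n t j), which tends to 0 as n >= 1. *)
Let M j := (Num.trunc (expR (t j))).+1.

Lemma M_near M0 : \forall j \near \oo, (M0 <= M j)%N.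
Proof.
have /cvgryPgt/(_ M0%:R) := t_oo; apply: filterS => j tj.
have /andP[_ h] := truncn_itv (ltW (expR_gt0 (t j))).
rewrite -(ler_nat R) ltW//; apply: lt_trans h; apply: lt_le_trans tj _.
by apply: le_trans (expR_ge1Dx _); rewrite lerDr.
Qed.

Lemma unip_near (d : R) : 0 < d -> \forall j \near \oo, forall k, (k < M j)%N ->
  dist1 (unip b (t j) k) < d.
Proof.
move=> d0; have n1 : (0 < n)%N.
  by case: n b b0 => // b'; rewrite (ord1 b') eqxx.
have /cvgryPgt/(_ (4 / d)) := t_oo; apply: filterS => j tj k kM.
apply: le_lt_trans (dist1_elem _ _ _) _.
have s0 : 0 < step n (t j) by exact: expR_gt0.
rewrite ger0_norm ?mulr_ge0 ?(ltW s0)//.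
have /andP[h _] := truncn_itv (ltW (expR_gt0 (t j))).
have e1 : 1 <= expR (t j) by rewrite -[leLHS]expR0 ler_expR.
have kb : k%:R <= 2 * expR (t j).
  apply: le_trans (_ : (M j)%:R <= _); first by rewrite ler_nat ltnW.
  by rewrite /M -addn1 natrD; lra.
have sb : step n (t j) <= expR (- t j) * expR (- t j).
  rewrite /step -expRD ler_expR -opprD lerN2.
  have : (2 : R) <= n.+1%:R by rewrite ler_nat.
  by have := t_ge0 j; nra.
have ee : expR (t j) * expR (- t j) = 1 by rewrite -expRD subrr expR0.
apply: le_lt_trans (_ : _ <= 4 * expR (- t j)) _.
  apply: le_trans (_ : _ <= 2 * (2 * expR (t j) * (expR (- t j) * expR (- t j)))) _.
    by rewrite ler_wpM2l// ler_pM// ltW.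
  by rewrite -mulrA [expR (t j) * _]mulrA ee mul1r mulrA -natrM.
rewrite expRN ltr_pdivrMr ?expR_gt0// mulrC -ltr_pdivrMr//.
by apply: lt_le_trans tj _; apply: le_trans (expR_ge1Dx _); rewrite lerDr.
Qed.

Lemma theta_jbmf s m : jbmf (fun (x : XB) (z : VB) => theta K phi b s m z x).
Proof.
apply: jbmfZ; apply: jbmf_sum => k; apply: (phi_jbmf phi_test).
by apply: mSL_mul; [exact: mSL_cst|exact: mSL_kap_Phi K_smooth _].
Qed.

Let H j x : R := \int[nuA]_z theta K phi b (t j) (M j) z x.

(** [H j x] is the average of F (t j) over the translates of x by [unip (t j) k] with k < M j. These
    elements are uniformly close to 1 by [unip_near], so equicontinuity applies. *)
Lemma H_near (e : R) : 0 < e -> \forall j \near \oo, forall x, `|F (t j) x - H j x| <= e.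
Proof.
move=> e0; have [d d0 hd] := avgF_equicontinuous K_e1 K_smooth phi_test A_open A_Omega mA Aoo e0.
apply: filterS (unip_near d0) => j hj x.
have M0 : (0 < M j)%N by [].
have -> : H j x = (size (iota 0 (M j)))%:R^-1 *
    \sum_(k <- iota 0 (M j)) F (t j) (real_act (unip b (t j) k) x).
  have bk k : bmf (fun z : VB => phi (real_act (unip b (t j) k * (kap z * Ph (t j)))%g x)).
    by apply: (avg_section phi_test); apply: mSL_mul; [exact: mSL_cst|exact: mSL_kap_Phi K_smooth _].
  rewrite /H /theta bmf_intZ; last by apply: bmf_sum.
  rewrite bmf_int_sum//; congr (_ * _); apply: eq_bigr => k _.
  by rewrite /avgF; congr Rintegral; apply/funext => z; rewrite -real_actM.
have -> : F (t j) x = (size (iota 0 (M j)))%:R^-1 * \sum_(k <- iota 0 (M j)) F (t j) x.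
  rewrite big_const_seq count_predT size_iota iter_addr_0 -[F (t j) x *+ _]mulr_natl mulKf//.
  by rewrite pnatr_eq0 -lt0n.
apply: avg_dist => [|k /hj /hd]; first exact: ltW.
by rewrite distrC; apply.
Qed.

(** F is replaced by H at both points at a cost of 2e/3. Fubini turns the rest into an integral over
    z of the L^1(mu) increments of theta, which tend to 0 for each z in A by
    [theta_almost_invariant] and are bounded by 2C. *)
Lemma avgF_L1 i l (s : R) :
  \int[mu]_x `|F (t j) (real_act (elem i l s) x) - F (t j) x| @[j --> \oo] --> 0.
Proof.
have third (e : R) : 2 * (e / 3) + e / 3 <= e by lra.
set E := elem i l s.
pose J j z : R := \int[mu]_x `|theta K phi b (t j) (M j) z (real_act E x) - theta K phi b (t j) (M j) z x|.
have jb j : jbmf (fun (x : XB) (z : VB) =>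
    `|theta K phi b (t j) (M j) z (real_act E x) - theta K phi b (t j) (M j) z x|).
  apply: jbmf_norm; apply: jbmfB; last exact: theta_jbmf.
  exact: (jbmf_comp (@real_act_measurable R n.+1 E) (theta_jbmf (t j) (M j))).
have bJ j : bmf (J j : VB -> R) by exact: (jbmf_int2 mu nuA (jb j)).
have thetaC s' m z x : `|theta K phi b s' m z x| <= C.
  have := @avg_dist R m (fun k => phi (real_act (unip b s' k * (kap z * Ph s'))%g x)) (fun=> 0) C
    (C_ge0 phi_test).
  rewrite [X in _ - _ * X]big1 // mulr0 subr0; apply => k _; rewrite subr0; exact: phi_bound phi_test _.
have J0 : \int[nuA]_z J j z @[j --> \oo] --> 0.
  apply: (@restr_int_cvg0 _ _ _ _ _ mA Aoo _ (2 * C)).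
  - by move=> j; case: (bJ j).
  - move=> j z; have bnd (x : XB) :
        `| `|theta K phi b (t j) (M j) z (real_act E x) - theta K phi b (t j) (M j) z x| | <= 2 * C.
      by rewrite normr_id (le_trans (ler_normB _ _))// mulr2n mulrDl !mul1r lerD.
    have mu1 : fine (mu setT) = 1 by rewrite probability_setT.
    apply: le_trans (bmf_int_bound mu (jbmf_section2 z (jb j)) bnd) _.
    by rewrite [X in _ * X <= _]mu1 mulr1.
  - move=> z /A_Omega[z0 _]; apply/cvgrPdist_le => e e0.
    have [T [M0 hM]] := theta_almost_invariant K_e1 mu_inv phi_test b0 i l s z0 e0.
    have /cvgryPge/(_ T) := t_oo; apply: filterS2 (M_near M0) => j MM tT.
    rewrite sub0r normrN ger0_norm; last by apply: Rintegral_ge0.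
    exact: hM.
apply/cvgrPdist_le => e e0.
have e3 : 0 < e / 3 by rewrite divr_gt0.
have /cvgrPdist_le/(_ _ e3) := J0; apply: filterS2 (H_near e3) => j Hj.
rewrite !sub0r !normrN => Jj.
have bF : bmf (F (t j) : XB -> R) by exact: (bmf_avgF K_smooth mu phi_test mA Aoo).
have bFE : bmf (fun x : XB => F (t j) (real_act E x)) by exact: bmf_real_act.
have bH : bmf (H j : XB -> R) by exact: (jbmf_int1 mu nuA (theta_jbmf (t j) (M j))).
have bHE : bmf (fun x : XB => H j (real_act E x)) by exact: (bmf_real_act E bH).
have bI : bmf (fun x : XB => \int[nuA]_z
    `|theta K phi b (t j) (M j) z (real_act E x) - theta K phi b (t j) (M j) z x|).
  exact: (jbmf_int1 mu nuA (jb j)).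
rewrite ger0_norm; last by apply: Rintegral_ge0.
apply: le_trans (_ : _ <= \int[mu]_x (2 * (e / 3) + \int[nuA]_z
    `|theta K phi b (t j) (M j) z (real_act E x) - theta K phi b (t j) (M j) z x|)) _.
  apply: bmf_int_le; [by apply: bmf_norm; exact: bmfB|by apply: bmfD => //; exact: bmf_cst|] => x.
  rewrite [X in `|X|](_ : _ = (F (t j) (real_act E x) - H j (real_act E x)) -
    (F (t j) x - H j x) + (H j (real_act E x) - H j x)); last by ring.
  apply: le_trans (ler_normD _ _) _; apply: lerD.
    by apply: le_trans (ler_normB _ _) _; rewrite mulr2n mulrDl !mul1r lerD.
  have b1 := jbmf_section1 (real_act E x : XB) (theta_jbmf (t j) (M j)).
  have b2 := jbmf_section1 (x : XB) (theta_jbmf (t j) (M j)).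
  rewrite /H -bmf_intB//; exact: bmf_int_norm (bmfB b1 b2).
have mu1 : fine (mu setT) = 1 by rewrite probability_setT.
rewrite bmf_intD//; last exact: bmf_cst.
rewrite (bmf_int_cst mu) [X in _ * X]mu1 mulr1 (jbmf_fubini mu nuA (jb j)).
have Jj' := le_trans (ler_norm _) Jj.
apply: le_trans (_ : _ <= 2 * (e / 3) + e / 3) _; first by rewrite lerD2l; exact: Jj'.
exact: third.
Qed.

End expanding_average_limit.

Section pointwise_limit.
Variables (R : realType) (n : nat) (K : sphere R n -> SL n.+1 R) (v0 : sphere R n).
Hypothesis K_e1 : forall v, sphere_val v *m K v = delta_mx 0 0.
Hypothesis K_smooth : forall v, v != v0 -> smooth_at (fun w => SL_mx (K w)) v.
Local Notation V := 'rV[R]_n.+1.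
Local Notation VB := (borel V).
Local Notation X := (SLQ_quot n.+1 R).
Local Notation XB := (borel (SLQ_quot n.+1 R)).
Local Notation SLR := (SL n.+1 R).
Implicit Types (z : V) (g h : SLR) (x y : X).
Variable mu : probability XB R.
Hypothesis mu_inv : forall (g : SL n.+1 (adele R)) (B : set XB),
  measurable B -> mu (SLQ_rtrans g @^-1` B) = mu B.
Variables (C L : R) (N : nat) (phi : X -> R).
Hypothesis phi_test : test_fun C L N phi.
Variable A : set V.
Hypotheses (A_open : open A) (A_Omega : A `<=` Omega v0).
Hypothesis mA : measurable (A : set VB).
Hypothesis Aoo : (@ell R n A < +oo)%E.
Local Notation nuA := (@mfrestr _ VB R A (@ell R n) mA Aoo).
Local Notation F := (avgF K phi mA Aoo).
Hypothesis n_gt0 : (0 < n)%N.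
Variable t : nat -> R.
Hypotheses (t_ge0 : forall j, 0 <= t j) (t_oo : t j @[j --> \oo] --> +oo).

Lemma avgF_fin_act s k x : Kcong N k -> F s (fin_act k x) = F s x.
Proof.
move=> kN; rewrite /avgF; congr Rintegral; apply/funext => z.
by rewrite real_fin_act; case: phi_test => _ _ _ ->.
Qed.

(* Convergence in mean is pointwise here: F is equicontinuous and the orbit
   neighbourhoods have positive measure. *)
Lemma avgF_elem_cvg i l (s : R) x0 :
  F (t j) (real_act (elem i l s) x0) - F (t j) x0 @[j --> \oo] --> 0.
Proof.
set E := elem i l s.
pose b : 'I_n.+1 := Ordinal (n_gt0 : (1 < n.+1)%N).
have L1 := @avgF_L1 R n K v0 K_e1 K_smooth mu mu_inv C L N phi phi_test A A_open A_Omega mA Aoo b isT t t_ge0 t_oo i l s.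
rewrite -/E in L1.
have N0 : (0 < N)%N by case: phi_test.
have key (a c d : R) : a <= c + 2 * d -> c <= d -> a <= 3 * d by lra.
apply/cvgrPdist_le => e0' e0'0.
pose e := e0' / 3; have e0 : 0 < e by rewrite divr_gt0.
have [d1 d10 hd1] := avgF_equicontinuous K_e1 K_smooth phi_test A_open A_Omega mA Aoo e0.
set c := l1 (SL_mx E^-1%g) * l1 (SL_mx E).
have c0 : 0 <= c by rewrite mulr_ge0// l1_ge0.
(* The factor c + 1 leaves room for E^-1 v E, which relates the two points after translation by
   E. *)
pose d := d1 / (c + 1).
have d0 : 0 < d by rewrite divr_gt0// ltr_wpDl.
have dd1 : d <= d1 by rewrite ler_pdivrMr ?ltr_wpDl// mulrDr mulr1 lerDr mulr_ge0// ltW.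
set W : set XB := orbit_nbhs x0 d N.
have mW : measurable W by apply: borel_open_measurable; exact: orbit_nbhs_open.
have W0 : 0 < fine (mu W).
  apply: fine_gt0; rewrite (orbit_nbhs_measure mu_inv)//=.
  by rewrite (le_lt_trans (probability_le1 mu mW))// ltry.
pose D j x := `|F (t j) (real_act E x) - F (t j) x|.
have bF j : bmf (F (t j) : XB -> R) by exact: (bmf_avgF K_smooth mu phi_test mA Aoo).
have bD j : bmf (D j : XB -> R).
  by apply: bmf_norm; apply: bmfB => //; exact: (bmf_real_act E (bF j)).
(* Points of W change D by at most 2e, so (D x0 - 2e) mu(W) is at most the integral of D, which is
   eventually at most e mu(W); this gives D x0 <= 3e. *)
have DW j x : W x -> D j x0 - 2 * e <= D j x.
  move=> [v [k [vd kN ->]]]; rewrite /D pair_act real_fin_act !avgF_fin_act//.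
  have h1 := hd1 v (lt_le_trans vd dd1) (t j) x0 (t_ge0 j).
  have h2 : `|F (t j) (real_act E (real_act v x0)) - F (t j) (real_act E x0)| <= e.
    have -> : real_act E (real_act v x0) = real_act (E^-1 * v * E)%g (real_act E x0).
      by rewrite -!real_actM !mulgA mulgV mul1g.
    apply: hd1 => //; apply: le_lt_trans (dist1_conj _ _) _.
    apply: le_lt_trans (_ : _ <= (c + 1) * dist1 v) _.
      by rewrite ler_wpM2r ?dist1_ge0// lerDl.
    by rewrite mulrC -ltr_pdivlMr// ltr_wpDl.
  set p := F _ (real_act E (real_act v x0)) in h2 *; set q := F _ (real_act E x0) in h2 *.
  set p' := F _ (real_act v x0) in h1 *; set q' := F _ x0 in h1 *.
  rewrite lerBlDr [X in `|X|](_ : q - q' = (p - p') + ((p' - q') - (p - q))); last by ring.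
  apply: le_trans (ler_normD _ _) _; rewrite lerD2l.
  by apply: le_trans (ler_normB _ _) _; rewrite mulr2n mulrDl !mul1r lerD.
have low j : (D j x0 - 2 * e) * fine (mu W) <= \int[mu]_x D j x.
  rewrite -(bmf_int_indic mu mW) -bmf_intZ; last exact: bmf_indic.
  apply: bmf_int_le => //; first by apply: bmfZ; exact: bmf_indic.
  move=> x; rewrite indicE; have [Wx|nWx] := pselect (W x).
    by rewrite mem_set// mulr1; exact: DW.
  by rewrite memNset// mulr0 normr_ge0.
have /cvgrPdist_le/(_ (e * fine (mu W)) (mulr_gt0 e0 W0)) := L1.
apply: filterS => j; rewrite !sub0r !normrN => /(le_trans (ler_norm _)) hj.
have -> : e0' = 3 * e by rewrite /e mulrC divfK.
apply: (key (D j x0) (D j x0 - 2 * e) e); first by rewrite subrK.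
by rewrite -(ler_pM2r W0); exact: le_trans (low j) hj.
Qed.

Lemma avgF_real_act_cvg g x0 : F (t j) (real_act g x0) - F (t j) x0 @[j --> \oo] --> 0.
Proof.
move: g x0; apply: (SL_elem_ind (P := fun g => forall x0,
  F (t j) (real_act g x0) - F (t j) x0 @[j --> \oo] --> 0) (@field_stable_range1 R)).
  move=> x0; rewrite (_ : (fun j => _) = (fun=> 0)); first exact: cvg_cst.
  by apply/funext => j; rewrite real_act1 subrr.
move=> i l s g IH x0; rewrite -[X in _ --> X](addr0 0).
rewrite (_ : (fun j => _) = (fun j => (F (t j) (real_act g (real_act (elem i l s) x0)) -
    F (t j) (real_act (elem i l s) x0)) + (F (t j) (real_act (elem i l s) x0) - F (t j) x0))).
  by apply: cvgD; [exact: IH|exact: avgF_elem_cvg].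
by apply/funext => j; rewrite real_actM addrA subrK.
Qed.

Lemma int_avgF s : \int[mu]_x F s x = (\int[mu]_x phi x) * fine (ell A).
Proof.
have jb := phi_jbmf phi_test (mSL_kap_Phi K_smooth s).
rewrite [LHS](jbmf_fubini mu nuA jb).
have bp : bmf (phi : XB -> R) by split; [exact: phi_measurable phi_test|exists C; exact: phi_bound phi_test].
rewrite (_ : (fun z => _) = fun=> \int[mu]_x phi x); last first.
  by apply/funext => z; exact: (int_real_act mu_inv _ bp).
have -> : ell A = nuA setT by rewrite -[RHS]/(ell (setT `&` A)) setTI.
exact: (bmf_int_cst nuA).
Qed.

(** F (t j) takes asymptotically the same value at x and at any other point y, so by dominated
    convergence F (t j) x is asymptotic to its mean over y, which [int_avgF] evaluates. *)
Theorem avgF_cvg x : F (t j) x @[j --> \oo] --> (\int[mu]_x phi x) * fine (ell A).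
Proof.
have N0 : (0 < N)%N by case: phi_test.
have bF j : bmf (F (t j) : XB -> R) by exact: (bmf_avgF K_smooth mu phi_test mA Aoo).
have FC := avgF_bound K_smooth phi_test mA Aoo.
have dcvg y : F (t j) y - F (t j) x @[j --> \oo] --> 0.
  have [r [k [kN ->]]] := SLQ_transitive x y N0.
  rewrite (_ : (fun j => _) = fun j => F (t j) (real_act r x) - F (t j) x).
    exact: avgF_real_act_cvg.
  by apply/funext => j; rewrite pair_act avgF_fin_act.
have mu1 : fine (mu setT) = 1 by rewrite probability_setT.
have [|||_] := @bounded_convergence _ XB R mu (fun j (y : XB) => F (t j) y - F (t j) x) (fun=> 0)
  (2 * (C * fine (ell A))).
- by move=> j; have [] := bmfB (bF j) (@bmf_cst _ XB R (F (t j) x)).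
- by move=> j y; rewrite (le_trans (ler_normB _ _))// mulr2n mulrDl !mul1r lerD.
- exact: dcvg.
rewrite (_ : (fun j => _) = fun j => (\int[mu]_x phi x) * fine (ell A) - F (t j) x); last first.
  apply/funext => j; rewrite bmf_intB//; last exact: bmf_cst.
  by rewrite (bmf_int_cst mu) [X in _ - _ * X]mu1 mulr1 int_avgF.
rewrite (bmf_int_cst mu) mul0r => h.
set c := (\int[mu]_x phi x) * fine (ell A) in h *.
rewrite -(subr0 c) (_ : (fun j => _) = fun j => c - (c - F (t j) x)).
  exact: (cvgB (cvg_cst c) h).
by apply/funext => j; rewrite subKr.
Qed.

End pointwise_limit.

(** * Transfer to absolutely continuous measures *)

Section transfer.
Context d (T : measurableType d) (R : realType).
Variables (sigma lambda : {finite_measure set T -> \bar R}) (G : set (set T)).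
Hypotheses (GI : setI_closed G) (GT : G setT) (mG : measurable = <<s G >>).
Variables (psi : nat -> T -> R) (C c : R).
Hypotheses (mpsi : forall j, measurable_fun setT (psi j)) (psiC : forall j x, `|psi j x| <= C).
Hypothesis psiG : forall B, G B ->
  \int[sigma]_x (\1_B x * psi j x) @[j --> \oo] --> c * fine (sigma B).

Let bpsi j : bmf (psi j). Proof. by split => //; exists C. Qed.

Let approx_cvg (u : nat -> R) (l : R) :
  (forall e, 0 < e -> exists v m, [/\ (v : nat -> R) j @[j --> \oo] --> (m : R),
     forall j, `|u j - v j| <= e & `|l - m| <= e]) -> u j @[j --> \oo] --> l.
Proof.
move=> H; have third (e : R) : e / 3 + e / 3 + e / 3 <= e by lra.
apply/cvgrPdist_le => e e0; have e3 : 0 < e / 3 by rewrite divr_gt0.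
have [v [m [vm uv lm]]] := H _ e3.
have /cvgrPdist_le/(_ _ e3) := vm; apply: filterS => j mv.
rewrite (_ : l - u j = (l - m) + (m - v j) - (u j - v j)); last by ring.
apply: le_trans (ler_normB _ _) _; apply: le_trans (third e).
by rewrite lerD//; apply: le_trans (ler_normD _ _) _; rewrite lerD.
Qed.

(** A lambda-system argument. Increasing unions pass because psi is bounded uniformly in j, so
    omitting a set of small sigma-measure costs little for all j at once. *)
Lemma transfer_indic B : measurable B ->
  \int[sigma]_x (\1_B x * psi j x) @[j --> \oo] --> c * fine (sigma B).
Proof.
move: B; pose H : set (set T) := [set B | measurable B /\
  \int[sigma]_x (\1_B x * psi j x) @[j --> \oo] --> c * fine (sigma B)].
suff GH : <<s G >> `<=` H by move=> B; rewrite mG => /GH[].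
have Gm : G `<=` measurable by rewrite mG; exact: sub_sigma_algebra.
apply: lambda_system_subset => //; last by move=> P GP; split; [exact: Gm|exact: psiG].
have bi B j : measurable B -> bmf (fun x => \1_B x * psi j x).
  by move=> mB; apply: bmfM => //; exact: bmf_indic.
have diffE A B : B `<=` A -> \1_(A `\` B) = (fun x => \1_A x - \1_B x : R).
  move=> BA; apply/funext => x; rewrite !indicE in_setD.
  have [Bx|nBx] := pselect (B x); first by rewrite (mem_set Bx) (mem_set (BA _ Bx)) subrr.
  by rewrite (memNset nBx) andbT subr0.
have fineD A B : measurable A -> measurable B -> B `<=` A ->
    fine (sigma (A `\` B)) = fine (sigma A) - fine (sigma B).
  move=> mA mB BA; rewrite -!(bmf_int_indic sigma)//; last exact: measurableD.
  by rewrite -bmf_intB; [rewrite diffE|exact: bmf_indic|exact: bmf_indic].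
split => //.
- by split => //; exact: psiG.
- move=> A B BA [mA cA] [mB cB]; split; first exact: measurableD.
  rewrite fineD// mulrBr (_ : (fun j => _) = fun j => \int[sigma]_x (\1_A x * psi j x) -
      \int[sigma]_x (\1_B x * psi j x)); first exact: cvgB.
  apply/funext => j; rewrite -bmf_intB//; [|exact: bi|exact: bi].
  by rewrite diffE//; congr Rintegral; apply/funext => x; rewrite mulrBl.
- move=> F ndF HF; have mF i : measurable (F i) by case: (HF i).
  have mU : measurable (\bigcup_i F i) by exact: bigcup_measurable.
  split => //; apply: approx_cvg => e e0.
  have Fs : fine (sigma (F i)) @[i --> \oo] --> fine (sigma (\bigcup_i F i)).
    by apply: fine_cvg; rewrite fineK ?fin_num_measure//; exact: nondecreasing_cvg_mu.
  (* k is positive and dominates both |C|, for the error in the integrals, and |c|, for the error in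
     the limit. *)
  pose k := `|C| + `|c| + 1; have k0 : 0 < k by rewrite ltr_wpDl// addr_ge0.
  have /cvgrPdist_le/(_ _ (divr_gt0 e0 k0))[i _ /(_ i (leqnn i)) Fi] := Fs.
  have FU : F i `<=` \bigcup_i F i by exact: bigcup_sup.
  have small : k * fine (sigma (\bigcup_i F i `\` F i)) <= e.
    by rewrite fineD// mulrC -ler_pdivlMr// (le_trans (ler_norm _)).
  have s0 : 0 <= fine (sigma (\bigcup_i F i `\` F i)) by exact: fine_ge0.
  have mD : measurable (\bigcup_i F i `\` F i) by exact: measurableD.
  exists (fun j => \int[sigma]_x (\1_(F i) x * psi j x)), (c * fine (sigma (F i))); split.
  + by case: (HF i).
  + move=> j; rewrite -bmf_intB; [|exact: bi|exact: bi].
    apply: le_trans (bmf_int_norm _ _) _; first by apply: bmfB; exact: bi.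
    apply: le_trans (_ : _ <= \int[sigma]_x (`|C| * \1_(\bigcup_i F i `\` F i) x)) _.
      apply: bmf_int_le; [by apply: bmf_norm; apply: bmfB; exact: bi|by apply: bmfZ; exact: bmf_indic|].
      move=> x; rewrite -mulrBl [X in `|X * _|](_ : _ = \1_(\bigcup_i F i `\` F i) x); last by rewrite diffE.
      rewrite normrM mulrC ler_pM//; first exact: le_trans (ler_norm _).
      by rewrite indicE; case: (_ \in _); rewrite ?normr1 ?normr0.
    rewrite bmf_intZ ?bmf_int_indic//; last exact: bmf_indic.
    by apply: le_trans small; rewrite ler_wpM2r// /k -addrA lerDl addr_ge0.
  + rewrite -mulrBr -fineD// normrM (ger0_norm s0); apply: le_trans small.
    by rewrite ler_wpM2r// /k addrAC lerDr addr_ge0.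
Qed.

Import HBSimple.

Lemma transfer_sfun (g : {sfun T >-> R}) :
  \int[sigma]_x (g x * psi j x) @[j --> \oo] --> c * \int[sigma]_x g x.
Proof.
pose s : seq R := finmap.enum_fset (fset_set (range g)).
have gE x : g x = \sum_(y <- s) y * \1_(g @^-1` [set y]) x.
  by rewrite fimfunE fsbig_finite.
have mp y : measurable (g @^-1` [set y]) by exact: measurable_sfunP.
have bi y : bmf (fun x => \1_(g @^-1` [set y]) x : R) by exact: bmf_indic.
have -> : (fun j => \int[sigma]_x (g x * psi j x)) =
    fun j => \sum_(y <- s) y * \int[sigma]_x (\1_(g @^-1` [set y]) x * psi j x).
  apply/funext => j; rewrite -(eq_bigr _ (fun y _ => bmf_intZ sigma y (bmfM (bi y) (bpsi j)))).
  rewrite -bmf_int_sum; last by move=> y; apply: bmfZ; apply: bmfM.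
  congr Rintegral; apply/funext => x; rewrite gE mulr_suml.
  by apply: eq_bigr => y _; rewrite mulrA.
have -> : c * \int[sigma]_x g x = \sum_(y <- s) y * (c * fine (sigma (g @^-1` [set y]))).
  have -> : \int[sigma]_x g x = \int[sigma]_x (\sum_(y <- s) y * \1_(g @^-1` [set y]) x).
    by congr Rintegral; apply/funext.
  rewrite bmf_int_sum; last by move=> y; exact: bmfZ.
  rewrite mulr_sumr; apply: eq_bigr => y _.
  by rewrite bmf_intZ// bmf_int_indic// mulrCA.
have := @cvg_big R R +%R 0 xpredT (@add_continuous R) nat \oo s
  (fun y j => y * \int[sigma]_x (\1_(g @^-1` [set y]) x * psi j x)).
apply => y _; apply: cvgM; [exact: cvg_cst|exact: transfer_indic].
Qed.

(** The density of lambda is integrable but may be unbounded. It is approximated in L^1(sigma) by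
    simple functions, which suffices as psi is bounded uniformly in j. *)
Lemma transfer_ac : lambda `<< sigma ->
  \int[lambda]_x psi j x @[j --> \oo] --> c * fine (lambda setT).
Proof.
move=> ac; pose h := Radon_Nikodym (charge_of_finite_measure lambda) sigma.
have ih : sigma.-integrable setT h by exact: Radon_Nikodym_integrable.
pose hr x := fine (h x).
have hE x : h x = (hr x)%:E by rewrite fineK//; exact: Radon_Nikodym_fin_num.
have ihr : sigma.-integrable setT (EFin \o hr).
  by rewrite (_ : EFin \o hr = h)//; apply/funext => x; rewrite hE.
have mhr : measurable_fun setT hr by apply/measurable_EFinP; exact: measurable_int ihr.
have lambdaE : fine (lambda setT) = \int[sigma]_x hr x.
  have lE : (lambda setT = \int[sigma]_x h x)%E :=
    @Radon_Nikodym_integral _ _ _ (charge_of_finite_measure lambda) sigma setT ac measurableT.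
  rewrite lE; congr fine.
  by apply: eq_integral => x _; rewrite -hE.
have psiE j : \int[lambda]_x psi j x = \int[sigma]_x (psi j x * hr x).
  congr fine; rewrite -(Radon_Nikodym_change_of_variables ac measurableT (bmf_integrable lambda (bpsi j))).
  by apply: eq_integral => x _; rewrite EFinM -hE.
have [g [ig _ g1]] := approximation_sfun_integrable measurableT ihr.
have g1' : \int[sigma]_x `|hr x - g i x| @[i --> \oo] --> 0.
  by apply: fine_cvg g1.
have bint k j : sigma.-integrable setT (EFin \o k) -> sigma.-integrable setT (EFin \o (fun x => psi j x * k x)).
  move=> ik; have mk : measurable_fun setT k by apply/measurable_EFinP; exact: measurable_int ik.
  apply: (le_integrable measurableT _ _ (integrableZl measurableT `|C| ik)).
    by apply/measurable_EFinP; exact: measurable_funM.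
  move=> x _; rewrite lee_fin /= normrM !normrM normr_id ler_wpM2r//.
  exact: le_trans (psiC j x) (ler_norm _).
apply: approx_cvg => e e0.
pose k := `|C| + `|c| + 1; have k0 : 0 < k by rewrite ltr_wpDl// addr_ge0.
have /cvgrPdist_le/(_ _ (divr_gt0 e0 k0))[i _ /(_ i (leqnn i))] := g1'.
rewrite sub0r normrN => /(le_trans (ler_norm _)); rewrite ler_pdivlMr// mulrC => gi.
set I1 := \int[sigma]_x _ in gi.
have I10 : 0 <= I1 by apply: Rintegral_ge0.
have id : sigma.-integrable setT (EFin \o (fun x => hr x - g i x)).
  rewrite (_ : EFin \o _ = (EFin \o hr) \- (EFin \o g i))%E; first exact: integrableB.
  by apply/funext => x.
have idn : sigma.-integrable setT (EFin \o (fun x => `|hr x - g i x|)).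
  exact: (integrable_abse id).
exists (fun j => \int[sigma]_x (g i x * psi j x)), (c * \int[sigma]_x g i x); split.
- exact: transfer_sfun.
- move=> j; rewrite psiE.
  rewrite (_ : \int[sigma]_x (g i x * psi j x) = \int[sigma]_x (psi j x * g i x)); last first.
    by congr Rintegral; apply/funext => x; rewrite mulrC.
  rewrite -RintegralB//; [|exact: bint|exact: bint].
  rewrite (_ : \int[sigma]_x _ = \int[sigma]_x (psi j x * (hr x - g i x))); last first.
    by congr Rintegral; apply/funext => x; rewrite mulrBr.
  apply: le_trans (le_normr_Rintegral measurableT (bint _ j id)) _.
  apply: le_trans (_ : _ <= \int[sigma]_x (`|C| * `|hr x - g i x|)) _.
    apply: le_Rintegral => //.
    + exact: (integrable_abse (bint _ j id)).
    + exact: (integrableZl measurableT `|C| idn).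
    + move=> x _; rewrite normrM ler_wpM2r//; exact: le_trans (psiC j x) (ler_norm _).
  rewrite RintegralZl//; apply: le_trans gi.
  by rewrite ler_wpM2r// /k -addrA lerDl addr_ge0.
- rewrite lambdaE -mulrBr -(RintegralB measurableT ihr (ig i)).
  rewrite normrM; apply: le_trans (_ : _ <= `|c| * I1) _.
    by rewrite ler_wpM2l//; exact: (le_normr_Rintegral measurableT id).
  by apply: le_trans gi; rewrite ler_wpM2r// /k addrAC lerDr addr_ge0.
Qed.

End transfer.

(** * The sphere as a quotient of a punctured ball *)

Section null_complement.
Variables (R : realType) (n : nat) (v0 : sphere R n).
Local Notation V := 'rV[R]_n.+1.
Local Notation outer := (@lebesgue_outer R n).
Implicit Types z w : V.

Lemma outer_hyperplane (i : 'I_n.+1) : outer [set z : V | z 0 i = 0] = 0%E.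
Proof.
pose F (k : nat) : V * V := (\row_j (if j == i then 0 else - k%:R), \row_j (if j == i then 0 else k%:R)).
apply/eqP; rewrite eq_le outer_ge0 andbT; apply: le_trans (outer_le_cover (F := F) _) _; first split.
- by move=> k j; rewrite !mxE; case: ifP => // _; have := ler0n R k; lra.
- move=> z /= zi; have [k zk] : exists k : nat, l1 z < k%:R.
    by exists (Num.bound (l1 z)); apply: archi_boundP; exact: l1_ge0.
  exists k => // j; rewrite !mxE; case: eqVneq => [->|_]; first by rewrite zi lexx.
  by rewrite -ler_norml (le_trans (ler_l1 _ _ _))// ltW.
rewrite eseries0// => k _ _; congr EFin.
by rewrite /vol (bigD1 i)//= !mxE eqxx subrr mul0r.
Qed.

Lemma outer_setU (P Q : set V) : outer P = 0%E -> outer Q = 0%E -> outer (P `|` Q) = 0%E.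
Proof.
move=> P0 Q0; apply/eqP; rewrite eq_le outer_ge0 andbT.
apply: le_trans (outer_measureU2 outer P Q) _.
by change (outer P + outer Q <= 0)%E; rewrite P0 Q0 adde0.
Qed.

(** Outside the hyperplane z_0 = 0 the complement lies on the ray through v0, which a shear maps
    into the hyperplane z_b = 0; the second index b exists as n >= 1. *)
Lemma outer_OmegaC : (0 < n)%N -> outer (~` Omega v0) = 0%E.
Proof.
move=> n0; pose b : 'I_n.+1 := Ordinal (n0 : (1 < n.+1)%N).
pose w := sphere_val v0; pose g : SL n.+1 R := elem ord0 b (- (w 0 b / w 0 0)).
have h0 := outer_hyperplane ord0.
have hg : outer ((fun z : V => z *m g) @^-1` [set z : V | z 0 b = 0]) = 0%E.
  by rewrite outer_mulmx outer_hyperplane.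
apply/eqP; rewrite eq_le outer_ge0 andbT; rewrite -[leRHS](outer_setU h0 hg).
apply: outer_le => z zO; have [z0|z0] := eqVneq (z 0 0) 0; [by left|right].
have zv : nrm z = v0 by apply: contrapT => /eqP zv; exact: zO.
have zn : z != 0 by apply: contra_neq z0 => ->; rewrite mxE.
have zE : z = norm2 z *: w.
  by rewrite /w -zv nrm_val// /radial scalerA mulfV ?scale1r// gt_eqF// norm2_gt0.
have w0 : w 0 0 != 0 by apply: contra_neq z0 => w0; rewrite zE mxE w0 mulr0.
rewrite /= /g elem_mulmx /= mulr1 [in X in X + _]zE [in X in _ + X]zE !mxE.
by rewrite mulrN -mulrA [w 0 0 * _]mulrCA mulfV// mulr1 subrr.
Qed.

End null_complement.

Section direction_measure.
Variables (R : realType) (n : nat) (v0 : sphere R n).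
Local Notation V := 'rV[R]_n.+1.
Local Notation VB := (borel V).
Local Notation SB := (borel (sphere R n)).

(** Radius 2 keeps the set open while it contains every point of [Omega] of norm at most 1, as the
    cones of [sphere_lebesgue] require. *)
Definition Omega2 : set V := Omega v0 `&` [set z | norm2 z < 2].

Lemma Omega2_open : open Omega2.
Proof.
apply: openI; first exact: Omega_open.
have := @open_comp V R (@norm2 R n) [set r | r < 2]; apply; last exact: open_lt.
by move=> z _; exact: norm2_continuous.
Qed.

Lemma Omega2_measurable : measurable (Omega2 : set VB).
Proof. by apply: borel_open_measurable; exact: Omega2_open. Qed.

Lemma Omega2_finite : (@ell R n Omega2 < +oo)%E.
Proof.
pose a : V := const_mx (-2); pose b : V := const_mx 2.
have sub : Omega2 `<=` box a b.
  move=> z [_ z2] i; rewrite !mxE -ler_norml; apply: le_trans (norm2_coord z i) _; exact: ltW.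
apply: le_lt_trans (outer_le sub) _; apply: le_lt_trans (outer_box _) (ltry _).
by move=> i; rewrite !mxE; lra.
Qed.

Definition direction_measure (B : set SB) : \bar R := @ell R n (@nrm R n @^-1` B `&` Omega2).

Local Notation nu := (@mfrestr _ VB R Omega2 (@ell R n) Omega2_measurable Omega2_finite).

Let direction_measure0 : direction_measure set0 = 0%E.
Proof. by rewrite /direction_measure preimage_set0 set0I measure0. Qed.

Let direction_measure_ge0 B : (0 <= direction_measure B)%E.
Proof. exact: measure_ge0. Qed.

Lemma nrm_preimage_measurable (B : set SB) : measurable B -> measurable (@nrm R n @^-1` B : set VB).
Proof. by move=> mB; rewrite -[X in measurable X]setTI; exact: nrm_measurable. Qed.

Let direction_measure_sigma_additive : semi_sigma_additive direction_measure.
Proof.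
move=> F mF tF mUF; rewrite /direction_measure preimage_bigcup.
have := @measure_semi_sigma_additive _ VB R nu (fun k => @nrm R n @^-1` F k); apply.
- by move=> k; exact: nrm_preimage_measurable.
- apply/trivIsetP => /= i j _ _ ij; rewrite -preimage_setI.
  by move/trivIsetP : tF => /(_ _ _ _ _ ij) ->//; rewrite preimage_set0.
- by rewrite -preimage_bigcup; exact: nrm_preimage_measurable.
Qed.

HB.instance Definition _ := isMeasure.Build _ SB R direction_measure
  direction_measure0 direction_measure_ge0 direction_measure_sigma_additive.

Let direction_measure_finite : fin_num_fun direction_measure.
Proof. by move=> B mB; apply: (@fin_num_measure _ VB R nu); exact: nrm_preimage_measurable. Qed.

HB.instance Definition _ := Measure_isFinite.Build _ SB R direction_measure direction_measure_finite.

Lemma int_direction (h : SB -> R) : bmf h ->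
  \int[nu]_z h (nrm z) = \int[direction_measure]_v h v.
Proof. by apply: bmf_int_pushforward => //; exact: nrm_measurable. Qed.

(** A cone over B lies in the preimage of B within [Omega2], up to the null complement of [Omega].
    Absolute continuity is all that [transfer_ac] asks of the comparison with
    [direction_measure]. *)
Lemma sphere_lebesgue_ac : (0 < n)%N -> @sphere_lebesgue R n `<< direction_measure.
Proof.
move=> n0 N N0 B mB BN; rewrite /sphere_lebesgue.
suff -> : lebesgue_outer (cone B) = 0%E by rewrite mule0.
have dB : lebesgue_outer (@nrm R n @^-1` B `&` Omega2) = 0%E by exact: N0.
apply/eqP; rewrite eq_le outer_ge0 andbT -[leRHS](outer_setU dB (outer_OmegaC v0 n0)).
apply: outer_le => z [r [v [/andP[r0 r1] Bv ->]]].
have [zO|zO] := pselect (Omega v0 (r *: sphere_val v)); [left|by right].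
split; first by rewrite /= nrm_ray.
by split => //=; rewrite norm2Z ?ltW// norm2_sphere mulr1; apply: le_lt_trans r1 _; rewrite ltr1n.
Qed.

End direction_measure.

(** * Equidistribution *)

Section equidistribution.
Variables (R : realType) (n : nat) (K : sphere R n -> SL n.+1 R) (v0 : sphere R n).
Hypothesis n_gt0 : (0 < n)%N.
Hypothesis K_e1 : forall v, sphere_val v *m K v = delta_mx 0 0.
Hypothesis K_smooth : forall v, v != v0 -> smooth_at (fun w => SL_mx (K w)) v.
Local Notation V := 'rV[R]_n.+1.
Local Notation VB := (borel V).
Local Notation SB := (borel (sphere R n)).
Local Notation X := (SLQ_quot n.+1 R).
Local Notation XB := (borel (SLQ_quot n.+1 R)).
Local Notation SLR := (SL n.+1 R).
Variable mu : probability XB R.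
Hypothesis mu_inv : forall (g : SL n.+1 (adele R)) (B : set XB),
  measurable B -> mu (SLQ_rtrans g @^-1` B) = mu B.
Variable lambda : probability SB R.
Hypothesis lambda_ac : lambda `<< @sphere_lebesgue R n.
Variable x : X.
Variable t : nat -> R.
Hypotheses (t_ge0 : forall j, 0 <= t j) (t_oo : t j @[j --> \oo] --> +oo).

Definition translate (f : X -> R) s (v : sphere R n) : R := f (real_act (K v * Phi n.+1 s)%g x).

Lemma bmf_translate (f : X -> R) C s : continuous f -> (forall y, `|f y| <= C) -> bmf (translate f s : SB -> R).
Proof.
move=> cf fC.
have mr : mSL (fun v : SB => K v * Phi n.+1 s)%g.
  by apply: mSL_mul; [move=> i j; exact: (K_measurable K_smooth)|exact: mSL_cst].
suff jb : jbmf (fun (y : XB) (v : SB) => f (real_act (K v * Phi n.+1 s)%g y)).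
  exact: (jbmf_section1 (x : XB) jb).
apply: (@jbmf_SL _ _ XB SB R n.+1 (fun g (y : XB) => f (real_act g y)) _ C _ _ _ mr) => //.
- move=> g; have mf := borel_continuous_measurable cf.
  exact: (measurableT_comp mf (@real_act_measurable R n.+1 g)).
- move=> g y e e0; have [d d0 [N N0 hd]] := SLQ_continuous_near (real_act g y) cf e0.
  exists d => // h hh; have k1 : Kcong N (1%g : SL n.+1 fin_adele) by exact: Kcong1.
  have := hd _ 1%g hh k1.
  by rewrite -SL_iotaE -/(real_act _ _) -real_actM mulVKg => /ltW.
Qed.

(** An open set B of directions pulls back to an open set A of vectors, where [avgF_cvg] applies.
    Open sets form a pi-system generating the Borel sets, and [transfer_ac] concludes with c the
    mean of phi. *)
Lemma translate_cvg_test C L N phi : test_fun C L N phi ->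
  \int[lambda]_v translate phi (t j) v @[j --> \oo] --> \int[mu]_y phi y.
Proof.
move=> pt; have cphi := test_fun_continuous pt; have phiC := phi_bound pt.
have bt j := bmf_translate (t j) cphi phiC.
have GI : setI_closed (@open (sphere R n)) by move=> B D; exact: openI.
have lam1 : fine (lambda setT) = 1 by rewrite probability_setT.
rewrite -[X in _ --> X]mulr1 -[X in _ * X]lam1.
apply: (@transfer_ac _ SB R (direction_measure v0) lambda (@open (sphere R n)) GI openT erefl
  (fun j => translate phi (t j) : SB -> R) C) => //.
- by move=> j; case: (bt j).
- by move=> j v; exact: phiC.
- move=> B oB.
  have mB : measurable (B : set SB) by exact: borel_open_measurable.
  pose A : set V := @nrm R n @^-1` B `&` Omega2 v0.
  have oA : open A.
    rewrite openE => z [Bz Oz]; apply: (@filterI _ _ (nbhs_filter z)); last first.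
      by apply: open_nbhs_nbhs; split => //; exact: Omega2_open.
    suff : (nrm w @[w --> z]) B by [].
    by apply: nrm_continuous; [exact: (Omega_neq0 (proj1 Oz))|exact: open_nbhs_nbhs].
  have AO : A `<=` Omega v0 by move=> z [_ []].
  have mA : measurable (A : set VB) by exact: borel_open_measurable.
  have A2 : A `<=` Omega2 v0 by move=> z [].
  have Aoo : (@ell R n A < +oo)%E by apply: le_lt_trans (outer_le A2) _; exact: Omega2_finite.
  rewrite (_ : (fun j => _) = fun j => avgF K phi mA Aoo (t j) x).
    exact: (avgF_cvg K_e1 K_smooth mu_inv pt oA AO mA Aoo n_gt0 t_ge0 t_oo).
  apply/funext => j.
  have bh : bmf (fun v : SB => \1_B v * translate phi (t j) v) by apply: bmfM => //; exact: bmf_indic.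
  have bk : bmf (fun z : VB => translate phi (t j) (nrm z)).
    exact: (bmf_comp (bt j) (@nrm_measurable R n)).
  have bhk : bmf (fun z : VB => \1_B (nrm z) * translate phi (t j) (nrm z)).
    exact: (bmf_comp bh (@nrm_measurable R n)).
  set m2 := Omega2_measurable v0; set f2 := Omega2_finite v0.
  apply: etrans (esym (int_direction v0 bh)) _.
  apply: etrans (restr_int_sub m2 m2 f2 f2 (@subset_refl _ _) bhk) _.
  apply: esym; apply: etrans (restr_int_sub mA m2 Aoo f2 A2 bk) _.
  congr Rintegral; apply/funext => z; rewrite [RHS]mulrA; congr (_ * _).
  by rewrite !indicE in_setI -natrM mulnb andbC; congr ((_ && _)%:R).
- by move=> P /(sphere_lebesgue_ac n_gt0) /lambda_ac.
Qed.

(** The regularisations [reg f m] lie below f and their means converge to that of f, so one of them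
    yields the lower bound. The upper bound comes from -f in [translate_cvg]. *)
Lemma translate_liminf (f : X -> R) C (e : R) : continuous f -> (forall y, `|f y| <= C) -> 0 < e ->
  \forall j \near \oo, \int[mu]_y f y - e <= \int[lambda]_v translate f (t j) v.
Proof.
move=> cf fC e0; have e2 : 0 < e / 2 by rewrite divr_gt0.
have half (a b c : R) : a - e / 2 <= b -> b - e / 2 <= c -> a - e <= c by lra.
have bt := fun m => test_fun_continuous (reg_test_fun fC m).
have mreg m : measurable_fun setT (reg f m : XB -> R) by exact: borel_continuous_measurable.
have [|||_ mu_reg] := @bounded_convergence _ XB R mu (fun m => reg f m : XB -> R) f C.
- by [].
- by move=> m y; exact: reg_bound.
- move=> y; apply/cvgrPdist_le => d d0; have [m0 hm] := reg_cvg fC y cf d0.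
  exists m0 => // m /= mm; rewrite ger0_norm ?subr_ge0 ?(reg_le fC)//.
  by rewrite lerBlDr addrC -lerBlDr; exact: hm.
have /cvgrPdist_le/(_ _ e2)[m _ /(_ m (leqnn m)) hm] := mu_reg.
have := translate_cvg_test (reg_test_fun fC m) => /cvgrPdist_le/(_ _ e2).
apply: filterS => j hj; apply: (half _ (\int[mu]_y reg f m y)).
  by rewrite lerBlDr addrC -lerBlDr; apply: le_trans hm; exact: ler_norm.
apply: (@le_trans _ _ (\int[lambda]_v translate (reg f m) (t j) v)).
  by rewrite lerBlDr addrC -lerBlDr; apply: le_trans hj; exact: ler_norm.
apply: bmf_int_le; [exact: (bmf_translate _ (bt m) (reg_bound fC m))|exact: (bmf_translate _ cf fC)|].
by move=> v; exact: reg_le.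
Qed.

Lemma translate_cvg (f : X -> R) C : continuous f -> (forall y, `|f y| <= C) ->
  \int[lambda]_v translate f (t j) v @[j --> \oo] --> \int[mu]_y f y.
Proof.
move=> cf fC; apply/cvgrPdist_le => e e0.
have cN : continuous (fun y => - f y) by move=> y; apply: (@continuous_comp X R R f -%R); [exact: cf|exact: opp_continuous].
have fNC y : `|- f y| <= C by rewrite normrN.
have bf : bmf (f : XB -> R) by split; [exact: borel_continuous_measurable|exists C].
apply: filterS2 (translate_liminf cf fC e0) (translate_liminf cN fNC e0) => j h1 h2.
have bj := bmf_translate (t j) cf fC.
have eN : \int[lambda]_v translate (fun y => - f y) (t j) v = - \int[lambda]_v translate f (t j) v.
  rewrite -mulN1r -bmf_intZ//; congr Rintegral; apply/funext => v; by rewrite mulN1r.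
have eM : \int[mu]_y - f y = - \int[mu]_y f y.
  rewrite -mulN1r -bmf_intZ//; congr Rintegral; apply/funext => v; by rewrite mulN1r.
by rewrite eN eM in h2; rewrite ler_norml; apply/andP; split; lra.
Qed.

End equidistribution.

Theorem theorem4p2 (R : realType) (n : nat) (hd : (2 <= n.+1)%N)
  (K : sphere R n -> SL n.+1 R)
  (K_SO : forall v, SO (K v))
  (K_e1 : forall v, sphere_val v *m K v = delta_mx 0 0)
  (K_smooth : exists v0, forall v, v != v0 -> smooth_at (fun w => SL_mx (K w)) v)
  (mu : probability (borel (SLQ_quot n.+1 R)) R)
  (mu_invariant : forall (g : SL n.+1 (adele R)) (A : set (borel (SLQ_quot n.+1 R))),
     measurable A -> mu (SLQ_rtrans g @^-1` A) = mu A)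
  (f : SLQ_quot n.+1 R -> R)
  (f_continuous : continuous f)
  (f_bounded : exists C : R, forall x, `|f x| <= C)
  (M : SL n.+1 (adele R))
  (lambda : probability (borel (sphere R n)) R)
  (lambda_ac : lambda `<< @sphere_lebesgue R n) :
  (\int[lambda]_v f (SLQ_coset (M * SL_iota (K v * Phi n.+1 t))%g))
    @[t --> +oo] --> (\int[mu]_x f x : R).
Proof.
have [v0 Ks] := K_smooth; have [C fC] := f_bounded.
apply/cvg_pinftyP => u u_oo.
(* Limits are taken along sequences for the sake of dominated convergence. The contraction estimates
   hold for t >= 0, so negative terms are replaced by 0, which changes nothing eventually. *)
pose t j := Num.max 0 (u j).
have t0 j : 0 <= t j by rewrite le_max lexx.
have ut : \forall j \near \oo, t j = u j.
  have /cvgryPge/(_ 0) := u_oo; apply: filterS => j uj.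
  by rewrite /t; apply/max_idPr.
have t_oo : t j @[j --> \oo] --> +oo.
  apply: cvg_trans u_oo; apply: near_eq_cvg.
  by apply: filterS ut => j ->.
have := translate_cvg hd K_e1 Ks mu_invariant lambda_ac (SLQ_coset M) t0 t_oo f_continuous fC.
apply: cvg_trans; apply: near_eq_cvg; apply: filterS ut => j ->.
by congr Rintegral; apply/funext => v; rewrite /translate /real_act SLQ_rtransE.
Qed.
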